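(* Assume $0<\epsilon\lesssim k^2$, $hk\lesssim 1$, and that the penalty parameter $\eta$ is sufficiently large. Then there exist constants $C_1,C_2>0$ independent of the mesh size such that $$\|P^{-1}A_\epsilon \boldsymbol v\|_P\le C_1\Lambda_m^2\,\|\boldsymbol v\|_P,\qquad \forall\,\boldsymbol v\in\mathbb C^{n_e},$$ $$|(P^{-1}A_\epsilon \boldsymbol v,\boldsymbol v)_P|\ge C_2\frac{\epsilon}{k^2}\,(\boldsymbol v,\boldsymbol v)_P,\qquad \forall\,\boldsymbol v\in\mathbb C^{n_e}.$$
   Context: Mesh. $\Omega\subset\mathbb R^d$ ($d=2,3$) is a bounded polygonal/polyhedral domain with Lipschitz boundary. $\mathcal T_h$ is a mesh of $\Omega$ into disjoint open triangles/tetrahedra, $h_K=\mathrm{diam}(K)$, $h=\max_K h_K$, quasi-uniform: $h\le\nu\min_K\rho_K$ for a fixed $\nu>0$, where $\rho_K$ is the diameter of the largest ball inscribed in $K$. $\mathcal E_h^i,\mathcal E_h^b$ are the sets of interior and boundary $(d-1)$-dimensional faces, $\mathcal E_h=\mathcal E_h^i\cup\mathcal E_h^b$, $h_e=\mathrm{diam}(e)$. On an interior face $e=\partial K^+\cap\partial K^-$: $[\![v]\!]=v^+-v^-$, $\{v\}=\frac12(v^++v^-)$ (same average for vectors), and $\boldsymbol n$ is the unit normal to $e$ pointing from $K^+$ to $K^-$. All function spaces are complex-valued. ''Constant independent of the mesh size'' means independent of $h$ (uniform over the family of meshes considered); $A\lesssim B$ means $A\le cB$ with such a constant $c$. ''$\eta$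 sufficiently large'' means $\eta\ge\eta_0$ for some $\eta_0$ independent of the mesh size. Reconstruction. $U_h^0$ is the space of piecewise constant functions on $\mathcal T_h$, with basis of characteristic functions $e_K$, $K\in\mathcal T_h$. Each element $K$ has a fixed collocation point $\boldsymbol x_K$ inside $K$. Fix an integer $m\ge1$ and a threshold integer $\#S$. Set $S_0(K)=\{K\}$ and let $S_t(K)$ consist of $S_{t-1}(K)$ together with all elements sharing a face with an element of $S_{t-1}(K)$; $S(K)=S_t(K)$ for the first $t$ with $\#S_t(K)\ge\#S$ ($S(K)$ also denotes the union of its elements). $I(K)=\{\boldsymbol x_{\widetilde K}:\widetilde K\in S(K)\}$. Standing assumption: for every $K$ and every polynomial $p$ of degree $\le m$, $p|_{I(K)}=0$ implies $p\equiv0$ on $S(K)$. For $g\in U_h^0$, $\mathcal R_Kg$ is the unique minimizer of $\sum_{\boldsymbol x\in I(K)}|p(\boldsymbol x)-g(\boldsymbol x)|^2$ over polynomials $p\in\mathbb P^m(S(K))$ subject to $p(\boldsymbol x_K)=g(\boldsymbol x_K)$. The linear operator $\mathcal R$ is $(\mathcal Rg)|_K=(\mathcal R_Kg)|_K$; $U_h^m=\mathcal R U_h^0$, with basis $\lambda_K=\mathcal Re_K$. Set $\Lambda(m,S(K))=\max_{p\in\mathbb P_m(S(K))}\frac{\max_{\boldsymbol x\in S(K)}|p(\boldsymbol x)|}{\max_{\boldsymbol x\in I(K)}|p(\boldsymbol x)|}$ and $\Lambda_m=\max_{K\in\mathcal T_h}\bigl(1+\Lambda(m,S(K))\sqrt{\#S(K)}\bigr)$.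 Forms. $k>0$ is the wavenumber, $\epsilon>0$ the absorption, $\mu=\eta/h_e$ on $e$, $\mathrm i=\sqrt{-1}$. $$A_h(u,v)=\sum_{K}\int_K\nabla u\cdot\overline{\nabla v}\,dx-\sum_{e\in\mathcal E_h^i}\int_e\bigl([\![u]\!]\,\boldsymbol n\cdot\{\overline{\nabla v}\}+[\![\overline v]\!]\,\boldsymbol n\cdot\{\nabla u\}\bigr)ds+\sum_{e\in\mathcal E_h^i}\mathrm i\int_e\mu[\![u]\!][\![\overline v]\!]\,ds,$$ $$a_h(u,v)=A_h(u,v)-(k^2-\mathrm i\epsilon)\sum_K\int_Ku\overline v\,dx+\sum_{e\in\mathcal E_h^b}\int_e\mathrm i k\,u\overline v\,ds.$$ For $u_h,v_h\in U_h^0$, $$a_h^0(u_h,v_h)=\sum_{e\in\mathcal E_h^i}\int_e\eta h^{-1}[\![u_h]\!][\![\overline{v_h}]\!]\,ds+\sum_K\int_Kk^2u_h\overline{v_h}\,dx+\sum_{e\in\mathcal E_h^b}\int_ek\,u_h\overline{v_h}\,ds.$$ Matrices. $n_e$ is the number of elements of $\mathcal T_h$. $A_\epsilon\in\mathbb C^{n_e\times n_e}$ is the matrix of $a_h$ in the basis $\{\lambda_K\}$ of $U_h^m$, and $P\in\mathbb C^{n_e\times n_e}$ is the matrix of $a_h^0$ in the basis $\{e_K\}$ of $U_h^0$ (same ordering of elements), so that for $v_h=\sum_Kv_Ke_K$ and $\boldsymbol v=(v_K)$ one has $\boldsymbol v^*A_\epsilon\boldsymbol v=a_h(\mathcal Rv_h,\mathcal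 Rv_h)$ and $\boldsymbol v^*P\boldsymbol v=a_h^0(v_h,v_h)$. $P$ is Hermitian positive definite; $(\boldsymbol u,\boldsymbol v)_P=\boldsymbol v^*P\boldsymbol u$ and $\|\boldsymbol v\|_P^2=\boldsymbol v^*P\boldsymbol v$. *)

(* Defs.v *)
(* MathComp, MathComp-Analysis, real-closed (R[i]) and multinomials. *)
From HB Require Import structures.
From mathcomp Require Import all_boot all_order all_algebra.
From mathcomp Require Import complex.
From mathcomp Require Import all_classical all_reals all_analysis.
From mathcomp Require mpoly.

Set Implicit Arguments.
Unset Strict Implicit.
Unset Printing Implicit Defensive.

Import Order.TTheory GRing.Theory Num.Theory numFieldNormedType.Exports.
Import ComplexField.Normc.
(* mpoly's notations clash with those of analysis. *)
Import(canonicals, coercions) mpoly.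

Local Open Scope classical_set_scope.
Local Open Scope ring_scope.
Local Open Scope complex_scope.

(** * Euclidean geometry of 'rV[R]_n
    The library norm on 'rV[R]_n is the sup norm; it is used only through its
    topology and its bounded sets. *)

Definition dotp (R : realType) (n : nat) (x y : 'rV[R]_n) : R :=
  \sum_(i < n) x 0 i * y 0 i.

Definition enorm (R : realType) (n : nat) (x : 'rV[R]_n) : R :=
  Num.sqrt (dotp x x).

Definition diam (R : realType) (n : nat) (A : set 'rV[R]_n) : R :=
  sup [set r | exists x y, [/\ A x, A y & r = enorm (x - y)]].

Definition inscribed_diam (R : realType) (n : nat) (A : set 'rV[R]_n) : R :=
  sup [set D | exists c r,
    [/\ 0 < r, [set y | enorm (y - c) < r] `<=` A & D = 2 * r]].

(* convex hull of the points [a j], j in J *)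
Definition hull (R : realType) (n q : nat) (a : 'I_q -> 'rV[R]_n)
    (J : {set 'I_q}) : set 'rV[R]_n :=
  [set x | exists w : 'I_q -> R,
    [/\ forall j, 0 <= w j, forall j, j \notin J -> w j = 0,
        \sum_j w j = 1 & x = \sum_j w j *: a j]].

Definition open_simplex (R : realType) (n q : nat) (a : 'I_q -> 'rV[R]_n) :
    set 'rV[R]_n :=
  [set x | exists w : 'I_q -> R,
    [/\ forall j, 0 < w j, \sum_j w j = 1 & x = \sum_j w j *: a j]].

(** * Domains *)

Definition bnd (R : realType) (d : nat) (Omega : set 'rV[R]_d.+1) :
    set 'rV[R]_d.+1 :=
  closure Omega `\` Omega°.

(* Near each boundary point x, in the rigid coordinates z = (y - x)Q, the
   domain is the strict epigraph of a Lipschitz function of d variables; the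
   height is the coordinate of index 0. *)
Definition lipschitz_boundary (R : realType) (d : nat)
    (Omega : set 'rV[R]_d.+1) : Prop :=
  forall x, bnd Omega x ->
  exists (Q : 'M[R]_d.+1) (phi : 'rV[R]_d -> R) (L : R),
    [/\ Q *m Q^T = 1%:M,
        forall s t, `|phi s - phi t| <= L * enorm (s - t) &
        \forall y \near x,
          Omega y <->
          phi (\row_i ((y - x) *m Q) 0 (lift ord0 i)) < ((y - x) *m Q) 0 ord0].

(* The closure is a finite union of polytopes (convex hulls of finite sets). *)
Definition polyhedral (R : realType) (d : nat) (Omega : set 'rV[R]_d.+1) :
    Prop :=
  exists (p q : nat) (a : 'I_p -> 'I_q -> 'rV[R]_d.+1),
    closure Omega = [set x | exists i, hull (a i) finset.setT x].

Definition polyhedral_lipschitz_domain (R : realType) (d : nat)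
    (Omega : set 'rV[R]_d.+1) : Prop :=
  [/\ [/\ open Omega, connected Omega & Omega !=set0], bounded_set Omega,
      polyhedral Omega & lipschitz_boundary Omega].

(** * Integration *)

(* Lebesgue integral over R^n, as n iterated Lebesgue integrals over R. *)
Fixpoint iint (R : realType) (n : nat) : ('rV[R]_n -> R) -> R :=
  match n with
  | 0 => fun f => f 0
  | n'.+1 => fun f => \int[lebesgue_measure]_(t in [set: R])
      iint (fun y : 'rV[R]_n' => f (row_mx t%:M y : 'rV[R]_(1 + n')))
  end.

Definition int_on (R : realType) (n : nat) (A : set 'rV[R]_n)
    (f : 'rV[R]_n -> R[i]) : R[i] :=
  iint (fun x => \1_A x * complex.Re (f x))
  +i* iint (fun x => \1_A x * complex.Im (f x)).

Definition ref_simplex (R : realType) (n : nat) : set 'rV[R]_n :=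
  [set t | (forall i, 0 <= t 0 i) /\ \sum_i t 0 i <= 1].

Definition edges (R : realType) (n q : nat) (a : 'I_q.+1 -> 'rV[R]_n) :
    'M[R]_(q, n) :=
  \matrix_(i < q, j < n) (a (lift ord0 i) 0 j - a ord0 0 j).

(* Surface integral over the q-dimensional simplex with vertices a, through its
   affine parametrization by the reference simplex; the surface element is the
   square root of the Gram determinant. *)
Definition surf_int (R : realType) (n q : nat) (a : 'I_q.+1 -> 'rV[R]_n)
    (f : 'rV[R]_n -> R[i]) : R[i] :=
  (Num.sqrt (\det (edges a *m (edges a)^T)))%:C
  * int_on (@ref_simplex R q) (fun t => f (a ord0 + t *m edges a)).

(** * Meshes
    A mesh with N elements in dimension d.+1: element K is the open simplex
    with the d.+2 vertices [T K j]. *)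

Definition mesh (R : realType) (d N : nat) := 'I_N -> 'I_d.+2 -> 'rV[R]_d.+1.

Definition elt (R : realType) (d N : nat) (T : mesh R d N) (K : 'I_N) :
    set 'rV[R]_d.+1 := open_simplex (T K).

(* Nondegenerate, pairwise disjoint elements, whose closures cover the closure
   of the domain and meet along common (possibly empty) subsimplices. *)
Definition is_mesh (R : realType) (d N : nat) (Omega : set 'rV[R]_d.+1)
    (T : mesh R d N) : Prop :=
  [/\ forall K, edges (T K) \in unitmx,
      forall K L, K != L -> elt T K `&` elt T L = set0,
      closure Omega = [set x | exists K, hull (T K) finset.setT x] &
      forall K L, K != L -> exists I J : {set 'I_d.+2},
        hull (T K) finset.setT `&` hull (T L) finset.setT = hull (T K) I
        /\ hull (T K) I = hull (T L) J].

Definition hK (R : realType) (d N : nat) (T : mesh R d N) (K : 'I_N) : R :=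
  diam (elt T K).

Definition rhoK (R : realType) (d N : nat) (T : mesh R d N) (K : 'I_N) : R :=
  inscribed_diam (elt T K).

Definition hmax (R : realType) (d N : nat) (T : mesh R d N) : R :=
  \big[Num.max/0]_(K < N) hK T K.

Definition quasi_uniform (R : realType) (d N : nat) (nu : R) (T : mesh R d N) :
    Prop :=
  forall K, hmax T <= nu * rhoK T K.

(* A local face (K, j) is the face of K opposite to its j-th vertex. *)
Definition lface (d N : nat) : finType := ('I_N * 'I_d.+2)%type.

Definition fvert (R : realType) (d N : nat) (T : mesh R d N) (F : lface d N) :
    'I_d.+1 -> 'rV[R]_d.+1 :=
  fun j => T F.1 (lift F.2 j).

Definition face (R : realType) (d N : nat) (T : mesh R d N) (F : lface d N) :
    set 'rV[R]_d.+1 := hull (fvert T F) finset.setT.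

Definition hF (R : realType) (d N : nat) (T : mesh R d N) (F : lface d N) : R :=
  diam (face T F).

(* An interior face is listed once, as a pair of coinciding local faces of
   K+ = F.1.1 and K- = F.2.1; the orientation by element numbers is a
   convention under which the forms below are invariant. *)
Definition ifaces (R : realType) (d N : nat) (T : mesh R d N) :
    pred (lface d N * lface d N) :=
  fun F => (F.1.1 < F.2.1)%N && `[< face T F.1 = face T F.2 >].

Definition bfaces (R : realType) (d N : nat) (Omega : set 'rV[R]_d.+1)
    (T : mesh R d N) : pred (lface d N) :=
  fun F => `[< face T F `<=` bnd Omega >].

Definition is_normal (R : realType) (d N : nat) (T : mesh R d N)
    (F : lface d N * lface d N) (n : 'rV[R]_d.+1) : Prop :=
  [/\ enorm n = 1,
      forall x y, face T F.1 x -> face T F.1 y -> dotp n (x - y) = 0 &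
      forall x y, elt T F.1.1 x -> elt T F.2.1 y -> 0 < dotp n (y - x)].

Definition normal (R : realType) (d N : nat) (T : mesh R d N)
    (F : lface d N * lface d N) : 'rV[R]_d.+1 :=
  xget 0 [set n | is_normal T F n].

(** * Piecewise polynomials *)

Notation cpoly R n := (mpoly.mpoly n (complex R)).

Definition peval (R : realType) (n : nat) (p : cpoly R n) (x : 'rV[R]_n) :
    R[i] :=
  mpoly.meval (fun i => (x 0 i)%:C) p.

(* mmeasure mdeg is the total degree plus one (0 for the zero polynomial). *)
Definition deg_le (R : realType) (n m : nat) (p : cpoly R n) : Prop :=
  (mpoly.mmeasure mpoly.mdeg p <= m.+1)%N.

Definition pdiff (R : realType) (n : nat) (i : 'I_n) (p : cpoly R n) :
    cpoly R n := mpoly.mderiv i p.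

Definition bpoly (R : realType) (d N : nat) := 'I_N -> cpoly R d.+1.

(* Elements of U_h^0 are given by their values, i.e. by their coordinates in
   the basis of characteristic functions. *)
Definition pw0 (R : realType) (d N : nat) (g : 'I_N -> R[i]) : bpoly R d N :=
  fun K => mpoly.mpolyC d.+1 (g K).

Definition charf (R : realType) (N : nat) (K : 'I_N) : 'I_N -> R[i] :=
  fun L => (L == K)%:R.

(** * Patches and reconstruction *)

Definition adjacent (R : realType) (d N : nat) (T : mesh R d N)
    (K L : 'I_N) : Prop :=
  K != L /\ exists i j, face T (K, i) = face T (L, j).

Fixpoint layer (R : realType) (d N : nat) (T : mesh R d N) (t : nat)
    (K : 'I_N) : {set 'I_N} :=
  match t with
  | 0 => [set K]%SET
  | t'.+1 => (layer T t' K :|: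
      [set L | `[< exists2 M, M \in layer T t' K & adjacent T M L >]])%SET
  end.

(* The layer number is the first t with at least thr elements in layer t. *)
Definition patch (R : realType) (d N : nat) (T : mesh R d N) (thr : nat)
    (K : 'I_N) : {set 'I_N} :=
  layer T (xget 0%N [set t | (thr <= #|layer T t K|)%N /\
                       forall s, (s < t)%N -> (#|layer T s K| < thr)%N]) K.

Definition patch_dom (R : realType) (d N : nat) (T : mesh R d N) (thr : nat)
    (K : 'I_N) : set 'rV[R]_d.+1 :=
  [set x | exists2 L, L \in patch T thr K & elt T L x].

Definition unisolvent (R : realType) (d N : nat) (T : mesh R d N)
    (xc : 'I_N -> 'rV[R]_d.+1) (m thr : nat) : Prop :=
  forall K (p : cpoly R d.+1), deg_le m p ->
    (forall L, L \in patch T thr K -> peval p (xc L) = 0) ->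
    forall x, patch_dom T thr K x -> peval p x = 0.

Definition lsq (R : realType) (d N : nat) (T : mesh R d N)
    (xc : 'I_N -> 'rV[R]_d.+1) (thr : nat) (K : 'I_N) (g : 'I_N -> R[i])
    (p : cpoly R d.+1) : R :=
  \sum_(L in patch T thr K) normc (peval p (xc L) - g L) ^+ 2.

Definition is_fit (R : realType) (d N : nat) (T : mesh R d N)
    (xc : 'I_N -> 'rV[R]_d.+1) (m thr : nat) (K : 'I_N) (g : 'I_N -> R[i])
    (p : cpoly R d.+1) : Prop :=
  [/\ deg_le m p, peval p (xc K) = g K &
      forall q : cpoly R d.+1, deg_le m q -> peval q (xc K) = g K ->
        lsq T xc thr K g p <= lsq T xc thr K g q].

Definition recon (R : realType) (d N : nat) (T : mesh R d N)
    (xc : 'I_N -> 'rV[R]_d.+1) (m thr : nat) (g : 'I_N -> R[i]) :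
    bpoly R d N :=
  fun K => xget 0 [set p | is_fit T xc m thr K g p].

(* Elements are open, so the maximum over the patch is a supremum. *)
Definition Lambda (R : realType) (d N : nat) (T : mesh R d N)
    (xc : 'I_N -> 'rV[R]_d.+1) (m thr : nat) (K : 'I_N) : R :=
  sup [set r | exists p : cpoly R d.+1,
    [/\ deg_le m p, p != 0 &
        r = sup [set normc (peval p x) | x in patch_dom T thr K]
            / \big[Num.max/0]_(L in patch T thr K) normc (peval p (xc L))]].

Definition Lambda_m (R : realType) (d N : nat) (T : mesh R d N)
    (xc : 'I_N -> 'rV[R]_d.+1) (m thr : nat) : R :=
  \big[Num.max/0]_(K < N)
    (1 + Lambda T xc m thr K * Num.sqrt (#|patch T thr K|%:R)).

(** * Sesquilinear forms *)

Definition jump (R : realType) (d N : nat) (u : bpoly R d N)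
    (F : lface d N * lface d N) (x : 'rV[R]_d.+1) : R[i] :=
  peval (u F.1.1) x - peval (u F.2.1) x.

(* n . {grad u} *)
Definition avg_dn (R : realType) (d N : nat) (T : mesh R d N) (u : bpoly R d N)
    (F : lface d N * lface d N) (x : 'rV[R]_d.+1) : R[i] :=
  \sum_(l < d.+1) (normal T F 0 l)%:C *
    ((peval (pdiff l (u F.1.1)) x + peval (pdiff l (u F.2.1)) x) / 2).

Definition mass (R : realType) (d N : nat) (T : mesh R d N)
    (u v : bpoly R d N) : R[i] :=
  \sum_(K < N) int_on (elt T K) (fun x => peval (u K) x * (peval (v K) x)^*).

Definition bmass (R : realType) (d N : nat) (Omega : set 'rV[R]_d.+1)
    (T : mesh R d N) (u v : bpoly R d N) : R[i] :=
  \sum_(F : lface d N | bfaces Omega T F)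
    surf_int (fvert T F) (fun x => peval (u F.1) x * (peval (v F.1) x)^*).

Definition A_h (R : realType) (d N : nat) (T : mesh R d N) (eta : R)
    (u v : bpoly R d N) : R[i] :=
  \sum_(K < N) int_on (elt T K) (fun x =>
     \sum_(l < d.+1) peval (pdiff l (u K)) x * (peval (pdiff l (v K)) x)^*)
  - \sum_(F | ifaces T F) surf_int (fvert T F.1) (fun x =>
       jump u F x * (avg_dn T v F x)^* + (jump v F x)^* * avg_dn T u F x)
  + \sum_(F | ifaces T F) 'i * surf_int (fvert T F.1) (fun x =>
       (eta / hF T F.1)%:C * jump u F x * (jump v F x)^*).

Definition a_h (R : realType) (d N : nat) (Omega : set 'rV[R]_d.+1)
    (T : mesh R d N) (eta k eps : R) (u v : bpoly R d N) : R[i] :=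
  A_h T eta u v - ((k ^+ 2)%:C - 'i * eps%:C) * mass T u v
  + 'i * k%:C * bmass Omega T u v.

Definition a_h0 (R : realType) (d N : nat) (Omega : set 'rV[R]_d.+1)
    (T : mesh R d N) (eta k : R) (u v : bpoly R d N) : R[i] :=
  \sum_(F | ifaces T F) surf_int (fvert T F.1) (fun x =>
       (eta / hmax T)%:C * jump u F x * (jump v F x)^*)
  + (k ^+ 2)%:C * mass T u v + k%:C * bmass Omega T u v.

(** * Matrices *)

(* The entry (K, L) is the form at (L-th, K-th) basis functions, so that
   v^* A v is the form evaluated at (v, v). *)
Definition A_eps (R : realType) (d N : nat) (Omega : set 'rV[R]_d.+1)
    (T : mesh R d N) (xc : 'I_N -> 'rV[R]_d.+1) (m thr : nat) (eta k eps : R) :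
    'M[R[i]]_N :=
  \matrix_(K, L) a_h Omega T eta k eps (recon T xc m thr (charf R L))
                                       (recon T xc m thr (charf R K)).

Definition P_mx (R : realType) (d N : nat) (Omega : set 'rV[R]_d.+1)
    (T : mesh R d N) (eta k : R) : 'M[R[i]]_N :=
  \matrix_(K, L) a_h0 Omega T eta k (pw0 d (charf R L)) (pw0 d (charf R K)).

Definition ipP (R : realType) (N : nat) (P : 'M[R[i]]_N)
    (u v : 'cV[R[i]]_N) : R[i] :=
  (map_mx (@conjc R) v^T *m P *m u) 0 0.

Definition normP (R : realType) (N : nat) (P : 'M[R[i]]_N)
    (v : 'cV[R[i]]_N) : R :=
  Num.sqrt (complex.Re (ipP P v v)).

(** * Admissible discretizations *)

(* The fourth condition says that every patch reaches the threshold. *)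
Definition admissible (R : realType) (d N : nat) (Omega : set 'rV[R]_d.+1)
    (nu : R) (m thr : nat) (T : mesh R d N) (xc : 'I_N -> 'rV[R]_d.+1) : Prop :=
  [/\ is_mesh Omega T, quasi_uniform nu T, forall K, elt T K (xc K),
      forall K, exists t, (thr <= #|layer T t K|)%N &
      unisolvent T xc m thr].

(* Main.v *)
Require Import Defs.
From HB Require Import structures.
From mathcomp Require Import all_boot all_order all_algebra.
From mathcomp Require Import complex.
From mathcomp Require Import ring lra.
From mathcomp Require Import all_classical all_reals all_analysis.
From mathcomp Require Import perm measurable_realfun.
From mathcomp Require mpoly.
Import Order.TTheory GRing.Theory Num.Theory numFieldNormedType.Exports.
Import ComplexField.Normc.
Import(canonicals, coercions) mpoly.
Local Open Scope classical_set_scope.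
Local Open Scope ring_scope.
Local Open Scope complex_scope.

Set Implicit Arguments.
Unset Strict Implicit.
Unset Printing Implicit Defensive.

(** Write h for the mesh size, and E(u) for the sum of the squared broken gradient of u, of its
    squared jumps times 1/h, of its squared mass times k^2 and of its squared boundary values
    times k. Each element contains a cube of side comparable to h, so piecewise polynomials of
    degree at most m satisfy trace, inverse and Poincare inequalities with constants that do not
    depend on the mesh. They give |a_h(u,w)| <= C (E(u) + E(w)) and, from the imaginary and then
    the real part of a_h(u,u), the coercivity E(u) <= C (k^2/eps) |a_h(u,u)|.

    If u takes the values v_K at the collocation points, the Poincare inequality yields
    v^* P v <= C E(u). As (P^-1 A v, v)_P = a_h(Rv, Rv), this proves the lower bound.

    Conversely, least squares stability bounds |Rv - v_K|^2 on K by 4 Lambda_m^2 times the sum of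
    |v_K - v_L|^2 over the patch of K. Chains of adjacent elements, together with the bounded
    overlap of the patches, control these sums by the jumps, so that
    E(Rv) <= C Lambda_m^2 v^* P v. The upper bound follows by testing with P^-1 A v. *)

(** * Iterated integrals *)

Section IteratedIntegrals.
Variable R : realType.
Implicit Types n : nat.

(** Integrals are iterated one-dimensional integrals. Only their linearity, their monotonicity and
    the volume of an axis-parallel box are established, and no change of variables is made.
    Estimates therefore go through pointwise bounds: a polynomial is bounded at all points near an
    element by its mean square over a cube, one coordinate after the other, and a face integral is
    at most a supremum times an area.

    The penalty carries a factor i, so it cannot absorb the consistency terms, which are real on the
    diagonal. The jumps are bounded from the imaginary part and inserted into the real part. There
    the mass has the wrong sign, and the imaginary part yields only eps times the mass: this is
    where k^2/eps is lost.

    Young's inequality, applied pointwise, replaces Cauchy-Schwarz, so the form is bounded by sums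
    and not by products of norms; rescaling the vectors at the end makes up for this. *)

Definition cons_row n (t : R) (y : 'rV[R]_n) : 'rV[R]_n.+1 :=
  (row_mx t%:M y : 'rV[R]_(1 + n)).

Lemma cons_row0 n t (y : 'rV[R]_n) : cons_row t y 0 ord0 = t.
Proof.
rewrite /cons_row; have -> : ord0 = lshift n (ord0 : 'I_1) by apply/val_inj.
by rewrite (row_mxEl (t%:M : 'M[R]_1)) mxE.
Qed.

Lemma cons_rowS n t (y : 'rV[R]_n) i : cons_row t y 0 (lift ord0 i) = y 0 i.
Proof.
rewrite /cons_row; have -> : lift ord0 i = rshift 1 i by apply/val_inj.
by rewrite (row_mxEr (t%:M : 'M[R]_1)).
Qed.

Lemma iintS n (f : 'rV[R]_n.+1 -> R) :
  iint f = \int[lebesgue_measure]_(t in [set: R]) iint (fun y => f (cons_row t y)).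
Proof. by []. Qed.

(* Measurability is tested on measurable parametrizations: it is then inherited by slices. *)
Definition mble n (f : 'rV[R]_n -> R) : Prop :=
  forall d (Z : measurableType d) (phi : Z -> 'rV[R]_n),
    (forall i, measurable_fun setT (fun z => phi z 0 i)) ->
    measurable_fun setT (fun z => f (phi z)).

Definition joint_mble d (W : measurableType d) n (f : W -> 'rV[R]_n -> R) : Prop :=
  forall d' (Z : measurableType d') (w : Z -> W) (phi : Z -> 'rV[R]_n),
    measurable_fun setT w ->
    (forall i, measurable_fun setT (fun z => phi z 0 i)) ->
    measurable_fun setT (fun z => f (w z) (phi z)).

(** The first coordinate joins the parameter, so the induction hypothesis applies over [W * R].
    Tonelli then makes the integrals of the positive and of the negative part measurable in the
    remaining parameter, without any integrability. *)
Lemma measurable_iint n d (W : measurableType d) (f : W -> 'rV[R]_n -> R) :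
  joint_mble f -> measurable_fun setT (fun w => iint (f w)).
Proof.
elim: n d W f => [|n IH] d W f mf.
  by apply: (mf _ _ id (fun=> 0)) => // i; under eq_fun do rewrite mxE.
pose RT : measurableType _ := measurableTypeR R.
pose T : measurableType _ := (W * RT)%type.
pose g (wt : T) : R := iint (fun y => f wt.1 (cons_row wt.2 y)).
have mg : measurable_fun [set: T] (EFin \o g : T -> \bar R).
  apply/measurable_EFinP; apply: IH => d' Z w phi mw mphi.
  apply: (mf _ _ (fst \o w) (fun z => cons_row (w z).2 (phi z))).
    exact: (measurableT_comp measurable_fst mw).
  move=> i; case: (unliftP ord0 i) => [j ->|->].
    by under eq_fun do rewrite cons_rowS; exact: mphi.
  by under eq_fun do rewrite cons_row0; exact: (measurableT_comp measurable_snd mw).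
rewrite (_ : (fun w => _) = fun w =>
  fine (\int[lebesgue_measure]_t funepos (EFin \o g) (w, t)
        - \int[lebesgue_measure]_t funeneg (EFin \o g) (w, t))%E); last first.
  apply/funext => w; rewrite iintS /Rintegral integralE.
  by congr (fine (_ - _)%E); apply: eq_integral => t _; rewrite ?funeposE ?funenegE.
apply: measurableT_comp => //.
apply: emeasurable_funB.
  apply: (measurable_fun_fubini_tonelli_F (m2 := lebesgue_measure) (funepos (EFin \o g))) => //.
  exact: measurable_funepos.
apply: (measurable_fun_fubini_tonelli_F (m2 := lebesgue_measure) (funeneg (EFin \o g))) => //.
exact: measurable_funeneg.
Qed.

(** The same [M] bounds the values and, in every coordinate, the support. Slices inherit the
    property with the same [M], as inductions on the dimension require. *)
Definition bddby n (M : R) (f : 'rV[R]_n -> R) : Prop :=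
  (forall x, `|f x| <= M) /\ (forall (x : 'rV[R]_n) i, M < `|x 0 i| -> f x = 0).

(** Enough for every intermediate integral to be finite, hence for [iint] to be linear; [Rintegral]
    would send an infinite value to 0. *)
Definition good n (f : 'rV[R]_n -> R) : Prop := mble f /\ exists M, bddby M f.

Lemma mble_comp2 n (op : R -> R -> R) (f g : 'rV[R]_n -> R) :
  (forall d (Z : measurableType d) (a b : Z -> R), measurable_fun setT a ->
     measurable_fun setT b -> measurable_fun setT (fun z => op (a z) (b z))) ->
  mble f -> mble g -> mble (fun x => op (f x) (g x)).
Proof. by move=> mo mf mg d Z phi mphi; apply: mo; [exact: mf|exact: mg]. Qed.

Lemma mble_cst n (c : R) : mble (fun _ : 'rV[R]_n => c).
Proof. by move=> d Z phi _. Qed.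

Lemma mbleD n (f g : 'rV[R]_n -> R) : mble f -> mble g -> mble (fun x => f x + g x).
Proof. by apply: mble_comp2 => *; exact: measurable_funD. Qed.

Lemma mbleM n (f g : 'rV[R]_n -> R) : mble f -> mble g -> mble (fun x => f x * g x).
Proof. by apply: mble_comp2 => *; exact: measurable_funM. Qed.

Lemma mble_coord n (i : 'I_n) : mble (fun x : 'rV[R]_n => x 0 i).
Proof. by move=> d Z phi; exact. Qed.

Lemma mble_comp n p (f : 'rV[R]_n -> R) (phi : 'rV[R]_p -> 'rV[R]_n) :
  mble f -> (forall i, mble (fun x => phi x 0 i)) -> mble (fun x => f (phi x)).
Proof.
move=> mf mphi d Z psi mpsi; apply: (mf _ _ (fun z => phi (psi z))) => i.
exact: mphi.
Qed.

Lemma mble_comp1 n (u : R -> R) (f : 'rV[R]_n -> R) : measurable_fun setT u ->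
  mble f -> mble (fun x => u (f x)).
Proof. by move=> mu mf d Z psi mpsi; exact: measurableT_comp (mf _ _ _ mpsi). Qed.

Lemma bddby_ge0 n M (f : 'rV[R]_n -> R) : bddby M f -> 0 <= M.
Proof. by case=> + _ => /(_ 0); apply: le_trans. Qed.

Lemma good_cst0 n : good (fun _ : 'rV[R]_n => 0).
Proof. by split; [exact: mble_cst|exists 0; split=> // x; rewrite normr0]. Qed.

Lemma good_slice n (f : 'rV[R]_n.+1 -> R) t : good f -> good (fun y => f (cons_row t y)).
Proof.
move=> [mf [M [bf sf]]]; split.
  apply: mble_comp => // i; case: (unliftP ord0 i) => [j ->|->] d Z phi mphi.
    by under eq_fun do rewrite cons_rowS; exact: mphi.
  by under eq_fun do rewrite cons_row0; exact: measurable_cst.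
by exists M; split=> [x|x i h]; [exact: bf|apply: (sf _ (lift ord0 i)); rewrite cons_rowS].
Qed.

Lemma iint0 n : iint (fun _ : 'rV[R]_n => 0) = 0.
Proof.
elim: n => // n IH; rewrite iintS /cons_row.
under eq_Rintegral do rewrite IH.
by rewrite /Rintegral integral0.
Qed.

Lemma iint_ge0 n (f : 'rV[R]_n -> R) : (forall x, 0 <= f x) -> 0 <= iint f.
Proof.
by elim: n f => [|n IH] f f0 //=; apply: Rintegral_ge0 => t _; exact: IH.
Qed.

Lemma integrable_scaled_indic (B a b : R) : lebesgue_measure.-integrable setT
  (EFin \o (fun t : R => B * \1_(`[a, b]%classic : set R) t)).
Proof.
have := integrableZl measurableT B (integrable_indic_itv a b true false).
by congr integrable; apply/funext => t /=; rewrite EFinM.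
Qed.

Lemma integrable_bdd (g : R -> R) M B : measurable_fun setT g ->
  (forall t, `|g t| <= B) -> (forall t, M < `|t| -> g t = 0) ->
  lebesgue_measure.-integrable setT (EFin \o g).
Proof.
move=> mg bg sg.
have B0 : 0 <= B by apply: le_trans (bg 0).
apply: (@le_integrable _ _ R lebesgue_measure setT measurableT _
  (EFin \o (fun t => B * \1_(`[- M, M]%classic : set R) t))).
- exact/measurable_EFinP.
- move=> t _ /=; rewrite lee_fin (ger0_norm (mulr_ge0 _ _))//.
  have [tM|tM] := leP `|t| M.
    by rewrite indicE mem_set ?mulr1//= in_itv/= -ler_norml.
  by rewrite sg// normr0 mulr_ge0.
- exact: integrable_scaled_indic.
Qed.

(** Each integration costs the length [2 * M] of the interval outside of which the slices vanish. *)
Lemma norm_iint_le n (f : 'rV[R]_n -> R) M : mble f -> bddby M f ->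
  `|iint f| <= M * (2 * M) ^+ n.
Proof.
elim: n f => [|n IH] f mf bf; first by rewrite expr0 mulr1; exact: bf.1.
have M0 := bddby_ge0 bf.
have mg : measurable_fun setT (fun t => iint (fun y => f (cons_row t y))).
  apply: measurable_iint => d Z w phi mw mphi; apply: mf => i.
  case: (unliftP ord0 i) => [j ->|->].
    by under eq_fun do rewrite cons_rowS; exact: mphi.
  by under eq_fun do rewrite cons_row0; exact: mw.
have bg t : `|iint (fun y => f (cons_row t y))| <= M * (2 * M) ^+ n.
  apply: IH.
    apply: mble_comp => // i; case: (unliftP ord0 i) => [j ->|->] d Z phi mphi.
      by under eq_fun do rewrite cons_rowS; exact: mphi.
    by under eq_fun do rewrite cons_row0; exact: measurable_cst.
  split=> [x|x i h]; first exact: bf.1.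
  by apply: (bf.2 _ (lift ord0 i)); rewrite cons_rowS.
have sg t : M < `|t| -> iint (fun y => f (cons_row t y)) = 0.
  move=> tM; rewrite -[RHS](iint0 n); congr iint; apply/funext => y.
  by apply: (bf.2 _ ord0); rewrite cons_row0.
have ig := integrable_bdd mg bg sg.
set B := M * (2 * M) ^+ n in bg *.
rewrite iintS; apply: le_trans (le_normr_Rintegral _ ig) _ => //.
have iM : lebesgue_measure.-integrable setT
    (EFin \o (fun t : R => B * \1_(`[- M, M]%classic : set R) t)) by exact: integrable_scaled_indic.
apply: le_trans (_ : \int[lebesgue_measure]_(t in setT) (B * \1_(`[- M, M]%classic : set R) t) <= _).
  apply: le_Rintegral => //.
    have := integrable_norm ig; congr integrable; exact/funext.
  move=> t _; have [tM|tM] := leP `|t| M.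
    by rewrite indicE mem_set ?mulr1 ?bg//= in_itv/= -ler_norml.
  rewrite sg// normr0 mulr_ge0//; apply: mulr_ge0 => //.
  by rewrite exprn_ge0// mulr_ge0.
rewrite /Rintegral; under eq_integral do rewrite EFinM.
rewrite integralZl//; last exact: (integrable_indic_itv (- M) M true false).
rewrite integral_indic// setIT /= (lebesgue_measure_itv `[- M, M]) /= lte_fin.
rewrite exprS [2 * M * _]mulrC mulrA -/B.
have [] := ltP (- M) M => h; rewrite /=; last by rewrite mulr0 mulr_ge0 ?mulr_ge0 ?exprn_ge0 ?mulr_ge0.
by rewrite le_eqVlt; apply/orP; left; apply/eqP; congr (_ * _); lra.
Qed.

Lemma integrable_slices n (f : 'rV[R]_n.+1 -> R) : good f ->
  lebesgue_measure.-integrable setT (EFin \o (fun t => iint (fun y => f (cons_row t y)))).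
Proof.
move=> [mf [M bf]].
apply: (@integrable_bdd _ M (M * (2 * M) ^+ n)).
- apply: measurable_iint => d Z w phi mw mphi; apply: mf => i.
  case: (unliftP ord0 i) => [j ->|->].
    by under eq_fun do rewrite cons_rowS; exact: mphi.
  by under eq_fun do rewrite cons_row0; exact: mw.
- move=> t; apply: norm_iint_le.
    by apply: (good_slice t _).1; split => //; exists M.
  split=> [x|x i h]; first exact: bf.1.
  by apply: (bf.2 _ (lift ord0 i)); rewrite cons_rowS.
- move=> t tM; rewrite -[RHS](iint0 n); congr iint; apply/funext => y.
  by apply: (bf.2 _ ord0); rewrite cons_row0.
Qed.

Lemma iint_lin n (a : R) (f g : 'rV[R]_n -> R) : good f -> good g ->
  iint (fun x => a * f x + g x) = a * iint f + iint g.
Proof.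
elim: n f g => [|n IH] f g gf gg; first by [].
rewrite !iintS.
under eq_Rintegral => t _ do rewrite (IH _ _ (good_slice t gf) (good_slice t gg)).
rewrite RintegralD//.
- by rewrite RintegralZl//; exact: integrable_slices.
- have := integrableZl measurableT a (integrable_slices gf).
  by under eq_fun do rewrite -EFinM.
- exact: integrable_slices.
Qed.

Lemma iint_le n (f g : 'rV[R]_n -> R) : good f -> good g ->
  (forall x, f x <= g x) -> iint f <= iint g.
Proof.
move=> gf gg fg; rewrite -subr_ge0 addrC -mulN1r -iint_lin//.
by apply: iint_ge0 => x; rewrite mulN1r addrC subr_ge0.
Qed.

End IteratedIntegrals.

(** * Locally bounded functions and their integrals over bounded sets *)

Section LocallyBounded.
Variable R : realType.
Implicit Types n : nat.

(** A class closed under sums, products and composition that contains the coordinates, hence the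
    real and imaginary parts of polynomials. Cut off by a bounded measurable set, its members become
    [good]. *)
Definition lbm n (g : 'rV[R]_n -> R) : Prop :=
  mble g /\
  forall M, exists B, forall x : 'rV[R]_n, (forall i, `|x 0 i| <= M) -> `|g x| <= B.

Lemma lbm_cst n (c : R) : lbm (fun _ : 'rV[R]_n => c).
Proof. by split; [exact: mble_cst|move=> M; exists `|c|]. Qed.

Lemma lbm_coord n (i : 'I_n) : lbm (fun x : 'rV[R]_n => x 0 i).
Proof. by split; [exact: mble_coord|move=> M; exists M => x]. Qed.

Lemma lbmD n (f g : 'rV[R]_n -> R) : lbm f -> lbm g -> lbm (fun x => f x + g x).
Proof.
move=> [mf bf] [mg bg]; split; first exact: mbleD.
move=> M; have [B hB] := bf M; have [B' hB'] := bg M; exists (B + B') => x hx.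
by apply: le_trans (ler_normD _ _) _; rewrite lerD ?hB ?hB'.
Qed.

Lemma lbmM n (f g : 'rV[R]_n -> R) : lbm f -> lbm g -> lbm (fun x => f x * g x).
Proof.
move=> [mf bf] [mg bg]; split; first exact: mbleM.
move=> M; have [B hB] := bf M; have [B' hB'] := bg M; exists (B * B') => x hx.
by rewrite normrM ler_pM ?hB ?hB'.
Qed.

Lemma lbmZ n c (f : 'rV[R]_n -> R) : lbm f -> lbm (fun x => c * f x).
Proof. by apply: lbmM; exact: lbm_cst. Qed.

Lemma eq_lbm n (f g : 'rV[R]_n -> R) : f =1 g -> lbm f -> lbm g.
Proof. by move=> /funext ->. Qed.

Lemma lbmN n (f : 'rV[R]_n -> R) : lbm f -> lbm (fun x => - f x).
Proof. by move=> /(lbmZ (-1)); apply: eq_lbm => x; rewrite mulN1r. Qed.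

Lemma lbmB n (f g : 'rV[R]_n -> R) : lbm f -> lbm g -> lbm (fun x => f x - g x).
Proof. by move=> lf lg; apply: lbmD => //; exact: lbmN. Qed.

Lemma lbm_sum n (I : Type) (r : seq I) (P : pred I) (F : I -> 'rV[R]_n -> R) :
  (forall i, P i -> lbm (F i)) -> lbm (fun x => \sum_(i <- r | P i) F i x).
Proof.
move=> lF; elim: r => [|i r IH].
  by apply: eq_lbm (lbm_cst n 0) => x; rewrite big_nil.
case Pi: (P i); last by apply: eq_lbm IH => x; rewrite big_cons Pi.
by apply: eq_lbm (lbmD (lF i Pi) IH) => x; rewrite big_cons Pi.
Qed.

Lemma lbm_comp n p (f : 'rV[R]_n -> R) (phi : 'rV[R]_p -> 'rV[R]_n) :
  lbm f -> (forall i, lbm (fun x => phi x 0 i)) -> lbm (fun x => f (phi x)).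
Proof.
move=> [mf bf] lphi; split; first by apply: mble_comp => // i; exact: (lphi i).1.
move=> M; have /choice[B hB] i := (lphi i).2 M.
have [C hC] := bf (\sum_i `|B i|); exists C => x hx; apply: hC => i.
rewrite (bigD1 i)//=; apply: le_trans (hB i x hx) _.
by apply: le_trans (ler_norm _) _; rewrite lerDl sumr_ge0.
Qed.

Definition bset n (A : set 'rV[R]_n) : Prop :=
  mble (\1_A : _ -> R) /\
  exists M, forall x, A x -> forall i, `|x 0 i| <= M.

Lemma good_on n (A : set 'rV[R]_n) g : bset A -> lbm g -> good (fun x => \1_A x * g x).
Proof.
move=> [mA [M hM]] [mg bg]; split; first exact: mbleM.
have [B hB] := bg M; exists (Num.max M (Num.max 0 B)).
have hA x : \1_A x * g x = if x \in A then g x else 0.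
  by rewrite indicE; case: (x \in A); rewrite ?mul1r ?mul0r.
split=> [x|x i h]; rewrite hA; case: ifPn => // xA.
- rewrite !le_max; apply/orP; right; apply/orP; right; apply: hB.
  by apply: hM; rewrite -in_setE.
- by rewrite normr0 !le_max lexx orbT.
- move: xA h; rewrite in_setE => /hM /(_ i) xM.
  by rewrite gt_max ltNge xM.
Qed.

Definition rint n (A : set 'rV[R]_n) (g : 'rV[R]_n -> R) : R :=
  iint (fun x => \1_A x * g x).

Lemma rint_lin n (A : set 'rV[R]_n) a f g : bset A -> lbm f -> lbm g ->
  rint A (fun x => a * f x + g x) = a * rint A f + rint A g.
Proof.
move=> bA lf lg; rewrite /rint -iint_lin; try exact: good_on.
by congr iint; apply/funext => x; ring.
Qed.

Lemma rint_le n (A B : set 'rV[R]_n) f g : bset A -> bset B -> lbm f -> lbm g ->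
  A `<=` B -> (forall x, A x -> f x <= g x) -> (forall x, B x -> 0 <= g x) ->
  rint A f <= rint B g.
Proof.
move=> bA bB lf lg AB fg g0; apply: iint_le; try exact: good_on.
move=> x; rewrite !indicE; have [xA|xA] := boolP (x \in A).
  have /set_mem/AB/mem_set -> := xA.
  by rewrite !mul1r; apply: fg; rewrite -in_setE.
rewrite mul0r; have [xB|xB] := boolP (x \in B); rewrite ?mul0r// mul1r.
by apply: g0; rewrite -in_setE.
Qed.

Lemma rint_mono n (A : set 'rV[R]_n) f g : bset A -> lbm f -> lbm g ->
  (forall x, A x -> f x <= g x) -> rint A f <= rint A g.
Proof.
move=> bA lf lg fg; apply: iint_le; try exact: good_on.
move=> x; rewrite indicE; have [xA|xA] := boolP (x \in A); rewrite ?mul0r// !mul1r.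
by apply: fg; rewrite -in_setE.
Qed.

Definition box n (b : 'rV[R]_n) (s : R) : set 'rV[R]_n :=
  [set x | forall i, b 0 i <= x 0 i <= b 0 i + s].

Lemma indic_box n (b : 'rV[R]_n) s x :
  \1_(box b s) x = \prod_i \1_(`[b 0 i, b 0 i + s]%classic : set R) (x 0 i) :> R.
Proof.
rewrite indicE; have [/set_mem xB|/negP xB] := boolP (x \in box b s).
  rewrite big1// => i _; rewrite indicE mem_set//=.
  by rewrite in_itv/=; exact: xB.
have [i hi] : exists i, ~ (b 0 i <= x 0 i <= b 0 i + s).
  by apply/existsNP => h; apply: xB; rewrite in_setE.
rewrite (bigD1 i)//= indicE memNset ?mul0r//=.
Qed.

Lemma bset_box n (b : 'rV[R]_n) s : bset (box b s).
Proof.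
split.
  rewrite (_ : \1_(box b s) = fun x : 'rV[R]_n =>
    \prod_i \1_(`[b 0 i, b 0 i + s]%classic : set R) (x 0 i)); last first.
    by apply/funext => x; exact: indic_box.
  elim: (index_enum _) => [|i r IH].
    rewrite (_ : (fun x => _) = fun=> 1); first exact: mble_cst.
    by apply/funext => x; rewrite big_nil.
  rewrite (_ : (fun x => _) = fun x : 'rV[R]_n => \1_(`[b 0 i, b 0 i + s]%classic : set R) (x 0 i) *
     \prod_(j <- r) \1_(`[b 0 j, b 0 j + s]%classic : set R) (x 0 j)); last first.
    by apply/funext => x; rewrite big_cons.
  apply: mbleM => //.
  by apply: mble_comp1; [exact: measurable_indic|exact: mble_coord].
exists (\sum_i (`|b 0 i| + `|b 0 i + s|)) => x xB i.
rewrite (bigD1 i)//= (@le_trans _ _ (`|b 0 i| + `|b 0 i + s|))//; last first.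
  by rewrite lerDl sumr_ge0// => j _; rewrite addr_ge0.
have /andP[h1 h2] := xB i.
by case: (ger0P (x 0 i)) => h; case: (ger0P (b 0 i)) => h3;
  case: (ger0P (b 0 i + s)) => h4; lra.
Qed.

(** Each coordinate contributes the length of an interval. The volumes of elements and of reference
    simplices are only compared with this one, by inclusion. *)
Lemma rint_box n (b : 'rV[R]_n) s : 0 <= s -> rint (box b s) (fun=> 1) = s ^+ n.
Proof.
move=> s0; rewrite /rint.
under [X in iint X]eq_fun do rewrite mulr1 indic_box.
pose c i := b 0 i.
rewrite (_ : (fun x => _) = fun x : 'rV[R]_n =>
  \prod_i \1_(`[c i, c i + s]%classic : set R) (x 0 i))//.
move: c => {}b.
elim: n b => [|n IH] b; first by rewrite /= big_ord0.
rewrite iintS (_ : (fun t => _) = fun t =>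
    s ^+ n * \1_(`[b ord0, b ord0 + s]%classic : set R) t); last first.
  apply/funext => t; rewrite -(IH (fun i => b (lift ord0 i))) mulrC.
  set c := \1_ _ _; have -> : c = c * 1 + 0 :> R by ring.
  have g1 : good (fun x : 'rV[R]_n =>
      \prod_i \1_(`[b (lift ord0 i), b (lift ord0 i) + s]%classic : set R) (x 0 i)).
    have := good_on (bset_box (\row_i b (lift ord0 i)) s) (lbm_cst n 1).
    congr good; apply/funext => x; rewrite mulr1 indic_box.
    by apply: eq_bigr => i _; rewrite mxE.
  rewrite mulr1 addr0 -[RHS]addr0 -[X in _ + X](iint0 R n) -iint_lin//; last exact: good_cst0.
  congr iint; apply/funext => y; rewrite big_ord_recl cons_row0 addr0; congr (_ * _).
  by apply: eq_bigr => i _; rewrite cons_rowS.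
rewrite /Rintegral; under eq_integral do rewrite EFinM.
rewrite integralZl//; last exact: (integrable_indic_itv _ _ true false).
rewrite integral_indic// setIT /= (lebesgue_measure_itv `[_, _]) /= lte_fin.
have [h|h] := ltP (b ord0) (b ord0 + s); rewrite /= exprSr.
  by congr (_ * _); lra.
by rewrite mulr0 (_ : s = 0) ?mulr0//; lra.
Qed.

Lemma rint_ge0 n (A : set 'rV[R]_n) f : (forall x, A x -> 0 <= f x) -> 0 <= rint A f.
Proof.
move=> f0; apply: iint_ge0 => x; rewrite indicE.
have [/set_mem /f0|] := boolP (x \in A); by rewrite ?mul1r// mul0r.
Qed.

End LocallyBounded.

(** * Squared moduli and complex-valued functions *)

Section ComplexFunctions.
Variable R : realType.
Implicit Types n : nat.
Local Notation C := R[i].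

Definition sq (z : C) : R := complex.Re z ^+ 2 + complex.Im z ^+ 2.

Lemma sq_ge0 z : 0 <= sq z. Proof. by rewrite addr_ge0 ?sqr_ge0. Qed.

Lemma ReD (a b : C) : complex.Re (a + b) = complex.Re a + complex.Re b.
Proof. by case: a b => ? ? []. Qed.
Lemma ImD (a b : C) : complex.Im (a + b) = complex.Im a + complex.Im b.
Proof. by case: a b => ? ? []. Qed.
Lemma ReM (a b : C) :
  complex.Re (a * b) = complex.Re a * complex.Re b - complex.Im a * complex.Im b.
Proof. by case: a b => ? ? []. Qed.
Lemma ImM (a b : C) :
  complex.Im (a * b) = complex.Re a * complex.Im b + complex.Im a * complex.Re b.
Proof. by case: a b => ? ? []. Qed.
Lemma Re_conj (a : C) : complex.Re (conjc a) = complex.Re a.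
Proof. by case: a. Qed.
Lemma Im_conj (a : C) : complex.Im (conjc a) = - complex.Im a.
Proof. by case: a. Qed.
Lemma ReN (a : C) : complex.Re (- a) = - complex.Re a. Proof. by case: a. Qed.
Lemma ImN (a : C) : complex.Im (- a) = - complex.Im a. Proof. by case: a. Qed.

Lemma eqC (a b : C) :
  complex.Re a = complex.Re b -> complex.Im a = complex.Im b -> a = b.
Proof. by case: a b => ? ? [? ?] /= -> ->. Qed.

Lemma sqM a b : sq (a * b) = sq a * sq b.
Proof. by rewrite /sq ReM ImM; ring. Qed.
Lemma sqN a : sq (- a) = sq a.
Proof. by rewrite /sq ReN ImN; ring. Qed.
Lemma sq_conj a : sq (conjc a) = sq a.
Proof. by rewrite /sq Re_conj Im_conj; ring. Qed.
Lemma sq0 : sq 0 = 0.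
Proof. by rewrite /sq /= expr0n addr0. Qed.
Lemma sq_real (c : R) : sq (c%:C)%C = c ^+ 2.
Proof. by rewrite /sq /= expr0n addr0. Qed.
Lemma sqD_le a b : sq (a + b) <= 2 * sq a + 2 * sq b.
Proof.
rewrite /sq ReD ImD.
have h1 := sqr_ge0 (complex.Re a - complex.Re b).
have h2 := sqr_ge0 (complex.Im a - complex.Im b).
move: h1 h2; rewrite !expr2; lra.
Qed.
Lemma sqB_le a b : sq (a - b) <= 2 * sq a + 2 * sq b.
Proof. by rewrite -(sqN b); exact: sqD_le. Qed.

Lemma mulC_conj (z : C) : z * conjc z = (sq z)%:C%C.
Proof. by apply: eqC; rewrite ?ReM ?ImM ?Re_conj ?Im_conj /sq /=; ring. Qed.

Lemma normcE z : normc z = Num.sqrt (sq z).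
Proof. by case: z. Qed.

Lemma normc_sq z : normc z ^+ 2 = sq z.
Proof. by rewrite normcE sqr_sqrtr ?sq_ge0. Qed.

Lemma sq_eq0 z : sq z = 0 -> z = 0.
Proof.
move=> /eqP; rewrite paddr_eq0 ?sqr_ge0// !sqrf_eq0 => /andP[/eqP h1 /eqP h2].
exact: eqC.
Qed.

(** The two-term inequality is iterated. The constant is far from sharp, but the sums to which this
    is applied have [m + 1] or [d + 1] terms, whatever the mesh. *)
Lemma sq_sum_le (I : finType) (F : I -> C) :
  sq (\sum_i F i) <= 2 ^+ #|I| * \sum_i sq (F i).
Proof.
suff H r : sq (\sum_(i <- r) F i) <= 2 ^+ size r * \sum_(i <- r) sq (F i).
  by have := H (enum I); rewrite -cardE !big_enum.
elim: r => [|i r IH]; first by rewrite !big_nil sq0 mulr0.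
rewrite !big_cons /= exprS; apply: le_trans (sqD_le _ _) _.
have e1 : 1 <= 2 ^+ size r :> R by rewrite exprn_ege1 ?ler1n.
have := sq_ge0 (F i).
have : 0 <= \sum_(j <- r) sq (F j) by rewrite sumr_ge0// => j _; exact: sq_ge0.
nra.
Qed.

Definition nice n (f : 'rV[R]_n -> C) : Prop :=
  lbm (fun x => complex.Re (f x)) /\ lbm (fun x => complex.Im (f x)).

Lemma eq_nice n (f g : 'rV[R]_n -> C) : f =1 g -> nice f -> nice g.
Proof. by move=> /funext ->. Qed.

Lemma nice_cst n c : nice (fun _ : 'rV[R]_n => c).
Proof. by split; exact: lbm_cst. Qed.

Lemma nice_real n (f : 'rV[R]_n -> R) : lbm f -> nice (fun x => (f x)%:C%C).
Proof. by split=> //=; exact: lbm_cst. Qed.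

Lemma niceD n (f g : 'rV[R]_n -> C) : nice f -> nice g -> nice (fun x => f x + g x).
Proof.
move=> [f1 f2] [g1 g2]; split.
  by apply: (eq_lbm (fun x => esym (ReD (f x) (g x)))); exact: lbmD.
by apply: (eq_lbm (fun x => esym (ImD (f x) (g x)))); exact: lbmD.
Qed.

Lemma niceM n (f g : 'rV[R]_n -> C) : nice f -> nice g -> nice (fun x => f x * g x).
Proof.
move=> [f1 f2] [g1 g2]; split.
  by apply: (eq_lbm (fun x => esym (ReM (f x) (g x)))); apply: lbmB; exact: lbmM.
by apply: (eq_lbm (fun x => esym (ImM (f x) (g x)))); apply: lbmD; exact: lbmM.
Qed.

Lemma nice_conj n (f : 'rV[R]_n -> C) : nice f -> nice (fun x => conjc (f x)).
Proof.
move=> [f1 f2]; split; first by apply: (eq_lbm (fun x => esym (Re_conj (f x)))).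
by apply: (eq_lbm (fun x => esym (Im_conj (f x)))); exact: lbmN.
Qed.

Lemma niceN n (f : 'rV[R]_n -> C) : nice f -> nice (fun x => - f x).
Proof.
move=> /(niceM (nice_cst n (-1))); apply: eq_nice => x; exact: mulN1r.
Qed.

Lemma niceB n (f g : 'rV[R]_n -> C) : nice f -> nice g -> nice (fun x => f x - g x).
Proof. by move=> nf ng; apply: niceD => //; exact: niceN. Qed.

Lemma nice_sum n (I : Type) (r : seq I) (P : pred I) (F : I -> 'rV[R]_n -> C) :
  (forall i, P i -> nice (F i)) -> nice (fun x => \sum_(i <- r | P i) F i x).
Proof.
move=> lF; elim: r => [|i r IH].
  by apply: eq_nice (nice_cst n 0) => x; rewrite big_nil.
case Pi: (P i); last by apply: eq_nice IH => x; rewrite big_cons Pi.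
by apply: eq_nice (niceD (lF i Pi) IH) => x; rewrite big_cons Pi.
Qed.

Lemma nice_prod n (I : Type) (r : seq I) (F : I -> 'rV[R]_n -> C) :
  (forall i, nice (F i)) -> nice (fun x => \prod_(i <- r) F i x).
Proof.
move=> lF; elim: r => [|i r IH].
  by apply: eq_nice (nice_cst n 1) => x; rewrite big_nil.
by apply: eq_nice (niceM (lF i) IH) => x; rewrite big_cons.
Qed.

Lemma niceX n k (f : 'rV[R]_n -> C) : nice f -> nice (fun x => f x ^+ k).
Proof.
move=> nf; elim: k => [|k IH]; first exact: nice_cst.
by under eq_fun do rewrite exprS; exact: niceM.
Qed.

Lemma nice_comp n p (f : 'rV[R]_n -> C) (phi : 'rV[R]_p -> 'rV[R]_n) :
  nice f -> (forall i, lbm (fun x => phi x 0 i)) -> nice (fun x => f (phi x)).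
Proof.
move=> [f1 f2] lphi.
by split; [exact: (lbm_comp f1 lphi)|exact: (lbm_comp f2 lphi)].
Qed.

Lemma lbm_sq n (f : 'rV[R]_n -> C) : nice f -> lbm (fun x => sq (f x)).
Proof. by move=> [f1 f2]; apply: lbmD; apply: lbmM. Qed.

Lemma nice_peval n (p : cpoly R n) : nice (peval p).
Proof.
apply: (eq_nice (fun x => esym (mpoly.mevalE (fun i => (x 0 i)%:C%C) p))).
apply: nice_sum => m _; apply: niceM; first exact: nice_cst.
by apply: nice_prod => i; apply: niceX; apply: nice_real; exact: lbm_coord.
Qed.

End ComplexFunctions.

(** * Positive linear functionals *)

Section PositiveFunctionals.
Variables (R : realType) (n : nat).
Local Notation C := R[i].

(** What integrals over elements and over faces have in common: the Young inequality and the
    expansion of the forms are proved for both at once. [D] is the set on which integrands have to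
    be compared. *)
Record posfun (D : set 'rV[R]_n) (I : ('rV[R]_n -> R) -> R) : Prop := PosFun {
  posfun_lin : forall a f g, lbm f -> lbm g ->
    I (fun x => a * f x + g x) = a * I f + I g;
  posfun_mono : forall f g, lbm f -> lbm g ->
    (forall x, D x -> f x <= g x) -> I f <= I g }.

(** [int_on] and [surf_int] are of this kind, for the functionals [rint] and [rsurf]. *)
Definition cext (I : ('rV[R]_n -> R) -> R) (f : 'rV[R]_n -> C) : C :=
  I (fun x => complex.Re (f x)) +i* I (fun x => complex.Im (f x)).

Variables (D : set 'rV[R]_n) (I : ('rV[R]_n -> R) -> R).
Hypothesis pI : posfun D I.

Lemma posfun0 : I (fun=> 0) = 0.
Proof.
have := posfun_lin pI 1 (lbm_cst n 0) (lbm_cst n 0).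
under [X in I X]eq_fun do rewrite mulr0 addr0.
by move=> /eqP; rewrite mul1r addrC -subr_eq subrr eq_sym => /eqP.
Qed.

Lemma posfunD f g : lbm f -> lbm g -> I (fun x => f x + g x) = I f + I g.
Proof.
move=> lf lg; rewrite -[X in X + _]mul1r -(posfun_lin pI)//.
by congr I; apply/funext => x; rewrite mul1r.
Qed.

Lemma posfunZ a f : lbm f -> I (fun x => a * f x) = a * I f.
Proof.
move=> lf; rewrite -[RHS]addr0 -[X in _ + X]posfun0 -(posfun_lin pI)//; last exact: lbm_cst.
by congr I; apply/funext => x; rewrite addr0.
Qed.

Lemma posfun_sum (J : Type) (r : seq J) (P : pred J) (F : J -> 'rV[R]_n -> R) :
  (forall j, P j -> lbm (F j)) ->
  I (fun x => \sum_(j <- r | P j) F j x) = \sum_(j <- r | P j) I (F j).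
Proof.
move=> lF; elim: r => [|j r IH].
  rewrite big_nil -[RHS]posfun0; congr (I _); apply/funext => x.
  by rewrite big_nil.
rewrite big_cons; case: ifPn => Pj; last first.
  rewrite -IH; congr (I _); apply/funext => x.
  by rewrite big_cons (negPf Pj).
rewrite -IH -posfunD; [|exact: lF|exact: lbm_sum].
congr (I _); apply/funext => x.
by rewrite big_cons Pj.
Qed.

Lemma posfun_sup f c : lbm f -> (forall x, D x -> f x <= c) -> I f <= c * I (fun=> 1).
Proof.
move=> lf fc; rewrite -posfunZ; last exact: lbm_cst.
apply: (posfun_mono pI) => //; last by move=> x Dx; rewrite mulr1 fc.
by apply: lbmZ; exact: lbm_cst.
Qed.

Lemma cext_lin c f g : nice f -> nice g ->
  cext I (fun x => c * f x + g x) = c * cext I f + cext I g.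
Proof.
move=> [f1 f2] [g1 g2]; apply: eqC.
  rewrite ReD ReM /=.
  transitivity (I (fun x => complex.Re c * complex.Re (f x)
      + (- complex.Im c * complex.Im (f x) + complex.Re (g x)))).
    by congr I; apply/funext => x; rewrite ReD ReM; ring.
  rewrite (posfun_lin pI)//; last by apply: lbmD => //; exact: lbmZ.
  by rewrite (posfun_lin pI)//; ring.
rewrite ImD ImM /=.
transitivity (I (fun x => complex.Re c * complex.Im (f x)
    + (complex.Im c * complex.Re (f x) + complex.Im (g x)))).
  by congr I; apply/funext => x; rewrite ImD ImM; ring.
rewrite (posfun_lin pI)//; last by apply: lbmD => //; exact: lbmZ.
by rewrite (posfun_lin pI)//; ring.
Qed.

Lemma cext_real f : cext I (fun x => (f x)%:C%C) = (I f)%:C%C.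
Proof. by rewrite /cext /= posfun0. Qed.

End PositiveFunctionals.

(** * Polynomial inequalities on boxes *)

Section UnivariateBounds.
Variable R : realType.
Local Notation C := R[i].
Implicit Types (P Q : {poly C}).

(* Newton's divided differences: P = P(t_0) + (X - t_0) Q, where Q is controlled at the other nodes. *)
Lemma coef_le_at_nodes m (delta : R) : 0 < delta -> exists2 c : R, 0 < c &
  forall P (t : nat -> R) B, (size P <= m.+1)%N ->
    (forall i, (i <= m)%N -> `|t i| <= 1) ->
    (forall i j, (i < j <= m)%N -> delta <= `|t j - t i|) ->
    (forall i, (i <= m)%N -> sq P.[(t i)%:C] <= B) ->
  forall i, sq P`_i <= c * B.
Proof.
move=> d0; elim: m => [|m [c c0 IH]].
  exists 1 => // P t B sP _ _ PB [|i].
    by move: (PB 0%N isT); rewrite (size1_polyC sP) hornerC coefC eqxx mul1r.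
  rewrite nth_default ?(leq_trans sP)// sq0 mul1r.
  by apply: le_trans (PB 0%N isT); exact: sq_ge0.
(* [Q] takes divided differences of [P] over distances at least [delta]: the squared difference of
   two values of [P], at most [4 * B], is divided by [delta ^+ 2]. *)
pose K := 4 / delta ^+ 2; have K0 : 0 < K by rewrite divr_gt0// exprn_gt0.
(* The coefficient of index i of [P] is [Q_(i-1) - a Q_i], plus the value at [a] when i = 0, and [a]
   has modulus at most 1. Two uses of the two-term inequality for squares give the factors 4, 4 and
   2. *)
exists (4 * (c * K) + 4 * (c * K) + 2).
  by rewrite addr_gt0// addr_gt0// mulr_gt0// mulr_gt0.
move=> P t B sP t1 tsep PB.
have B0 : 0 <= B by apply: le_trans (PB 0%N isT); exact: sq_ge0.
pose a := (t 0%N)%:C%C : C.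
have /factor_theorem[Q PQ] : root (P - P.[a]%:P) a.
  by rewrite /root !hornerE subrr.
have PE : P = Q * ('X - a%:P) + P.[a]%:P by rewrite -PQ subrK.
have sQ : (size Q <= m.+1)%N.
  have [->|Q0] := eqVneq Q 0; first by rewrite size_poly0.
  have : (size (Q * ('X - a%:P))%R <= m.+2)%N.
    rewrite -PQ; apply: leq_trans (size_polyD _ _) _; rewrite geq_max sP size_polyN.
    by apply: leq_trans (size_polyC_leq1 _) _.
  by rewrite size_Mmonic ?monicXsubC// size_XsubC addn2.
have QB j : (j <= m)%N -> sq Q.[(t j.+1)%:C] <= K * B.
  move=> jm; pose u := t j.+1 - t 0%N.
  have u0 : delta ^+ 2 <= u ^+ 2.
    rewrite -(real_normK (num_real u)) ler_sqr ?nnegrE// ?(ltW d0)//.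
    by apply: (tsep 0%N j.+1); rewrite ltnS.
  have : sq (Q.[(t j.+1)%:C] * u%:C) <= 4 * B.
    have -> : Q.[(t j.+1)%:C] * (u%:C)%C = P.[(t j.+1)%:C] - P.[a].
      rewrite {1}PE hornerD hornerM hornerXsubC hornerC addrK.
      by rewrite /u rmorphB.
    apply: le_trans (sqB_le _ _) _.
    by have := PB j.+1 jm; have := PB 0%N isT; rewrite -/a; lra.
  rewrite sqM sq_real => h.
  rewrite /K mulrAC ler_pdivlMr ?exprn_gt0//; apply: le_trans h.
  by rewrite ler_wpM2l ?sq_ge0.
have {}IH := IH Q (fun j => t j.+1) (K * B) sQ (fun i im => t1 i.+1 im)
  (fun i j ij => tsep i.+1 j.+1 ij) QB.
have a1 : sq a <= 1.
  rewrite sq_real -(real_normK (num_real (t 0%N))).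
  by rewrite expr_le1 ?normr_ge0//; exact: t1.
have cKB : 0 <= c * K * B by exact: mulr_ge0 (mulr_ge0 (ltW c0) (ltW K0)) B0.
move=> i; rewrite PE coefD mulrBr coefB coefMX coefMC coefC.
have h1 : sq (if i == 0%N then 0 else Q`_i.-1) <= c * K * B.
  by case: ifP => _; rewrite ?sq0// -mulrA.
have h2 : sq (Q`_i * a) <= c * K * B.
  rewrite sqM; apply: le_trans (_ : sq Q`_i * 1 <= _); first by rewrite ler_wpM2l ?sq_ge0.
  by rewrite mulr1 -mulrA.
have h3 : sq (if i == 0%N then P.[a] else 0) <= B by case: ifP => _; rewrite ?sq0// PB.
apply: le_trans (sqD_le _ _) _.
have := sqB_le (if i == 0%N then 0 else Q`_i.-1) (Q`_i * a).
lra.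
Qed.

Definition rescale (a s : R) P : {poly C} := P \Po (s%:C *: 'X + (a%:C)%:P).

Lemma rescale_horner a s P y :
  (rescale a s P).[(y%:C)%C] = P.[((a + s * y)%:C)%C].
Proof.
by rewrite horner_comp !hornerE -rmorphM -rmorphD /= addrC.
Qed.

Lemma size_rescale a s P : s != 0 -> size (rescale a s P) = size P.
Proof.
move=> s0; apply: size_comp_poly2.
have sC : (s%:C)%C != 0 :> C by rewrite fmorph_eq0.
rewrite size_polyDl size_scale ?size_polyX//.
by rewrite (leq_ltn_trans (size_polyC_leq1 _)).
Qed.

Lemma deriv_rescale a s P : (rescale a s P)^`() = s%:C *: rescale a s P^`().
Proof.
rewrite deriv_comp derivD derivZ derivX derivC addr0.
by rewrite -scalerAr mulr1.
Qed.

Lemma coef_le_sup m : exists2 c : R, 0 < c & forall P B, (size P <= m.+1)%N ->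
  (forall y, 0 <= y <= 1 -> sq P.[(y%:C)%C] <= B) -> forall i, sq P`_i <= c * B.
Proof.
have m0 : 0 < m.+1%:R :> R by rewrite ltr0n.
have [c c0 H] := @coef_le_at_nodes m m.+1%:R^-1 (ltac:(by rewrite invr_gt0)).
(* Equidistant nodes; dividing by [m + 1] instead of [m] also covers degree 0. *)
exists c => // P B sP PB; apply: (H P (fun i => i%:R / m.+1%:R)) => //.
- move=> i im; rewrite ger0_norm ?divr_ge0// ler_pdivrMr// mul1r ler_nat.
  exact: leq_trans im _.
- move=> i j /andP[ij jm]; rewrite -mulrBl -natrB 1?ltnW// ger0_norm ?divr_ge0//.
  by rewrite ler_pdivlMr// mulVf ?gt_eqF// ler1n subn_gt0.
- move=> i im; apply: PB; rewrite divr_ge0//= ler_pdivrMr// mul1r ler_nat.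
  exact: leq_trans im _.
Qed.

Lemma horner_le_coef m (M : R) : 1 <= M -> exists2 K : R, 0 < K &
  forall P B y, (size P <= m.+1)%N -> `|y| <= M -> (forall i, sq P`_i <= B) ->
  sq P.[(y%:C)%C] <= K * B.
Proof.
move=> M1; exists (2 ^+ m.+1 * m.+1%:R * M ^+ (2 * m)).
  by rewrite !mulr_gt0// ?exprn_gt0// ?ltr0n// (lt_le_trans ltr01).
move=> P B y sP yM PB.
have B0 : 0 <= B by apply: le_trans (PB 0%N); exact: sq_ge0.
rewrite (horner_coef_wide _ sP).
apply: le_trans (sq_sum_le _) _; rewrite card_ord -!mulrA ler_wpM2l ?exprn_ge0//.
apply: le_trans (_ : \sum_(i < m.+1) (M ^+ (2 * m) * B) <= _); last first.
  by rewrite sumr_const card_ord mulr_natl.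
apply: ler_sum => i _; rewrite sqM mulrC ler_pM ?sq_ge0//.
rewrite -rmorphXn sq_real -(real_normK (num_real (y ^+ i))) normrX -exprM mulnC.
apply: le_trans (_ : M ^+ (2 * i) <= _); last first.
  by rewrite ler_weXn2l// leq_mul2l/= -ltnS ltn_ord.
by rewrite lerXn2r// nnegrE// (le_trans ler01).
Qed.

End UnivariateBounds.

(** * Estimates on segments *)

Section SegmentEstimates.
Variable R : realType.
Local Notation C := R[i].
Implicit Types (P Q : {poly C}).

Lemma sq_mulrn (z : C) n : sq (z *+ n) = n%:R ^+ 2 * sq z.
Proof.
by rewrite -[z *+ n]mulr_natl sqM -(rmorph_nat (real_complex R)) sq_real.
Qed.

Lemma leq_size_deriv P : (size P^`() <= size P)%N.
Proof.
by have [->|/lt_size_deriv/ltnW//] := eqVneq P 0; rewrite deriv0 size_poly0.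
Qed.

(** After rescaling to the unit interval, the values there bound the coefficients, and these bound
    the polynomial and its derivative on an interval [M] times larger. The scaling gives the
    derivative its factor [1 / s]. *)
Lemma segment_ext m (M : R) : 1 <= M -> exists2 c : R, 0 < c &
  forall a s P B, 0 < s -> (size P <= m.+1)%N ->
  (forall t, a <= t <= a + s -> sq P.[(t%:C)%C] <= B) ->
  forall t, `|t - a| <= M * s ->
    sq P.[(t%:C)%C] <= c * B /\ sq P^`().[(t%:C)%C] <= c * B / s ^+ 2.
Proof.
move=> M1; have [c1 c10 H1] := @coef_le_sup R m.
have [K K0 HK] := horner_le_coef m M1.
(* Bounds the factor by which differentiation multiplies squared coefficients. *)
pose m1 : R := m.+1%:R ^+ 2.
have m11 : 1 <= m1 by rewrite exprn_ege1// ler1n.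
have m10 : 0 < m1 by apply: lt_le_trans m11.
exists (K * (m1 * c1)); first exact: mulr_gt0 K0 (mulr_gt0 m10 c10).
move=> a s P B s0 sP PB t tM.
have sn0 : s != 0 by rewrite gt_eqF.
pose y := (t - a) / s; have yE : a + s * y = t by rewrite /y mulrC divfK// addrC subrK.
have yM : `|y| <= M by rewrite /y normrM normfV (gtr0_norm s0) ler_pdivrMr.
pose Q := rescale a s P.
have sQ : (size Q <= m.+1)%N by rewrite size_rescale.
have QB u : 0 <= u <= 1 -> sq Q.[(u%:C)%C] <= B.
  move=> /andP[u0 u1]; rewrite rescale_horner; apply: PB.
  by rewrite lerDl mulr_ge0 ?(ltW s0)//= lerD2l ler_piMr// ltW.
have cQ := H1 Q B sQ QB.
have cB : 0 <= c1 * B by apply: le_trans (cQ 0%N); exact: sq_ge0.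
have cB' : c1 * B <= m1 * c1 * B by rewrite -mulrA ler_peMl.
split.
  rewrite -yE -rescale_horner -mulrA.
  apply: HK => // i; apply: le_trans (cQ i) _ => //.
have -> : sq P^`().[(t%:C)%C] = sq Q^`().[(y%:C)%C] / s ^+ 2.
  rewrite /Q deriv_rescale hornerZ rescale_horner yE. rewrite sqM sq_real.
  by rewrite mulrAC divff ?mul1r// expf_neq0.
rewrite ler_pM2r ?invr_gt0 ?exprn_gt0// -[K * _ * B]mulrA -[m1 * c1 * B]mulrA.
apply: HK => // [|i]; first exact: leq_trans (leq_size_deriv _) sQ.
rewrite coef_deriv sq_mulrn.
have [im|im] := leqP i m; last first.
  rewrite nth_default; last exact: leq_trans sQ (leqW im).
  by rewrite sq0 mulr0 (le_trans cB)// mulrA.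
by apply: ler_pM (cQ _); rewrite ?sq_ge0 ?exprn_ge0// /m1 lerXn2r ?nnegrE ?ler_nat.
Qed.

(** The coefficients of the derivative are positive integer multiples of those of the polynomial,
    shifted by one index. They dominate all but the constant coefficient, which cancels in a
    difference of values. *)
Lemma segment_poincare m (M : R) : 1 <= M -> exists2 c : R, 0 < c &
  forall a s P B, 0 < s -> (size P <= m.+1)%N ->
  (forall t, a <= t <= a + s -> sq P^`().[(t%:C)%C] <= B) ->
  forall t u, `|t - a| <= M * s -> `|u - a| <= M * s ->
    sq (P.[(t%:C)%C] - P.[(u%:C)%C]) <= c * (s ^+ 2 * B).
Proof.
move=> M1; have [c1 c10 H1] := @coef_le_sup R m.
have [K K0 HK] := horner_le_coef m M1.
exists (4 * (K * c1)); first exact: mulr_gt0 _ (mulr_gt0 K0 c10).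
move=> a s P B s0 sP PB.
have sn0 : s != 0 by rewrite gt_eqF.
pose Q := rescale a s P.
have sQ : (size Q <= m.+1)%N by rewrite size_rescale.
have sQ' : (size Q^`() <= m.+1)%N by exact: leq_trans (leq_size_deriv _) sQ.
have QB u : 0 <= u <= 1 -> sq Q^`().[(u%:C)%C] <= s ^+ 2 * B.
  move=> /andP[u0 u1]; rewrite deriv_rescale hornerZ rescale_horner sqM sq_real.
  rewrite ler_wpM2l ?exprn_ge0 ?(ltW s0)//; apply: PB.
  by rewrite lerDl mulr_ge0 ?(ltW s0)//= lerD2l ler_piMr// ltW.
have cQ := H1 _ _ sQ' QB; set B' := s ^+ 2 * B in cQ QB *.
pose Q0 := Q - (Q`_0)%:P.
have sQ0 : (size Q0 <= m.+1)%N.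
  apply: leq_trans (size_polyD _ _) _; rewrite geq_max sQ size_polyN.
  by apply: leq_trans (size_polyC_leq1 _) _.
have cB : 0 <= c1 * B' by apply: le_trans (cQ 0%N); exact: sq_ge0.
have cQ0 i : sq Q0`_i <= c1 * B'.
  rewrite coefB coefC; case: i => [|i]; first by rewrite subrr sq0.
  rewrite subr0; apply: le_trans (cQ i); rewrite coef_deriv sq_mulrn.
  by rewrite ler_peMl ?sq_ge0// exprn_ege1// ler1n.
have key t : `|t - a| <= M * s -> exists2 z, sq z <= K * (c1 * B') &
    P.[(t%:C)%C] = z + Q`_0.
  move=> tM; pose y := (t - a) / s.
  have yE : a + s * y = t by rewrite /y mulrC divfK// addrC subrK.
  have yM : `|y| <= M by rewrite /y normrM normfV (gtr0_norm s0) ler_pdivrMr.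
  exists Q0.[(y%:C)%C]; first exact: HK.
  by rewrite /Q0 hornerD hornerN hornerC subrK rescale_horner yE.
move=> t u /key[z hz ->] /key[w hw ->].
rewrite opprD addrACA subrr addr0.
by apply: le_trans (sqB_le _ _) _; lra.
Qed.

Lemma Rintegral_scaled_indic (B a b : R) : a <= b ->
  \int[lebesgue_measure]_(t in setT) (B * \1_(`[a, b]%classic : set R) t) = B * (b - a).
Proof.
move=> ab; rewrite /Rintegral; under eq_integral do rewrite EFinM.
rewrite integralZl//; last exact: (integrable_indic_itv _ _ true false).
rewrite integral_indic// setIT /= (lebesgue_measure_itv `[_, _]) /= lte_fin.
have [h|h] := ltP a b; rewrite //= mulr0.
by rewrite (_ : b - a = 0) ?mulr0//; apply/eqP; rewrite subr_eq0 eq_le h ab.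
Qed.

(* A polynomial that is large on a whole subinterval has a large integral, so each of
   the m + 1 separated subintervals has a node where it is controlled by the integral. *)
Lemma segment_sup_le_int m : exists2 c : R, 0 < c &
  forall a s P, 0 < s -> (size P <= m.+1)%N ->
  lebesgue_measure.-integrable setT
    (EFin \o (fun t : R => \1_(`[a, a + s]%classic : set R) t * sq P.[(t%:C)%C])) ->
  forall t, a <= t <= a + s -> sq P.[(t%:C)%C] <= c / s *
    \int[lebesgue_measure]_(t in setT) (\1_(`[a, a + s]%classic : set R) t * sq P.[(t%:C)%C]).
Proof.
(* The segment is cut into [k = 2 (m + 1)] pieces of length [w = s / k] and every other piece is
   kept, so that nodes in different kept pieces are at least [w] apart. *)
have [k [k0 jk]] : exists k : R, 0 < k /\ forall j, (j <= m)%N -> (2 * j).+1%:R <= k.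
  exists (2 * m.+1)%:R; split=> [|j jm]; first by rewrite ltr0n.
  by rewrite ler_nat mulnS ltnS leqW// leq_mul2l.
have [c1 c10 H1] := @coef_le_at_nodes R m k^-1 (ltac:(by rewrite invr_gt0)).
have [K K0 HK] := @horner_le_coef R m 1 (lexx _).
have Q0 : 0 < K * c1 by exact: mulr_gt0.
exists (K * c1 * k); first exact: mulr_gt0.
move=> a s P s0 sP iP t tI; set I := Rintegral _ _ _.
have sn0 : s != 0 by rewrite gt_eqF.
apply/ler_addgt0Pr => e e0.
have [w [w0 ws]] : exists w, 0 < w /\ s = k * w.
  by exists (s / k); rewrite divr_gt0// mulrC divfK// gt_eqF.
(* A slack that avoids minimizing over a piece: a square above [I / w + e'] on a whole piece would
   integrate to more than [I]. After multiplication by [K * c1] the slack is [e]. *)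
pose e' := e / (K * c1); have e'0 : 0 < e' by exact: divr_gt0.
pose B := I / w + e'.
have node j : (j <= m)%N -> exists u, [/\ a + (2 * j)%:R * w <= u,
    u <= a + (2 * j).+1%:R * w & sq P.[(u%:C)%C] <= B].
  move=> jm; set l := a + _; set r := a + _.
  have lr : r - l = w by rewrite /r /l -addn1 natrD; ring.
  have al : a <= l by rewrite lerDl mulr_ge0// ltW.
  have rs : r <= a + s by rewrite lerD2l ws ler_wpM2r ?jk// ltW.
  apply: contrapT => /forallNP h.
  have hB u : l <= u <= r -> B <= sq P.[(u%:C)%C].
    by move=> /andP[lu ur]; rewrite leNgt; apply/negP => uB; apply: (h u); split=> //; exact: ltW.
  have : B * (r - l) <= I.
    rewrite -Rintegral_scaled_indic; last by rewrite -subr_ge0 lr ltW.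
    apply: le_Rintegral => //; first exact: integrable_scaled_indic.
    move=> u _; rewrite !indicE; have [/set_mem/=|] := boolP (u \in _).
      rewrite in_itv/= => /andP[lu ur].
      rewrite mem_set ?mul1r ?mulr1 ?hB ?lu//= in_itv/= (le_trans al)//=.
      exact: le_trans rs.
    by rewrite mulr0 mulr_ge0// sq_ge0.
  rewrite lr /B mulrDl divfK ?gt_eqF// gerDl leNgt.
  by rewrite mulr_gt0.
have B0 : 0 <= B by have [u [_ _]] := node 0%N isT; apply: le_trans; exact: sq_ge0.
have /choice[u uP] j : exists u, (j <= m)%N -> [/\ a + (2 * j)%:R * w <= u,
    u <= a + (2 * j).+1%:R * w & sq P.[(u%:C)%C] <= B].
  have [jm|jm] := leqP j m; last by exists 0.
  by have [v hv] := node j jm; exists v.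
pose Q := rescale a s P.
have sQ : (size Q <= m.+1)%N by rewrite size_rescale.
pose y j := (u j - a) / s.
have yE j : a + s * y j = u j by rewrite /y mulrC divfK// addrC subrK.
have cQ := H1 Q y B sQ.
have tE : a + s * ((t - a) / s) = t by rewrite mulrC divfK// addrC subrK.
have hB : K * (c1 * B) = K * c1 * k / s * I + e.
  rewrite /B /e' ws; field.
  by rewrite !gt_eqF.
rewrite -hB -[in leLHS]tE -rescale_horner.
apply: HK => //.
  move: tI => /andP[t1 t2]; rewrite ger0_norm ?divr_ge0 ?subr_ge0// ?(ltW s0)//.
  by rewrite ler_pdivrMr// mul1r lerBlDl.
apply: cQ => [i im|i j /andP[ij jm]|i im].
- have [h1 h2 _] := uP i im.
  have h3 : 0 <= u i - a.
    by rewrite subr_ge0; apply: le_trans h1; rewrite lerDl mulr_ge0// ltW.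
  rewrite ger0_norm ?divr_ge0 ?(ltW s0)// ler_pdivrMr// mul1r lerBlDl.
  by apply: le_trans h2 _; rewrite lerD2l ws ler_wpM2r ?jk// ltW.
- have im : (i <= m)%N by apply: leq_trans (ltnW ij) jm.
  have [_ h2 _] := uP i im; have [h1 _ _] := uP j jm.
  have h3 : w <= u j - u i.
    have : (2 * i).+2%:R * w <= (2 * j)%:R * w.
      by rewrite ler_pM2r// ler_nat -[(2 * i).+2]addn2 -mulnSr leq_mul2l.
    rewrite -natr1 mulrDl mul1r; move: (_%:R * w) (_%:R * w) h1 h2 => A A'; lra.
  rewrite -mulrBl (_ : _ - _ = u j - u i); last by ring.
  rewrite ger0_norm; last by rewrite divr_ge0 ?(ltW s0)// (le_trans (ltW w0)).
  by rewrite ler_pdivlMr// [X in _ * X]ws mulrA mulVf ?gt_eqF// mul1r.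
- by rewrite rescale_horner yE; have [] := uP i im.
Qed.

End SegmentEstimates.

(** * From segments to boxes *)

Section BoxEstimates.
Variable R : realType.
Local Notation C := R[i].

Definition upd n (x : 'rV[R]_n) (l : 'I_n) (t : R) : 'rV[R]_n :=
  \row_i (if i == l then t else x 0 i).

Lemma upd_id n (x : 'rV[R]_n) l : upd x l (x 0 l) = x.
Proof. by apply/rowP => i; rewrite mxE; case: eqP => // ->. Qed.

(** Polynomial along every coordinate line. In contrast to a degree bound on a multivariate
    polynomial, this passes to slices at once, as the induction in [box_sup_le_int] requires. *)
Definition line_pol m n (f : 'rV[R]_n -> C) : Prop :=
  forall x l, exists2 P : {poly C}, (size P <= m.+1)%N &
    forall t, f (upd x l t) = P.[(t%:C)%C].

Lemma peval_line m n (p : cpoly R n) x l : deg_le m p ->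
  exists P : {poly C}, [/\ (size P <= m.+1)%N,
    forall t, peval p (upd x l t) = P.[(t%:C)%C] &
    forall t, peval (pdiff l p) (upd x l t) = P^`().[(t%:C)%C]].
Proof.
move=> dp.
pose c (a : mpoly.multinom n) : C := \prod_(i | i != l) ((x 0 i)%:C)%C ^+ mpoly.fun_of_multinom a i.
have split_prod t (a b : mpoly.multinom n) :
    (forall i, i != l -> mpoly.fun_of_multinom b i = mpoly.fun_of_multinom a i) ->
    \prod_i ((upd x l t 0 i)%:C)%C ^+ mpoly.fun_of_multinom b i
    = (t%:C)%C ^+ mpoly.fun_of_multinom b l * c a.
  move=> ab; rewrite (bigD1 l)//= mxE eqxx; congr (_ * _).
  by apply: eq_bigr => i il; rewrite mxE (negPf il) ab.
exists (\sum_(a <- mpoly.msupp p) (mpoly.mcoeff a p * c a)%:P * 'X^(mpoly.fun_of_multinom a l)); split.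
- apply: leq_trans (size_sum _ _ _) _; apply/bigmax_leqP_seq => a ap _.
  apply: leq_trans (size_polyMleq _ _) _; rewrite size_polyXn addnS /=.
  apply: leq_trans (leq_add (size_polyC_leq1 _) (leqnn _)) _.
  have := mpoly.msize_mdeg_lt ap.
  move=> /leq_trans/(_ dp); rewrite !ltnS; apply: leq_trans.
  by rewrite mpoly.mdegE (bigD1 l)//= leq_addr.
- move=> t; rewrite /peval mpoly.mevalE horner_sum; apply: eq_bigr => a _.
  rewrite hornerM hornerC hornerXn (split_prod _ a)// -mulrA; congr (_ * _).
  exact: mulrC.
- move=> t; rewrite /peval /pdiff /mpoly.mderiv rmorph_sum [X in _ = X.[_]]linear_sum horner_sum /=.
  apply: eq_bigr => a _; rewrite mpoly.mevalZ mpoly.mevalX (split_prod _ a); last first.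
    by move=> i il; rewrite mpoly.mnmBE mpoly.mnm1E eq_sym (negPf il) subn0.
  rewrite mpoly.mnmBE mpoly.mnm1E eqxx subn1.
  rewrite derivM derivC mul0r add0r derivXn hornerM hornerC hornerMn hornerXn.
  by rewrite -[_ ^+ _ *+ _]mulr_natl; ring.
Qed.

Lemma line_pol_peval m n (p : cpoly R n) : deg_le m p -> line_pol m (peval p).
Proof.
by move=> dp x l; have [P [sP PE _]] := peval_line x l dp; exists P.
Qed.

Lemma deg_le_pdiff m n (p : cpoly R n) l : deg_le m p -> deg_le m (pdiff l p).
Proof.
rewrite /deg_le /pdiff /mpoly.mderiv => dp.
apply: (leq_trans (@mpoly.mmeasure_sum _ _ _ _ _ _ _)).
apply/bigmax_leqP_seq => a ap _.
apply: (leq_trans (@mpoly.mmeasureZ_le _ _ _ _ _)); rewrite mpoly.mmeasureX.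
apply: leq_trans (leq_trans (mpoly.msize_mdeg_lt ap) dp).
rewrite ltnS /= !mpoly.mdegE; apply: leq_sum => i _.
by rewrite mpoly.mnmBE leq_subr.
Qed.

Definition bigbox n (b : 'rV[R]_n) (r : R) : set 'rV[R]_n :=
  [set x | forall i, `|x 0 i - b 0 i| <= r].

(* Coordinate by coordinate, through the restrictions of the polynomial to lines. *)
Lemma box_ext m (M : R) n : 1 <= M -> exists2 c : R, 0 < c &
  forall (b : 'rV[R]_n) s (p : cpoly R n) B, 0 < s -> deg_le m p ->
  (forall x, box b s x -> sq (peval p x) <= B) ->
  forall x, bigbox b (M * s) x ->
    sq (peval p x) <= c * B /\ forall l, sq (peval (pdiff l p) x) <= c * B / s ^+ 2.
Proof.
move=> M1; have [c c0 H] := @segment_ext R m M M1.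
exists (c ^+ n + c * c ^+ n); first by rewrite addr_gt0 ?mulr_gt0 ?exprn_gt0.
move=> b s p B s0 dp pB.
have B0 : 0 <= B.
  apply: le_trans (pB b _); first exact: sq_ge0.
  by move=> i; rewrite lexx lerDl ltW.
(* Coordinates of index below [j] range over the large box, the others still over the small one;
   each release of a coordinate costs a factor [c]. *)
have key j : forall x, (j <= n)%N -> bigbox b (M * s) x ->
    (forall i : 'I_n, (j <= i)%N -> b 0 i <= x 0 i <= b 0 i + s) ->
    sq (peval p x) <= c ^+ j * B.
  elim: j => [|j IH] x jn bx xj.
    by rewrite mul1r; apply: pB => i; exact: xj.
  pose l := Ordinal jn.
  have [P [sP PE _]] := peval_line x l dp.
  have PB t : b 0 l <= t <= b 0 l + s -> sq P.[(t%:C)%C] <= c ^+ j * B.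
    move=> tI; rewrite -PE; apply: IH; [exact: ltnW| |].
    - move=> i; rewrite mxE; case: eqP => [->|_]; last exact: bx.
      move: tI => /andP[t1 t2]; rewrite ger0_norm ?subr_ge0// lerBlDl (le_trans t2)//.
      by rewrite lerD2l ler_peMl// ltW.
    - move=> i ji; rewrite mxE; case: eqP => [->//|/eqP il]; apply: xj.
      by rewrite ltn_neqAle ji andbT; apply: contra il => /eqP ji'; apply/eqP/val_inj.
  rewrite -(upd_id x l) PE exprS -mulrA.
  by have [] := H _ _ _ _ s0 sP PB (x 0 l) (bx l).
have key' x : bigbox b (M * s) x -> sq (peval p x) <= c ^+ n * B.
  by move=> bx; apply: (key n) => // i; rewrite leqNgt ltn_ord.
have cB : 0 <= c ^+ n * B by rewrite mulr_ge0// exprn_ge0// ltW.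
move=> x bx; split.
  by apply: le_trans (key' x bx) _; rewrite mulrDl lerDl -mulrA mulr_ge0// ltW.
(* The values are now bounded on the whole large box, so one more application along direction [l]
   bounds the derivative. *)
move=> l; have [P [sP PE P'E]] := peval_line x l dp.
have PB t : b 0 l <= t <= b 0 l + s -> sq P.[(t%:C)%C] <= c ^+ n * B.
  move=> /andP[t1 t2]; rewrite -PE; apply: key' => i; rewrite mxE; case: eqP => [->|_]; last exact: bx.
  rewrite ger0_norm ?subr_ge0// lerBlDl (le_trans t2)//.
  by rewrite lerD2l ler_peMl// ltW.
rewrite -(upd_id x l) P'E.
have [_ h] := H _ _ _ _ s0 sP PB (x 0 l) (bx l).
apply: le_trans h _; rewrite ler_pM2r ?invr_gt0 ?exprn_gt0// mulrDl mulrA.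
by rewrite lerDr.
Qed.

Lemma norm_itv_le (a b t : R) : a <= t <= b -> `|t| <= `|a| + `|b|.
Proof.
by case/andP; case: (ger0P t); case: (ger0P a); case: (ger0P b); lra.
Qed.

Lemma quadruple_le (a b A D : R) : a <= A -> b <= D -> D <= A -> 2 * a + 2 * b <= 4 * A.
Proof. lra. Qed.

(** A path from [x] to [y] is followed that changes one coordinate at a time. Its corners lie in the
    large box, where [box_ext] bounds the gradient; each leg is a one-dimensional Poincare
    inequality, and appending a leg costs at most a factor 4. *)
Lemma box_poincare m (M : R) n : 1 <= M -> exists2 c : R, 0 < c &
  forall (b : 'rV[R]_n) s (p : cpoly R n) B, 0 < s -> 0 <= B -> deg_le m p ->
  (forall x l, box b s x -> sq (peval (pdiff l p) x) <= B) ->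
  forall x y, bigbox b (M * s) x -> bigbox b (M * s) y ->
    sq (peval p x - peval p y) <= c * (s ^+ 2 * B).
Proof.
move=> M1; have [c c0 H] := @segment_poincare R m M M1.
have [c1 c10 H1] := @box_ext m M n M1.
exists (4 ^+ n * (c * c1)); first by rewrite !mulr_gt0 ?exprn_gt0.
move=> b s p B s0 B0 dp pB x y bx by_.
have pB' z l : bigbox b (M * s) z -> sq (peval (pdiff l p) z) <= c1 * B.
  by move=> bz; have [] := H1 b s (pdiff l p) B s0 (deg_le_pdiff l dp) (fun x h => pB x l h) z bz.
pose z j : 'rV[R]_n := \row_i (if (i < j)%N then y 0 i else x 0 i).
have bz j : bigbox b (M * s) (z j).
  by move=> i; rewrite mxE; case: ifP => _; [exact: by_|exact: bx].
have [D DE] : exists D, D = c * (s ^+ 2 * (c1 * B)) by eexists.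
have step j : (j < n)%N -> sq (peval p (z j) - peval p (z j.+1)) <= D.
  move=> jn; pose l := Ordinal jn.
  have [P [sP PE P'E]] := peval_line (z j) l dp.
  have zj : z j = upd (z j) l (x 0 l).
    by rewrite -[LHS](upd_id _ l); congr upd; rewrite mxE ltnn.
  have zj1 : z j.+1 = upd (z j) l (y 0 l).
    apply/rowP => i; rewrite !mxE ltnS leq_eqVlt.
    have [->|il] := eqVneq i l; first by rewrite eqxx.
    by rewrite (_ : (_ == j) = false)//; apply: contraNF il => /eqP ij; apply/eqP/val_inj.
  rewrite DE zj1 {1}zj !PE; apply: H => // t tI.
  rewrite -P'E; apply: pB' => i; rewrite mxE; case: eqP => [->|_]; last exact: bz.
  move: tI => /andP[t1 t2]; rewrite ger0_norm ?subr_ge0// lerBlDl (le_trans t2)//.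
  by rewrite lerD2l ler_peMl// ltW.
have z0 : z 0%N = x by apply/rowP => i; rewrite mxE.
have zn : z n = y by apply/rowP => i; rewrite mxE ltn_ord.
have D0 : 0 <= D by rewrite DE !mulr_ge0 ?exprn_ge0 ?(ltW c0) ?(ltW c10) ?(ltW s0).
have key j : (j <= n)%N -> sq (peval p x - peval p (z j)) <= 4 ^+ j * D.
  elim: j => [|j IH] jn; first by rewrite z0 subrr sq0 mul1r.
  have -> : peval p x - peval p (z j.+1) =
      (peval p x - peval p (z j)) + (peval p (z j) - peval p (z j.+1)).
    by rewrite addrA subrK.
  apply: le_trans (sqD_le _ _) _; have h1 := IH (ltnW jn); have h2 := step j jn.
  have : D <= 4 ^+ j * D by rewrite ler_peMl// exprn_ege1// ler1n.
  by rewrite exprS -[_ * _ * D]mulrA; exact: quadruple_le h1 h2.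
rewrite -zn; apply: le_trans (key n (leqnn n)) _.
rewrite le_eqVlt; apply/orP; left; apply/eqP; rewrite DE.
by move: (4 ^+ n) (s ^+ 2) => A s2; ring.
Qed.

Lemma upd_cons_rowS n t (y : 'rV[R]_n) i u :
  upd (cons_row t y) (lift ord0 i) u = cons_row t (upd y i u).
Proof.
apply/rowP => j; rewrite mxE; case: (unliftP ord0 j) => [k ->|->].
  by rewrite !cons_rowS mxE (inj_eq lift_inj).
by rewrite !cons_row0.
Qed.

Lemma upd_cons_row0 n t (y : 'rV[R]_n) u : upd (cons_row t y) ord0 u = cons_row u y.
Proof.
apply/rowP => j; rewrite mxE; case: (unliftP ord0 j) => [k ->|->].
  by rewrite !cons_rowS.
by rewrite !cons_row0.
Qed.

Lemma cons_row_split n (x : 'rV[R]_n.+1) :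
  x = cons_row (x 0 ord0) (\row_i x 0 (lift ord0 i)).
Proof.
apply/rowP => j; case: (unliftP ord0 j) => [k ->|->].
  by rewrite cons_rowS mxE.
by rewrite cons_row0.
Qed.

Lemma nice_slice n t (f : 'rV[R]_n.+1 -> C) : nice f -> nice (fun y => f (cons_row t y)).
Proof.
move=> nf; apply: nice_comp => // i; case: (unliftP ord0 i) => [k ->|->].
  by apply: eq_lbm (@lbm_coord R n k) => y; rewrite cons_rowS.
by apply: eq_lbm (lbm_cst n t) => y; rewrite cons_row0.
Qed.

(** The one-dimensional bound in the first coordinate leaves an integral of values on slices, and
    the induction hypothesis replaces each value by an integral over its slice. The result is
    already the iterated integral, in the right order. *)
Lemma box_sup_le_int m n : exists2 c : R, 0 < c &
  forall (b : 'rV[R]_n) s (f : 'rV[R]_n -> C), 0 < s -> nice f -> line_pol m f ->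
  forall x, box b s x -> sq (f x) <= c / s ^+ n * rint (box b s) (fun x => sq (f x)).
Proof.
have [c1 c10 H1] := @segment_sup_le_int R m.
elim: n => [|n [c c0 IH]].
  exists 1 => // b s f s0 nf pf x bx; rewrite expr0 divr1 mul1r /rint /=.
  rewrite indicE mem_set ?mul1r; first by rewrite (_ : x = 0)//; apply/rowP => - [].
  by case.
exists (c1 * c); first exact: mulr_gt0.
move=> b s f s0 nf pf x bx.
pose y : 'rV[R]_n := \row_i x 0 (lift ord0 i).
pose b' : 'rV[R]_n := \row_i b 0 (lift ord0 i).
have bE t z : box b s (cons_row t z) <-> (b 0 ord0 <= t <= b 0 ord0 + s) /\ box b' s z.
  split=> [h|[h1 h2] i].
    by have := h ord0; rewrite cons_row0; split=> // i; have := h (lift ord0 i); rewrite cons_rowS mxE.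
  case: (unliftP ord0 i) => [k ->|->]; last by rewrite cons_row0.
  by have := h2 k; rewrite cons_rowS mxE.
have [P sP PE] := pf x ord0.
have {}PE t : f (cons_row t y) = P.[(t%:C)%C] by rewrite -PE [x in upd x]cons_row_split upd_cons_row0.
set a := b 0 ord0 in bE.
have by' : box b' s y by move=> i; rewrite !mxE; exact: bx.
pose g (t : R) : R := \1_(`[a, a + s]%classic : set R) t.
have gi : lebesgue_measure.-integrable setT (EFin \o (fun t => g t * sq P.[(t%:C)%C])).
  have [mf bf] := lbm_sq nf.
  have [B hB] := bf (`|a| + `|a + s| + \sum_i `|y 0 i|).
  have bd t : a <= t <= a + s -> `|sq P.[(t%:C)%C]| <= B.
    move=> /andP[t1 t2]; rewrite -PE; apply: hB => i; case: (unliftP ord0 i) => [k ->|->].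
      rewrite cons_rowS (bigD1 k)//= [leRHS]addrCA lerDl.
      by rewrite !addr_ge0// sumr_ge0.
    rewrite cons_row0; apply: le_trans (@norm_itv_le a (a + s) t _) _; first by rewrite t1.
    by rewrite lerDl sumr_ge0.
  have B0 : 0 <= B by apply: le_trans (bd a _); rewrite ?lexx ?lerDl ?(ltW s0).
  apply: (@integrable_bdd R _ (`|a| + `|a + s|) B).
  - apply: measurable_funM; first exact: measurable_indic.
    apply: eq_measurable_fun (mf _ _ (fun t : R => cons_row t y) _) => [t _|i].
      by rewrite PE.
    case: (unliftP ord0 i) => [k ->|->].
      by apply: eq_measurable_fun (measurable_cst (y 0 k)) => t _; rewrite cons_rowS.
    by apply: eq_measurable_fun (@measurable_id _ _ setT) => t _; rewrite cons_row0.
  - move=> t; rewrite /g indicE; have [/set_mem|_] := boolP (t \in _).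
      by rewrite /= in_itv/= mul1r; exact: bd.
    by rewrite mul0r normr0.
  - move=> t ht; rewrite /g indicE memNset ?mul0r//= in_itv/= => tI.
    by move: ht; rewrite ltNge => /negP; apply; exact: norm_itv_le.
have xa : a <= x 0 ord0 <= a + s by exact: bx.
rewrite (cons_row_split x) -/y PE; apply: le_trans (H1 a s P s0 sP gi _ xa) _.
set I := (X in c1 / s * X <= _); set J := rint _ _.
have IJ : I <= c / s ^+ n * J.
  have iJ := integrable_slices (good_on (bset_box b s) (lbm_sq nf)).
  rewrite /J /rint iintS -RintegralZl//.
  apply: le_Rintegral => //.
    have := integrableZl measurableT (c / s ^+ n) iJ.
    by congr integrable; apply/funext => t /=; rewrite EFinM.
  move=> t _; have [tI|tI] := boolP (a <= t <= a + s); last first.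
    rewrite indicE memNset ?mul0r; last by rewrite /= in_itv/=; exact/negP.
    rewrite mulr_ge0 ?divr_ge0 ?exprn_ge0 ?(ltW c0) ?(ltW s0)//.
    by apply: iint_ge0 => z; rewrite mulr_ge0// sq_ge0.
  rewrite indicE mem_set ?mul1r; last by rewrite /= in_itv.
  have pft : line_pol m (fun z => f (cons_row t z)).
    move=> z l; have [Q sQ QE] := pf (cons_row t z) (lift ord0 l).
    by exists Q => // u; rewrite -QE upd_cons_rowS.
  rewrite -PE; apply: le_trans (IH b' s _ s0 (nice_slice t nf) pft y by') _.
  rewrite le_eqVlt; apply/orP; left; apply/eqP; congr (_ * _).
  congr iint; apply/funext => z; congr (_ * _); rewrite !indicE; congr (nat_of_bool _)%:R.
  by apply/idP/idP; rewrite !in_setE; [move=> h; exact/bE|move=> /bE[]].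
have cs : 0 <= c1 / s by rewrite divr_ge0 ?(ltW c10) ?(ltW s0).
apply: le_trans (ler_wpM2l cs IJ) _; rewrite le_eqVlt; apply/orP; left; apply/eqP.
by rewrite exprS invfM !mulrA; congr (_ * _); rewrite -!mulrA; congr (_ * _); rewrite mulrCA.
Qed.

End BoxEstimates.

(** * Sets containing a cube of comparable size *)

Section ChunkySets.
Variable R : realType.
Local Notation C := R[i].

Lemma deg_le_subC m n (p : cpoly R n) v : deg_le m p -> deg_le m (p - mpoly.mpolyC n v).
Proof.
rewrite /deg_le => dp; apply: (leq_trans (@mpoly.mmeasureD_le _ _ _ _ _)).
rewrite geq_max dp mpoly.mmeasureN; apply: leq_trans (ltn0Sn m).
by rewrite mpoly.mmeasureC; case: (v == 0).
Qed.

Lemma peval_subC n (p : cpoly R n) v x : peval (p - mpoly.mpolyC n v) x = peval p x - v.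
Proof. by rewrite /peval rmorphB /= mpoly.mevalC. Qed.

Lemma pdiff_subC n (p : cpoly R n) v l : pdiff l (p - mpoly.mpolyC n v) = pdiff l p.
Proof. by rewrite /pdiff mpoly.mderivB mpoly.mderivC subr0. Qed.

(** Only the cube inside [A] is examined: its integral is at most the one over [A], it bounds the
    supremum on the cube, and [box_ext] carries this bound to the larger box. *)
Lemma chunky_sup m (M : R) n : 1 <= M -> exists2 c : R, 0 < c &
  forall (A : set 'rV[R]_n) b s (p : cpoly R n), 0 < s -> bset A -> box b s `<=` A ->
  deg_le m p -> forall x, bigbox b (M * s) x ->
  sq (peval p x) <= c / s ^+ n * rint A (fun x => sq (peval p x)).
Proof.
move=> M1; have [c c0 H] := @box_ext R m M n M1.
have [c1 c10 H1] := @box_sup_le_int R m n.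
exists (c * c1); first exact: mulr_gt0.
move=> A b s p s0 bA sA dp x bx; rewrite -!mulrA [c1 * _]mulrA.
have [|h _] := H b s p (c1 / s ^+ n * rint A (fun x => sq (peval p x))) s0 dp _ x bx; last exact: h.
move=> y yb; apply: le_trans (H1 b s _ s0 (nice_peval p) (line_pol_peval dp) y yb) _.
apply: ler_wpM2l; first by rewrite divr_ge0 ?exprn_ge0 ?(ltW s0) ?(ltW c10).
have lp := lbm_sq (nice_peval p).
by apply: rint_le => // [|z _]; [exact: bset_box|exact: sq_ge0].
Qed.

Lemma chunky_poincare m (M : R) n : 1 <= M -> exists2 c : R, 0 < c &
  forall (A : set 'rV[R]_n) b s (p : cpoly R n), 0 < s -> bset A -> box b s `<=` A ->
  deg_le m p -> forall x y, bigbox b (M * s) x -> bigbox b (M * s) y ->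
  sq (peval p x - peval p y) <=
    c * (s ^+ 2 / s ^+ n * rint A (fun x => \sum_l sq (peval (pdiff l p) x))).
Proof.
move=> M1; have [c c0 H] := @box_poincare R m M n M1.
have [c1 c10 H1] := @chunky_sup m M n M1.
exists (c * c1); first exact: mulr_gt0.
move=> A b s p s0 bA sA dp x y bx by_.
set I := rint A _.
have I0 : 0 <= I by apply: rint_ge0 => z _; apply: sumr_ge0 => l _; exact: sq_ge0.
have cs : 0 <= c1 / s ^+ n by rewrite divr_ge0 ?exprn_ge0 ?(ltW s0) ?(ltW c10).
apply: le_trans (H b s p (c1 / s ^+ n * I) s0 _ dp _ x y bx by_) _.
- exact: mulr_ge0.
- move=> z l zb; have zb' : bigbox b (M * s) z.
    move=> i; have /andP[h1 h2] := zb i; rewrite ger0_norm ?subr_ge0//.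
    by rewrite lerBlDl (le_trans h2)// lerD2l ler_peMl// ltW.
  apply: le_trans (H1 A b s _ s0 bA sA (deg_le_pdiff l dp) z zb') _.
  apply: ler_wpM2l => //; apply: rint_mono => //.
  + exact: lbm_sq (nice_peval _).
  + by apply: lbm_sum => i _; exact: lbm_sq (nice_peval _).
  + by move=> u _; rewrite (bigD1 l)//= lerDl sumr_ge0// => i _; exact: sq_ge0.
- rewrite le_eqVlt; apply/orP; left; apply/eqP.
  by move: (s ^+ 2) ((s ^+ n)^-1) I {cs I0} => s2 sn I; ring.
Qed.

End ChunkySets.

(** * Simplices and regular meshes *)

Section Euclidean.
Variable R : realType.
Implicit Types n : nat.

Lemma dotpDl n (x y z : 'rV[R]_n) : dotp (x + y) z = dotp x z + dotp y z.
Proof. by rewrite -big_split; apply: eq_bigr => i _; rewrite mxE mulrDl. Qed.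

Lemma dotpC n (x y : 'rV[R]_n) : dotp x y = dotp y x.
Proof. by apply: eq_bigr => i _; rewrite mulrC. Qed.

Lemma dotpZl n c (x y : 'rV[R]_n) : dotp (c *: x) y = c * dotp x y.
Proof. by rewrite /dotp mulr_sumr; apply: eq_bigr => i _; rewrite mxE mulrA. Qed.

Lemma dotp_ge0 n (x : 'rV[R]_n) : 0 <= dotp x x.
Proof. by apply: sumr_ge0 => i _; rewrite -expr2 sqr_ge0. Qed.

Lemma dotp_eq0 n (x : 'rV[R]_n) : dotp x x = 0 -> x = 0.
Proof.
move=> /eqP; rewrite psumr_eq0 => [/allP h|i _]; last by rewrite -expr2 sqr_ge0.
apply/rowP => i; rewrite mxE; apply/eqP; rewrite -sqrf_eq0 expr2.
by apply: h; rewrite mem_index_enum.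
Qed.

Lemma dotp_cauchy n (x y : 'rV[R]_n) : dotp x y ^+ 2 <= dotp x x * dotp y y.
Proof.
have [y0|yn0] := eqVneq (dotp y y) 0.
  have d0 z : dotp z (0 : 'rV[R]_n) = 0 by rewrite /dotp big1// => i _; rewrite mxE mulr0.
  by rewrite (dotp_eq0 y0) !d0 mulr0 expr0n.
have y0 : 0 < dotp y y by rewrite lt_neqAle eq_sym yn0 dotp_ge0.
have := dotp_ge0 (dotp y y *: x + (- dotp x y) *: y).
rewrite dotpDl !dotpZl [dotp x (_ + _)]dotpC [dotp y (_ + _)]dotpC !dotpDl !dotpZl (dotpC y x).
move: (dotp x x) (dotp x y) (dotp y y) y0 => a b c c0 h.
have {}h : 0 <= c * (a * c - b ^+ 2) by apply: le_trans h _; rewrite le_eqVlt; apply/orP; left; apply/eqP; ring.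
by rewrite -subr_ge0 -(pmulr_rge0 _ c0).
Qed.

Lemma enormZ n c (x : 'rV[R]_n) : enorm (c *: x) = `|c| * enorm x.
Proof.
by rewrite /enorm dotpZl dotpC dotpZl mulrA -expr2 sqrtrM ?sqr_ge0// sqrtr_sqr.
Qed.

Lemma coord_le_enorm n (x : 'rV[R]_n) i : `|x 0 i| <= enorm x.
Proof.
rewrite -sqrtr_sqr ler_wsqrtr// /dotp (bigD1 i)//= -expr2 lerDl sumr_ge0// => j _.
by rewrite -expr2 sqr_ge0.
Qed.

Lemma enorm_le_coord n (x : 'rV[R]_n) r : 0 <= r -> (forall i, `|x 0 i| <= r) ->
  enorm x <= n%:R * r.
Proof.
move=> r0 xr; rewrite -(ger0_norm (mulr_ge0 (ler0n R n) r0)) -sqrtr_sqr ler_wsqrtr//.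
apply: le_trans (_ : \sum_(i < n) r ^+ 2 <= _).
  by apply: ler_sum => i _; rewrite -expr2 -(real_normK (num_real (x 0 i))) lerXn2r ?nnegrE.
rewrite sumr_const card_ord exprMn -[X in X <= _]mulr_natl ler_wpM2r ?sqr_ge0//.
rewrite expr2 -natrM ler_nat; case: (n) => // k; exact: leq_pmulr.
Qed.

Lemma enorm_eq0 n (x : 'rV[R]_n) : enorm x = 0 -> x = 0.
Proof.
by move=> /eqP; rewrite sqrtr_eq0 => h; apply/dotp_eq0/eqP; rewrite eq_le h dotp_ge0.
Qed.

Lemma enorm_le_diam n (A : set 'rV[R]_n) M x y :
  (forall x, A x -> forall i, `|x 0 i| <= M) -> A x -> A y -> enorm (x - y) <= diam A.
Proof.
move=> bA Ax Ay; apply: ub_le_sup; last by exists x, y.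
exists (n%:R * (`|M| + `|M|)) => _ [u [v [Au Av ->]]].
apply: enorm_le_coord => [|i]; first by rewrite addr_ge0.
rewrite !mxE; apply: le_trans (ler_normD _ _) _; rewrite normrN.
by rewrite lerD// (le_trans (bA _ _ i))// ler_norm.
Qed.

Lemma diam_le n (A : set 'rV[R]_n) r : A !=set0 ->
  (forall x y, A x -> A y -> enorm (x - y) <= r) -> diam A <= r.
Proof.
move=> [z Az] h; apply: ge_sup; first by exists (enorm (z - z)), z, z.
by move=> _ [x [y [Ax Ay ->]]]; exact: h.
Qed.

Lemma det_le n (A : 'M[R]_n) x : (forall i j, `|A i j| <= x) -> `|\det A| <= n`!%:R * x ^+ n.
Proof.
move=> Ax; rewrite /determinant; apply: le_trans (ler_norm_sum _ _ _) _.
apply: le_trans (_ : \sum_(s : {perm 'I_n}) x ^+ n <= _).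
  apply: ler_sum => s _; rewrite normrM normrX normrN1 expr1n mul1r normr_prod.
  rewrite -[in leRHS](card_ord n) -prodr_const; apply: ler_prod => i _.
  by rewrite normr_ge0 Ax.
rewrite sumr_const -[X in X <= _]mulr_natl le_eqVlt; apply/orP; left; apply/eqP.
by congr (_%:R * _); rewrite -card_Sn; apply: eq_card => s; rewrite !inE.
Qed.

(* Cauchy-Binet would give this for every q; faces have dimension at most 2. *)
Lemma gram_det_ge0 q n (E : 'M[R]_(q, n)) : (q <= 2)%N -> 0 <= \det (E *m E^T).
Proof.
have EE i j : (E *m E^T) i j = dotp (row i E) (row j E).
  by rewrite mxE; apply: eq_bigr => k _; rewrite !mxE.
case: q E EE => [|[|[|//]]] E EE _; first by rewrite det_mx00.
  by rewrite det_mx11 EE dotp_ge0.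
rewrite (expand_det_row _ ord0) !big_ord_recl big_ord0 /cofactor !det_mx11 !mxE.
rewrite -!/(dotp _ _) /=.
have -> : lift ord0 0 = ord_max :> 'I_2 by apply/val_inj.
have -> : lift (ord_max : 'I_2) 0 = ord0 by apply/val_inj.
pose u := row ord0 E; pose v := row ord_max E.
have := dotp_cauchy u v; rewrite -subr_ge0; congr (0 <= _).
have DE i j : \sum_k E i k * E^T k j = dotp (row i E) (row j E).
  by apply: eq_bigr => k _; rewrite !mxE.
rewrite !DE -/u -/v (dotpC v u) /= /bump /= expr0 expr1; ring.
Qed.

(** Keeps the area of a face away from 0: [E] will be its edge matrix, and [B] will consist of
    gradients of barycentric coordinates. The inverse Gram matrix has bounded entries, hence a
    bounded determinant. *)
Lemma gram_det_lower q n (E : 'M[R]_(q, n)) (B : 'M[R]_(n, q)) beta :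
  (q <= 2)%N -> 0 < beta -> E *m B = 1%:M -> (forall i j, `|B i j| <= beta) ->
  1 <= q`!%:R * (n%:R * beta ^+ 2) ^+ q * \det (E *m E^T).
Proof.
move=> q2 b0 EB Bb; set A := E *m E^T.
(* A row vector in the kernel satisfies [|v *m E|^2 = 0], and the right inverse [B] recovers [v]
   from [v *m E]. *)
have Au : A \in unitmx.
  rewrite -row_free_unit -kermx_eq0; apply/eqP/row_matrixP => i; rewrite row0.
  set v := row i _; have vA : v *m A = 0 by rewrite /v -row_mul mulmx_ker row0.
  have vE : v *m E = 0.
    apply: dotp_eq0; transitivity ((v *m A *m v^T) 0 0).
      rewrite /A -!mulmxA -trmx_mul mulmxA mxE.
      by apply: eq_bigr => k _; rewrite [_^T k 0]mxE.
    by rewrite vA mul0mx mxE.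
  by rewrite -[LHS]mulmx1 -EB mulmxA vE mul0mx.
(* The rows y_i of Z E satisfy |y_i|^2 = Z_ii = y_i . b_i and Z_ij = y_i . b_j, where b_j is the
   j-th column of B, so Cauchy-Schwarz bounds the entries of the inverse Gram matrix Z. *)
pose Z := invmx A; have ZA : Z *m A = 1%:M by exact: mulVmx.
have AT : A^T = A by rewrite /A trmx_mul trmxK.
have ZT : Z^T = Z by rewrite /Z trmx_inv AT.
pose y i := row i (Z *m E); pose b j := row j B^T.
have yy i j : dotp (y i) (y j) = Z i j.
  transitivity ((Z *m E *m (Z *m E)^T) i j).
    by rewrite !mxE; apply: eq_bigr => k _; rewrite !mxE.
  by rewrite trmx_mul ZT mulmxA -[Z *m E *m E^T]mulmxA ZA mul1mx.
have yb i j : dotp (y i) (b j) = Z i j.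
  transitivity ((Z *m E *m B) i j).
    by rewrite !mxE; apply: eq_bigr => k _; rewrite !mxE.
  by rewrite -mulmxA EB mulmx1.
pose r : R := n%:R * beta ^+ 2.
have r0 : 0 <= r by rewrite mulr_ge0// exprn_ge0// ltW.
have bb j : dotp (b j) (b j) <= r.
  rewrite /r mulr_natl -[in leRHS](card_ord n) -sumr_const; apply: ler_sum => k _.
  rewrite !mxE -expr2 -(real_normK (num_real (B k j))) lerXn2r ?nnegrE ?(ltW b0)//.
have Zii i : 0 <= Z i i <= r.
  have Z0 : 0 <= Z i i by rewrite -yy dotp_ge0.
  rewrite Z0 /=; have := dotp_cauchy (y i) (b i); rewrite yb yy => h.
  have {}h := le_trans h (ler_wpM2l Z0 (bb i)).
  have [Zle0|Zgt0] := leP (Z i i) 0; first exact: le_trans Zle0 r0.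
  by rewrite expr2 ler_pM2l in h.
have Zij i j : `|Z i j| <= r.
  have := dotp_cauchy (y i) (b j); rewrite yb yy => h.
  rewrite -(@ler_pXn2r _ 2) ?nnegrE// real_normK ?num_real//.
  by apply: le_trans h _; rewrite expr2 ler_pM ?dotp_ge0//; case/andP: (Zii i).
have := det_le Zij; rewrite -/r.
have : \det Z * \det A = 1 by rewrite -det_mulmx ZA det1.
have := gram_det_ge0 E q2; rewrite -/A.
move: (\det A) (\det Z) (q`!%:R * r ^+ q) => a z c a0 za zc.
have z0 : 0 <= z by rewrite leNgt; apply/negP => zlt; nra.
by rewrite -za ler_wpM2r// -(ger0_norm z0).
Qed.

End Euclidean.

(** * Barycentric coordinates *)

Section Simplices.
Variable R : realType.

Section OneSimplex.
Variables (n : nat) (a : 'I_n.+1 -> 'rV[R]_n).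

(** The gradient of the barycentric coordinate of vertex [j]: a column of the inverse edge matrix,
    except at vertex 0, where it is determined by the coordinates having sum 1. *)
Definition bgrad (j : 'I_n.+1) (l : 'I_n) : R :=
  if unlift ord0 j is Some i then invmx (edges a) l i
  else - \sum_i invmx (edges a) l i.

Definition bary (x : 'rV[R]_n) (j : 'I_n.+1) : R :=
  (j == ord0)%:R + \sum_l (x 0 l - a ord0 0 l) * bgrad j l.

Hypothesis aU : edges a \in unitmx.

Lemma bary_sub x y j : bary x j - bary y j = \sum_l (x 0 l - y 0 l) * bgrad j l.
Proof.
rewrite /bary opprD addrACA subrr add0r -sumrB; apply: eq_bigr => l _.
by rewrite -mulrBl; congr (_ * _); ring.
Qed.

Lemma lbm_bary j : lbm (fun x => bary x j).
Proof.
apply: lbmD; first exact: lbm_cst.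
apply: lbm_sum => l _; apply: lbmM; last exact: lbm_cst.
by apply: lbmB; [exact: lbm_coord|exact: lbm_cst].
Qed.

Let bary_lift x i : bary x (lift ord0 i) = ((x - a ord0) *m invmx (edges a)) 0 i.
Proof.
by rewrite /bary /bgrad liftK add0r mxE; apply: eq_bigr => l _; rewrite !mxE.
Qed.

Lemma bary_sum x : \sum_j bary x j = 1.
Proof.
rewrite big_ord_recl [X in X + _]/bary eqxx /bgrad unlift_none.
rewrite (_ : \sum_l _ = - \sum_i bary x (lift ord0 i)) ?subrK//.
under eq_bigr do rewrite mulrN mulr_sumr.
rewrite sumrN exchange_big /=; congr (- _); apply: eq_bigr => i _.
by rewrite bary_lift mxE; apply: eq_bigr => l _; rewrite !mxE.
Qed.

Lemma bary_unique w x : \sum_j w j = 1 -> x = \sum_j w j *: a j -> forall j, bary x j = w j.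
Proof.
move=> w1 xE.
have xw : x - a ord0 = (\row_i w (lift ord0 i)) *m edges a.
  rewrite xE mulmx_sum_row -[X in _ - X]scale1r -w1 scaler_suml -sumrB big_ord_recl subrr add0r.
  apply: eq_bigr => i _; apply/rowP => l; rewrite !mxE; ring.
have wS i : bary x (lift ord0 i) = w (lift ord0 i).
  by rewrite bary_lift xw mulmxK// mxE.
move=> j; case: (unliftP ord0 j) => [i ->//|->].
have := bary_sum x; rewrite -{}w1 !big_ord_recl.
by under eq_bigr do rewrite wS; move/addIr.
Qed.

Lemma bary_comb x : x = \sum_j bary x j *: a j.
Proof.
have xw : x - a ord0 = (\row_i bary x (lift ord0 i)) *m edges a.
  rewrite (_ : \row_i _ = (x - a ord0) *m invmx (edges a)) ?mulmxKV//.
  by apply/rowP => i; rewrite mxE bary_lift.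
have : x = a ord0 + (x - a ord0) by rewrite addrC subrK.
rewrite xw mulmx_sum_row => {1}->.
rewrite -[X in X + _]scale1r -(bary_sum x) !big_ord_recl scalerDl -addrA; congr (_ + _).
rewrite scaler_suml -big_split; apply: eq_bigr => i _; apply/rowP => l; rewrite !mxE; ring.
Qed.

Lemma bary_vertex k j : bary (a k) j = (j == k)%:R.
Proof.
apply: (bary_unique (w := fun j => (j == k)%:R)).
  by rewrite (bigD1 k)//= eqxx big1 ?addr0// => i /negPf ->.
by rewrite (bigD1 k)//= eqxx scale1r big1 ?addr0// => i /negPf ->; rewrite scale0r.
Qed.

Lemma open_simplexP x : open_simplex a x <-> forall j, 0 < bary x j.
Proof.
split=> [[w [w0 w1 xw]] j|x0]; first by rewrite (bary_unique w1 xw).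
by exists (bary x); split=> //; [exact: bary_sum|exact: bary_comb].
Qed.

Lemma bary_lt1 x j : (0 < n)%N -> open_simplex a x -> bary x j < 1.
Proof.
move=> n0 /open_simplexP x0; rewrite -(bary_sum x) (bigD1 j)//= ltrDl.
have [k kj] : exists k : 'I_n.+1, k != j.
  case: (eqVneq j ord0) => [->|j0]; last by exists ord0; rewrite eq_sym.
  by exists ord_max; rewrite -(inj_eq val_inj) /= -lt0n.
rewrite (bigD1 k)//=; apply: ltr_pwDl => //.
by apply: sumr_ge0 => i _; exact: ltW.
Qed.

Lemma open_simplex_sub_hull : open_simplex a `<=` hull a finset.setT.
Proof.
move=> x [w [w0 w1 ->]]; exists w; split=> // j; first exact: ltW.
by rewrite finset.inE.
Qed.

Lemma hull_bounded (q : nat) (c : 'I_q -> 'rV[R]_n) J x : hull c J x ->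
  forall i, `|x 0 i| <= \sum_j \sum_l `|c j 0 l|.
Proof.
move=> [w [w0 _ w1 ->]] i; rewrite summxE; apply: le_trans (ler_norm_sum _ _ _) _.
apply: ler_sum => j _; rewrite mxE normrM.
have wj : `|w j| <= 1.
  by rewrite ger0_norm// -w1 (bigD1 j)//= lerDl sumr_ge0.
apply: le_trans (_ : `|c j 0 i| <= _); first by rewrite ler_piMl.
by rewrite (bigD1 i)//= lerDl sumr_ge0.
Qed.

Lemma bset_open_simplex : bset (open_simplex a).
Proof.
split; last first.
  exists (\sum_j \sum_l `|a j 0 l|) => x /open_simplex_sub_hull; exact: hull_bounded.
have -> : (\1_(open_simplex a) : 'rV[R]_n -> R) = fun x : 'rV[R]_n =>
    \prod_j \1_(`]0, +oo[%classic : set R) (bary x j).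
  apply/funext => x; rewrite indicE.
  have [/set_mem/open_simplexP x0|/negP xA] := boolP (x \in open_simplex a).
    by rewrite big1// => j _; rewrite indicE mem_set//= in_itv/= x0.
  have [j hj] : exists j, ~ 0 < bary x j.
    by apply/existsNP => h; apply: xA; rewrite in_setE; exact/open_simplexP.
  rewrite (bigD1 j)//= indicE memNset ?mul0r//=.
  by rewrite in_itv/= andbT.
elim: (index_enum _) => [|j r IH].
  rewrite (_ : (fun x => _) = fun=> 1); first exact: mble_cst.
  by apply/funext => x; rewrite big_nil.
rewrite (_ : (fun x => _) = fun x : 'rV[R]_n => \1_(`]0, +oo[%classic : set R) (bary x j) *
   \prod_(i <- r) \1_(`]0, +oo[%classic : set R) (bary x i)); last first.
  by apply/funext => x; rewrite big_cons.
apply: mbleM => //; apply: mble_comp1; last exact: (lbm_bary j).1.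
exact: measurable_indic.
Qed.

(* An interior point of the simplex pulls the points of the closed simplex inside. *)
Lemma hull_le_diam x y : hull a finset.setT x -> hull a finset.setT y ->
  enorm (x - y) <= diam (open_simplex a).
Proof.
move=> [u [u0 _ u1 xu]] [v [v0 _ v1 yv]].
pose g := \sum_j (n.+1%:R^-1 : R) *: a j.
have g1 : \sum_(j < n.+1) (n.+1%:R^-1 : R) = 1.
  by rewrite sumr_const card_ord -[_ *+ _]mulr_natr mulVf// pnatr_eq0.
have inner (w : 'I_n.+1 -> R) t z : (forall j, 0 <= w j) -> \sum_j w j = 1 ->
    z = \sum_j w j *: a j -> 0 < t < 1 -> open_simplex a ((1 - t) *: z + t *: g).
  move=> w0 w1 zw /andP[t0 t1].
  exists (fun j => (1 - t) * w j + t * n.+1%:R^-1); split=> [j||].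
  - by rewrite ltr_pwDr ?mulr_gt0 ?invr_gt0 ?ltr0n// mulr_ge0// subr_ge0 ltW.
  - by rewrite big_split /= -!mulr_sumr w1 g1 !mulr1 subrK.
  - rewrite zw /g !scaler_sumr -big_split; apply: eq_bigr => j _ /=.
    by rewrite [in RHS]scalerDl !scalerA.
have key t : 0 < t < 1 -> (1 - t) * enorm (x - y) <= diam (open_simplex a).
  move=> t01; have /andP[t0 t1] := t01.
  have t1' : 0 <= 1 - t by rewrite subr_ge0 ltW.
  rewrite -{1}(ger0_norm t1') -enormZ.
  rewrite (_ : (1 - t) *: (x - y) = ((1 - t) *: x + t *: g) - ((1 - t) *: y + t *: g)).
    apply: (@enorm_le_diam _ _ _ (\sum_j \sum_l `|a j 0 l|)).
    - by move=> z /open_simplex_sub_hull; exact: hull_bounded.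
    - exact: (inner u).
    - exact: (inner v).
  by rewrite scalerBr opprD addrACA subrr addr0.
have e0 : 0 <= enorm (x - y) by exact: sqrtr_ge0.
move: (enorm (x - y)) (diam _) e0 key => e h e0 key.
rewrite leNgt; apply/negP => he.
have h0 : 0 <= h by have := key 2^-1; lra.
have ep : 0 < e by apply: le_lt_trans he.
(* For this parameter the left side of [key] is [(e + h) / 2], which exceeds [h]. *)
have := key ((e - h) / (2 * e)).
have -> : (1 - (e - h) / (2 * e)) * e = (e + h) / 2 by field; rewrite gt_eqF.
rewrite ltr_pdivrMr ?divr_gt0 ?mulr_gt0// ?subr_gt0// => hk.
have : (e + h) / 2 <= h by apply: hk; lra.
lra.
Qed.

Lemma diam_simplex_gt0 : (0 < n)%N -> 0 < diam (open_simplex a).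
Proof.
move=> n0; pose i0 : 'I_n := Ordinal n0.
have v j : hull a finset.setT (a j).
  exists (fun i => (i == j)%:R); split=> [i|i||]; rewrite ?ler0n ?finset.inE//.
    by rewrite (bigD1 j)//= eqxx big1 ?addr0// => i /negPf ->.
  by rewrite (bigD1 j)//= eqxx scale1r big1 ?addr0// => i /negPf ->; rewrite scale0r.
have := hull_le_diam (v ord0) (v (lift ord0 i0)); apply: lt_le_trans.
rewrite lt_neqAle eq_sym sqrtr_ge0 andbT; apply/eqP => /enorm_eq0/subr0_eq h.
have := bary_vertex ord0 ord0; rewrite h bary_vertex eqxx => /eqP.
by rewrite (negPf (neq_lift _ _)) eq_sym oner_eq0.
Qed.

(** A step of length [r / 2] from the centre along axis [l] stays in the simplex and changes the
    coordinate by [r / 2] times the gradient entry, whereas barycentric coordinates stay strictly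
    between 0 and 1. *)
Lemma bgrad_le c r : (0 < n)%N -> 0 < r ->
  [set y | enorm (y - c) < r] `<=` open_simplex a ->
  forall j l, `|bgrad j l| <= 2 / r.
Proof.
move=> n0 r0 sub j l.
pose y : 'rV[R]_n := c + (r / 2) *: delta_mx 0 l.
have yc : y - c = (r / 2) *: delta_mx 0 l by rewrite addrC addKr.
have e1 : enorm (delta_mx 0 l : 'rV[R]_n) = 1.
  rewrite /enorm /dotp (bigD1 l)//= big1 ?addr0 => [|i il]; last first.
    by rewrite !mxE (negPf il) mulr0.
  by rewrite !mxE !eqxx mulr1 sqrtr1.
have r20 : 0 < r / 2 by rewrite divr_gt0.
have yA : open_simplex a y.
  by apply: sub; rewrite /= yc enormZ e1 mulr1 gtr0_norm// ltr_pdivrMr//; lra.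
have cA : open_simplex a c.
  by apply: sub; rewrite /= subrr -(scale0r 0) enormZ normr0 mul0r.
have := bary_sub y c j; rewrite (bigD1 l)//= big1 ?addr0; last first.
  move=> i il; have -> : y 0 i - c 0 i = (y - c) 0 i by rewrite !mxE.
  by rewrite yc !mxE (negPf il) andbF mulr0 mul0r.
have -> : y 0 l - c 0 l = (y - c) 0 l by rewrite !mxE.
rewrite yc !mxE !eqxx mulr1 => h.
have y0 := (open_simplexP y).1 yA j; have c0 := (open_simplexP c).1 cA j.
have y1 := bary_lt1 j n0 yA; have c1 := bary_lt1 j n0 cA.
have : `|r / 2 * bgrad j l| <= 1.
  by rewrite -h; move: (bary y j) (bary c j) y0 y1 c0 c1 => A B *; rewrite ler_norml; lra.
rewrite normrM gtr0_norm// => h2; rewrite ler_pdivlMr//; move: h2.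
by move: `|_| => A; lra.
Qed.

End OneSimplex.
End Simplices.

(** * Geometry of quasi-uniform meshes *)

Section RegularMeshes.
Variable R : realType.

Lemma face_sub_hull d N (T : mesh R d N) (F : lface d N) :
  face T F `<=` hull (T F.1) finset.setT.
Proof.
move=> x [w [w0 _ w1 xw]].
exists (fun i => if unlift F.2 i is Some k then w k else 0); split=> [i|i||].
- by case: unliftP.
- by rewrite finset.inE.
- rewrite (bigD1_ord F.2)//= unlift_none add0r -w1.
  by apply: eq_bigr => i _; rewrite liftK.
- rewrite (bigD1_ord F.2)//= unlift_none scale0r add0r xw.
  by apply: eq_bigr => i _; rewrite liftK.
Qed.

Lemma fvert_face d N (T : mesh R d N) (F : lface d N) j : face T F (fvert T F j).
Proof.
exists (fun i => (i == j)%:R); split=> [i|i||]; rewrite ?ler0n ?finset.inE//.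
  by rewrite (bigD1 j)//= eqxx big1 ?addr0// => i /negPf ->.
by rewrite (bigD1 j)//= eqxx scale1r big1 ?addr0// => i /negPf ->; rewrite scale0r.
Qed.

(** The constant factor in [surf_int]: [d!] times the area of the face. *)
Definition farea d N (T : mesh R d N) (F : lface d N) : R :=
  Num.sqrt (\det (edges (fvert T F) *m (edges (fvert T F))^T)).

(* [b K] is a corner of a cube of side kappa h contained in K. *)
Record regular d N (T : mesh R d N) (kappa : R) (b : 'I_N -> 'rV[R]_d.+1) : Prop :=
  Regular {
  reg_h : 0 < hmax T;
  reg_bset : forall K, bset (elt T K);
  reg_box : forall K, box (b K) (kappa * hmax T) `<=` elt T K;
  reg_hull : forall K x, hull (T K) finset.setT x -> bigbox (b K) (hmax T) x;
  reg_area_ge : forall F, kappa * hmax T ^+ d <= farea T F;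
  reg_area_le : forall F, farea T F <= kappa^-1 * hmax T ^+ d;
  reg_hF_ge : forall F, kappa * hmax T <= hF T F;
  reg_hF_le : forall F, hF T F <= hmax T }.

(** [rhoK] is a supremum of diameters that need not be attained, so a ball is taken whose diameter
    [2 * r] exceeds [h / (2 nu)]; hence the factor 4. *)
Lemma quasi_uniform_ball d N nu (T : mesh R d N) K : 0 < nu ->
  quasi_uniform nu T -> 0 < hmax T -> exists c r,
    [/\ 0 < r, hmax T < 4 * nu * r & [set y | enorm (y - c) < r] `<=` elt T K].
Proof.
move=> nu0 /(_ K); rewrite /rhoK /inscribed_diam; set S := [set D | _] => hS h0.
(* The supremum of the empty set is 0, which a positive mesh size excludes. *)
have S0 : S !=set0.
  by apply: contrapT => /set0P/negP/negPn/eqP S0; move: hS; rewrite S0 sup0 mulr0 leNgt h0.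
have : hmax T / (2 * nu) < sup S.
  rewrite ltr_pdivrMr ?mulr_gt0//; move: (hmax T) (sup S) hS h0 => h S' hS h0; nra.
move=> /(sup_gt S0)[_ [c [r [r0 rA ->]]]].
rewrite ltr_pdivrMr ?mulr_gt0// => hr; exists c, r; split=> //.
by move: (hmax T) hr => h; lra.
Qed.

Lemma hmax_gt0 d N (T : mesh R d N) : (0 < N)%N ->
  (forall K, edges (T K) \in unitmx) -> 0 < hmax T.
Proof.
move=> N0 TU; pose K := Ordinal N0.
have := le_bigmax 0 (fun K => hK T K) K; rewrite -/(hmax T).
by apply: lt_le_trans; exact: diam_simplex_gt0.
Qed.

(** Everything comes from an inscribed ball of radius above [h / (4 nu)]: it contains a cube, and it
    bounds the gradients of the barycentric coordinates by [8 nu / h], which keeps the areas and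
    diameters of faces from degenerating. Thus [kappa] depends on [d] and [nu] only. *)
Lemma mesh_regular d nu : (0 < d <= 2)%N -> 0 < nu -> exists kappa : R,
  [/\ 0 < kappa, kappa <= 1 & forall N (T : mesh R d N), (0 < N)%N ->
    (forall K, edges (T K) \in unitmx) -> quasi_uniform nu T ->
    exists b, regular T kappa b].
Proof.
move=> /andP[d0 d2] nu0.
pose n : R := d.+1%:R; have n1 : 1 <= n by rewrite ler1n.
have n0 : 0 < n by rewrite ltr0n.
have f0 : 0 < d`!%:R :> R by rewrite ltr0n fact_gt0.
(* [G] is the constant of [gram_det_lower] for [beta = 8 nu / h], and [H] below the one of [det_le]
   for entries at most [n h^2], both stripped of their powers of [h]. *)
have [G [G0 GE]] : exists G, 0 < G /\ G = d`!%:R * (n * (64 * nu ^+ 2)) ^+ d.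
  by eexists; split; last reflexivity; rewrite !mulr_gt0// exprn_gt0// !mulr_gt0// exprn_gt0.
have [H [H0 HE]] : exists H, 0 < H /\ H = d`!%:R * n ^+ d.
  by eexists; split; last reflexivity; rewrite mulr_gt0// exprn_gt0.
(* The bound [8 n nu <= k'] is used twice: for fitting the cube into the ball and for the diameter
   of a face. *)
have [k' [k'1 k'G k'H k'n]] : exists k', [/\ 1 <= k', G <= k', H <= k' & 8 * n * nu <= k'].
  have : 0 < 8 * n * nu by rewrite !mulr_gt0.
  move: (8 * n * nu) => A A0; exists (1 + G + H + A); split; lra.
have k'0 : 0 < k' by apply: lt_le_trans k'1.
exists k'^-1; split; [by rewrite invr_gt0|by rewrite invf_le1|].
move=> N T N0 TU qT; have h0 := hmax_gt0 N0 TU.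
have hT K : hK T K <= hmax T by exact: (le_bigmax 0 (fun K => hK T K)).
have /choice[cr hcr] K : exists cr : 'rV[R]_d.+1 * R,
    [/\ 0 < cr.2, hmax T < 4 * nu * cr.2 & [set y | enorm (y - cr.1) < cr.2] `<=` elt T K].
  by have [c [r h]] := quasi_uniform_ball K nu0 qT h0; exists (c, r).
have hx K x y : hull (T K) finset.setT x -> hull (T K) finset.setT y ->
    enorm (x - y) <= hmax T.
  by move=> Kx Ky; apply: le_trans (hT K); exact: hull_le_diam.
have gr K j l : `|bgrad (T K) j l| <= 8 * nu / hmax T.
  have [r0 rh sub] := hcr K; apply: le_trans (bgrad_le (TU K) _ r0 sub j l) _ => //.
  rewrite ler_pdivrMr// mulrAC ler_pdivlMr//.
  by move: (hmax T) (cr K).2 rh => h r; lra.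
have [h hE] : exists h, hmax T = h by eexists.
rewrite hE in h0 hT hcr hx gr.
have kh : 0 < k'^-1 * h by rewrite mulr_gt0// invr_gt0.
(* The corner for which the cube is centred at the centre of the ball. *)
pose b K : 'rV[R]_d.+1 := \row_i ((cr K).1 0 i - k'^-1 * h / 2).
have bsub K : box (b K) (k'^-1 * h) `<=` elt T K.
  have [r0 rh sub] := hcr K; move=> y yb; apply: sub => /=.
  apply: le_lt_trans (_ : n * (k'^-1 * h / 2) < _).
    apply: enorm_le_coord => [|i]; first by rewrite divr_ge0// ltW.
    have := yb i; rewrite !mxE; move: (k'^-1 * h) (y 0 i) ((cr K).1 0 i) => A B E.
    by rewrite ler_norml; lra.
  have e1 : n * k'^-1 * (8 * nu) <= 1.
    by rewrite mulrAC ler_pdivrMr// mul1r; move: k'n; rewrite mulrCA mulrA.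
  have A0 : 0 <= n * k'^-1 by rewrite mulr_ge0 ?invr_ge0 ?ltW.
  have h2 := ler_wpM2l A0 (ltW rh).
  have h3 := ler_wpM2r (ltW r0) e1.
  rewrite /= in h2 h3 r0 *; rewrite !mulrA.
  by move: (n * k'^-1) (cr K).2 h2 h3 r0 => A r h2 h3 r0; lra.
have bh K : hull (T K) finset.setT (b K).
  apply: open_simplex_sub_hull; apply: bsub => i; rewrite lexx lerDl ltW//.
have vh (F : lface d N) i l : `|fvert T F i 0 l - fvert T F ord0 0 l| <= h.
  have := coord_le_enorm (fvert T F i - fvert T F ord0) l; rewrite !mxE => /le_trans; apply.
  by apply: (hx F.1); apply: face_sub_hull; exact: fvert_face.
have area F : k'^-1 * h ^+ d <= farea T F <= k' * h ^+ d.
  pose E := edges (fvert T F).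
  (* A barycentric coordinate is 1 at its own vertex and 0 at the others, so the gradients for the
     vertices of the face other than the first form a right inverse of its edge matrix. *)
  pose B : 'M[R]_(d.+1, d) := \matrix_(l, i) bgrad (T F.1) (lift F.2 (lift ord0 i)) l.
  have EB : E *m B = 1%:M.
    apply/matrixP => i i'; rewrite !mxE.
    transitivity (bary (T F.1) (fvert T F (lift ord0 i)) (lift F.2 (lift ord0 i'))
                  - bary (T F.1) (fvert T F ord0) (lift F.2 (lift ord0 i'))).
      by rewrite bary_sub//; apply: eq_bigr => l _; rewrite !mxE.
    rewrite !bary_vertex//.
    rewrite !(inj_eq lift_inj) [lift ord0 i' == ord0]eq_sym (negPf (neq_lift _ _)) subr0.
    by rewrite eq_sym.
  have b0 : 0 < 8 * nu / h by rewrite divr_gt0// mulr_gt0.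
  have := gram_det_lower d2 b0 EB; rewrite /farea -/E.
  have := gram_det_ge0 E d2.
  have : `|\det (E *m E^T)| <= d`!%:R * (n * h ^+ 2) ^+ d.
    apply: det_le => i j; rewrite mxE; apply: le_trans (ler_norm_sum _ _ _) _.
    rewrite /n -[X in X%:R * _](card_ord d.+1) mulr_natl -sumr_const; apply: ler_sum => l _.
    by rewrite normrM expr2 ler_pM//; rewrite !mxE; exact: vh.
  move: (\det _) => D DU D0 /(_ _)DL.
  have {}DL : 1 <= d`!%:R * (n * (8 * nu / h) ^+ 2) ^+ d * D.
    by apply: DL => l i; rewrite mxE; exact: gr.
  have hd0 : 0 < h ^+ d by rewrite exprn_gt0.
  have {}DL : (h ^+ d) ^+ 2 <= G * D.
    have E1 : d`!%:R * (n * (8 * nu / h) ^+ 2) ^+ d = G / (h ^+ d) ^+ 2.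
      rewrite GE -[RHS]mulrA; congr (_ * _); rewrite [(h ^+ d) ^+ 2]exprAC -expr_div_n.
      by congr (_ ^+ _); field; rewrite gt_eqF.
    by move: DL; rewrite E1 mulrAC ler_pdivlMr ?exprn_gt0// mul1r.
  have {}DU : D <= H * (h ^+ d) ^+ 2.
    by move: DU; rewrite ger0_norm// HE exprMn [(h ^+ 2) ^+ d]exprAC mulrA.
  have kD : k' * D <= k' ^+ 2 * D by rewrite ler_wpM2r// expr2 ler_peMl// ltW.
  apply/andP; split.
    rewrite -[leLHS]ger0_norm ?mulr_ge0 ?invr_ge0 ?(ltW k'0) ?(ltW hd0)//.
    rewrite -sqrtr_sqr ler_wsqrtr// exprMn exprVn ler_pdivrMl ?exprn_gt0//.
    by apply: le_trans DL _; apply: le_trans kD; rewrite ler_wpM2r.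
  rewrite -[leRHS]ger0_norm ?mulr_ge0 ?(ltW k'0) ?(ltW hd0)//.
  rewrite -sqrtr_sqr ler_wsqrtr// exprMn; apply: le_trans DU _.
  by rewrite ler_wpM2r ?sqr_ge0// (le_trans k'H)// expr2 ler_peMl// ltW.
exists b; split; rewrite ?hE//.
- move=> K; exact: bset_open_simplex.
- move=> K x Kx i; apply: le_trans (hx K x (b K) Kx (bh K)).
  by have := coord_le_enorm (x - b K) i; rewrite !mxE.
- by move=> F; have /andP[] := area F.
- by move=> F; have /andP[] := area F; rewrite invrK.
(* From [w] to [v] a barycentric coordinate grows from 0 to 1 with gradient entries at most
   [8 nu / h], so the two vertices are at least [h / (8 n nu)] apart. *)
- move=> F; pose i0 : 'I_d := Ordinal d0.
  pose v := fvert T F (lift ord0 i0); pose w := fvert T F ord0.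
  have vw : enorm (v - w) <= hF T F.
    apply: enorm_le_diam; [|exact: fvert_face|exact: fvert_face].
    by move=> x; exact: hull_bounded.
  have := bary_sub (T F.1) v w (lift F.2 (lift ord0 i0)).
  rewrite /v /w !bary_vertex// eqxx (inj_eq lift_inj) eq_sym (negPf (neq_lift _ _)) subr0 -/v -/w => e1.
  rewrite ler_pdivrMl//; apply: le_trans (_ : 8 * n * nu * enorm (v - w) <= _); last first.
    apply: le_trans (_ : k' * enorm (v - w) <= _).
      by rewrite ler_wpM2r ?sqrtr_ge0.
    by rewrite ler_wpM2l// ltW.
  suff : 1 <= n * (enorm (v - w) * (8 * nu / h)).
    by rewrite !mulrA ler_pdivlMr// mul1r; move: (enorm _) => e; congr (_ <= _); ring.
  rewrite -[X in X <= _]/(true%:R) e1 /n -[X in X%:R * _](card_ord d.+1) mulr_natl -sumr_const; apply: ler_sum => l _.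
  apply: le_trans (ler_norm _) _; rewrite normrM ler_pM//.
  by have := coord_le_enorm (v - w) l; rewrite !mxE.
- move=> F; apply: diam_le => [|x y Fx Fy]; first by exists (fvert T F ord0); exact: fvert_face.
  by apply: (hx F.1); exact: face_sub_hull.
Qed.

End RegularMeshes.

(** * Bounded overlap of the patches *)

Section Packing.
Variable R : realType.

Lemma posfun_rint n (A : set 'rV[R]_n) : bset A -> posfun A (rint A).
Proof. by move=> bA; split=> *; [exact: rint_lin|exact: rint_mono]. Qed.

Lemma lbm_indic n (A : set 'rV[R]_n) : bset A -> lbm (\1_A : 'rV[R]_n -> R).
Proof.
move=> [mA _]; split=> // M; exists 1 => x _.
by rewrite indicE; case: (x \in A); rewrite ?normr1 ?normr0.
Qed.

(** By disjointness the indicators of the small boxes sum to at most 1; this is integrated over the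
    large box. *)
Lemma card_disjoint_boxes n (I : finType) (S : {set I}) (c : I -> 'rV[R]_n) b s r :
  0 < s -> 0 < r -> (forall i, i \in S -> box (c i) s `<=` box b r) ->
  (forall i j, i \in S -> j \in S -> i != j -> box (c i) s `&` box (c j) s = set0) ->
  #|S|%:R <= (r / s) ^+ n.
Proof.
move=> s0 r0 sub dis.
have pB := posfun_rint (bset_box b r).
rewrite expr_div_n ler_pdivlMr ?exprn_gt0// -(rint_box b (ltW r0)).
rewrite mulr_natl -sumr_const.
apply: le_trans (_ : \sum_(i in S) rint (box b r) (\1_(box (c i) s)) <= _).
  apply: ler_sum => i iS; rewrite -(rint_box (c i) (ltW s0)) le_eqVlt; apply/orP; left; apply/eqP.
  congr iint; apply/funext => x; rewrite mulr1 [X in _ = X * _]indicE.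
  have [/set_mem xi|xi] := boolP (x \in box (c i) s).
    by rewrite (mem_set (sub i iS x xi)) mul1r.
  by rewrite indicE (negPf xi) mulr0.
rewrite -(posfun_sum pB); last by move=> i _; exact/lbm_indic/bset_box.
apply: (posfun_mono pB).
- by apply: lbm_sum => i _; exact/lbm_indic/bset_box.
- exact: lbm_cst.
move=> x _; have [[i [iS xi]]|h] := pselect (exists i, i \in S /\ box (c i) s x).
  rewrite (bigD1 i)//= big1 ?addr0; first by rewrite indicE mem_set.
  move=> j /andP[jS ji]; rewrite indicE memNset// => xj.
  by have : set0 x by rewrite -(dis _ _ jS iS ji).
rewrite big1// => i iS; rewrite indicE memNset// => xi.
by apply: h; exists i.
Qed.

Variables (d N : nat) (T : mesh R d N) (kappa : R) (b : 'I_N -> 'rV[R]_d.+1).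
Hypotheses (k0 : 0 < kappa) (k1 : kappa <= 1) (rT : regular T kappa b).
Hypothesis dis : forall K L, K != L -> elt T K `&` elt T L = set0.

(** Distance of cube corners in units of the mesh size. It is symmetric and subadditive like the
    number of steps through faces, and it also allows elements to be counted by volume. *)
Definition near (t : nat) (K L : 'I_N) : bool :=
  [forall i, `|b L 0 i - b K 0 i| <= t%:R * hmax T].

Lemma nearC t K L : near t K L = near t L K.
Proof. by apply: eq_forallb => i; rewrite distrC. Qed.

Lemma near_trans s t K L M : near s K L -> near t L M -> near (s + t) K M.
Proof.
move=> /forallP h1 /forallP h2; apply/forallP => i; rewrite natrD mulrDl.
rewrite (_ : _ - _ = (b L 0 i - b K 0 i) + (b M 0 i - b L 0 i)); last by ring.
by apply: le_trans (ler_normD _ _) _; rewrite lerD.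
Qed.

(** The ratio of the volumes of a box of side [2 (t + 1) h] and of a cube of side [kappa h]. *)
Definition pack (t : nat) : R := (2 * t.+1%:R / kappa) ^+ d.+1.

(* The elements are disjoint and each contains a cube of side kappa h: compare volumes. *)
Lemma card_near t K : #|[set L | near t K L]%SET|%:R <= pack t.
Proof.
have h0 := reg_h rT; have s0 : 0 < kappa * hmax T by exact: mulr_gt0.
have r0 : 0 < 2 * t.+1%:R * hmax T by rewrite !mulr_gt0.
rewrite /pack (_ : 2 * t.+1%:R / kappa = 2 * t.+1%:R * hmax T / (kappa * hmax T)); last first.
  by rewrite -mulf_div divff ?mulr1// gt_eqF.
apply: (@card_disjoint_boxes _ _ _ b (b K - t.+1%:R * hmax T *: const_mx 1)) => //.
- move=> L; rewrite finset.inE => /forallP KL x xL i.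
  have /andP[x1 x2] := xL i; have := KL i; rewrite ler_norml => /andP[h1 h2].
  have hk : kappa * hmax T <= hmax T by rewrite ler_piMl// ltW.
  rewrite !mxE mulr1 -natr1.
  move: (hmax T) (kappa * hmax T) (t%:R) (b L 0 i) (b K 0 i) (x 0 i) h0 hk x1 x2 h1 h2.
  by move=> h k u bL bK y h0 hk x1 x2 h1 h2; apply/andP; split; lra.
- move=> L M _ _ LM; rewrite -subset0 => x [xL xM].
  by rewrite -(dis LM); split; exact: (reg_box rT).
Qed.

(** A vertex of the common face is within one mesh size of both corners. *)
Lemma face_near K L i j : face T (K, i) = face T (L, j) -> near 2 K L.
Proof.
move=> KL; apply/forallP => l.
have xK := reg_hull rT (face_sub_hull (fvert_face T (K, i) ord0)).
have xL : bigbox (b L) (hmax T) (fvert T (K, i) ord0).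
  apply: (reg_hull rT); apply: (@face_sub_hull _ _ _ T (L, j)); rewrite -KL.
  exact: fvert_face.
have := xK l; have := xL l; rewrite !ler_norml.
move: (hmax T) (fvert _ _ _ 0 l) (b K 0 l) (b L 0 l) => h x y z.
by move=> /andP[h1 h2] /andP[h3 h4]; apply/andP; split; lra.
Qed.

Definition adjb K L := `[< Defs.adjacent T K L >].

Lemma adjb_near K L : adjb K L -> near 2 K L.
Proof. by move=> /asboolP[_ [i [j]]]; exact: face_near. Qed.

Lemma layer_near t K L : L \in layer T t K -> near (2 * t) K L.
Proof.
elim: t L => [|t IH] L /=.
  rewrite finset.inE => /eqP ->; apply/forallP => i.
  by rewrite subrr normr0 mulr0n mul0r.
rewrite !finset.inE => /orP[LK|/asboolP[M /IH h MA]]; last first.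
  by rewrite mulnS addnC; apply: near_trans h (adjb_near _); exact/asboolP.
have /forallP h := IH _ LK; apply/forallP => i; apply: le_trans (h i) _.
by rewrite ler_pM2r ?(reg_h rT)// ler_nat leq_mul2l leqnSn.
Qed.

Lemma layerS t K : layer T t K \subset layer T t.+1 K.
Proof. by apply/fintype.subsetP => L LK; rewrite /= finset.inE LK. Qed.

Lemma layer_mono s t K : (s <= t)%N -> layer T s K \subset layer T t K.
Proof.
elim: t => [|t IH]; first by rewrite leqn0 => /eqP ->; exact: fintype.subxx.
rewrite leq_eqVlt => /orP[/eqP -> //|]; rewrite ltnS => /IH st.
exact: fintype.subset_trans st (layerS t K).
Qed.

Lemma layer_stable t u K : layer T t.+1 K = layer T t K -> layer T (t + u) K = layer T t K.
Proof.
by move=> h; elim: u => [|u IH]; rewrite ?addn0// addnS /= IH.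
Qed.

(** A layer that does not grow never grows again, so below the threshold each layer gains at least
    one element and the threshold is met after at most [thr] steps. If it is never met, the default
    0 of [xget] gives the layer 0. *)
Lemma patch_sub_layer thr K : Defs.patch T thr K \subset layer T thr K.
Proof.
rewrite /Defs.patch; case: xgetP => [t _ [ht hs]|_]; last exact: layer_mono.
apply: layer_mono.
have key s : (s <= t)%N -> (s < #|layer T s K|)%N.
  elim: s => [|s IH] st; first by rewrite /= finset.cards1.
  apply: leq_ltn_trans (IH (ltnW st)) _; apply: proper_card.
  rewrite finset.properEneq layerS andbT; apply/eqP => h.
  have := hs s st; rewrite -(layer_stable (t - s) (esym h)) subnKC ?ltnNge ?ht//.
  exact: ltnW.
case: t ht hs key => // t ht hs key.
by apply: leq_ltn_trans (hs t (ltnSn t)); exact: leq_trans (key t (leqnSn t)).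
Qed.

Lemma layer_refl t K : K \in layer T t K.
Proof. by apply: (fintype.subsetP (layer_mono K (leq0n t))); rewrite finset.inE. Qed.

Lemma patch_refl thr K : K \in Defs.patch T thr K.
Proof. exact: layer_refl. Qed.

Lemma sum_near_le t (X : 'I_N -> R) (P : rel 'I_N) : (forall K, 0 <= X K) ->
  (forall K L, P K L -> near t K L) ->
  \sum_K \sum_(L | P K L) X K <= pack t * \sum_K X K.
Proof.
move=> X0 PN; rewrite mulr_sumr; apply: ler_sum => K _.
rewrite sumr_const -[X in X <= _]mulr_natl ler_wpM2r// (le_trans _ (card_near t K))// ler_nat.
by apply: subset_leq_card; apply/fintype.subsetP => L LP; rewrite finset.inE; exact: PN.
Qed.

Lemma pack_ge0 t : 0 <= pack t.
Proof. by rewrite exprn_ge0// divr_ge0 ?mulr_ge0// ltW. Qed.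

Section Spread.
Variable v : 'I_N -> R[i].
Let D K L := sq (v K - v L).
Let D0 K L : 0 <= D K L. Proof. exact: sq_ge0. Qed.

(** An element [L] of the next layer is adjacent to some [M] in layer [t], and the difference
    between [K] and [L] is split at [M]. The first part is counted for at most [pack 2] neighbours
    [L], the second for at most [pack (2 * t)] elements [K]. *)
Lemma layer_spread_le t :
  \sum_K \sum_(L in layer T t K) D K L <=
  (1 + 2 * pack 2) ^+ t * (2 * \sum_(s < t) pack (2 * s)) * \sum_K \sum_(L | adjb K L) D K L.
Proof.
set Adj := \sum_K \sum_(L | adjb K L) _.
have A0 : 0 <= Adj by do 2 apply: sumr_ge0 => ? _.
elim: t => [|t IH].
  rewrite big_ord0 mulr0 mulr0 mul0r big1// => K _.
  by rewrite big1// => L; rewrite /= finset.inE => /eqP ->; rewrite /D subrr sq0.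
set A := \sum_K _ in IH.
have step : \sum_K \sum_(L in layer T t.+1 K) D K L <=
    A + (2 * pack 2 * A + 2 * pack (2 * t) * Adj).
  apply: le_trans (_ : \sum_K (\sum_(L in layer T t K) D K L +
      \sum_(M in layer T t K) \sum_(L | adjb M L) D K L) <= _).
    apply: ler_sum => K _; rewrite [X in _ <= X + _]big_mkcond [X in X <= _]big_mkcond /=.
    under [X in _ <= _ + X]eq_bigr do rewrite big_mkcond.
    rewrite exchange_big -big_split /=; apply: ler_sum => L _.
    rewrite !finset.inE; set S := \sum_(M in _) _.
    have S0 : 0 <= S by apply: sumr_ge0 => M _; case: ifP.
    case: ifP => /=; last first.
      by move=> _; apply: addr_ge0 => //; case: ifP.
    have [LK _|LK] := boolP (L \in layer T t K); first by rewrite lerDl.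
    move=> /asboolP[M MK ML]; rewrite add0r /S (bigD1 M)//=.
    rewrite ifT; last exact/asboolP.
    by rewrite lerDl; apply: sumr_ge0 => M' _; case: ifP.
  rewrite big_split /= -/A lerD2l.
  apply: le_trans (_ : \sum_K \sum_(M in layer T t K) \sum_(L | adjb M L)
      (2 * D K M + 2 * D M L) <= _).
    apply: ler_sum => K _; apply: ler_sum => M _; apply: ler_sum => L _.
    rewrite /D (_ : v K - v L = (v K - v M) + (v M - v L)); last by rewrite addrA subrK.
    exact: sqD_le.
  under eq_bigr do under eq_bigr do rewrite big_split /=.
  under eq_bigr do rewrite big_split /=.
  rewrite big_split /=; apply: lerD.
    rewrite mulr_sumr; apply: ler_sum => K _; rewrite mulr_sumr; apply: ler_sum => M _.
    rewrite sumr_const -[X in X <= _]mulr_natl mulrCA -[leRHS]mulrA ler_wpM2l// ler_wpM2r//.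
    apply: le_trans (card_near 2 M); rewrite ler_nat.
    by apply: subset_leq_card; apply/fintype.subsetP => L LP; rewrite finset.inE; exact: adjb_near.
  under eq_bigr do under eq_bigr do rewrite -mulr_sumr.
  rewrite (exchange_big_dep xpredT)//=.
  have h := @sum_near_le (2 * t) (fun M => 2 * \sum_(L | adjb M L) D M L)
    (fun M K => M \in layer T t K) _ _.
  apply: le_trans (h _ _) _ => [M|M K MK|].
  - by rewrite mulr_ge0// sumr_ge0.
  - by rewrite nearC; exact: layer_near.
  - by rewrite -mulr_sumr -/Adj mulrCA mulrA.
apply: le_trans step _.
have p2 := pack_ge0 2; have pt := pack_ge0 (2 * t).
rewrite big_ord_recr /=.
have S0 : 0 <= \sum_(s < t) pack (2 * s) by apply: sumr_ge0 => s _; exact: pack_ge0.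
have Q1 : 1 <= (1 + 2 * pack 2) ^+ t.+1 by rewrite exprn_ege1// lerDl mulr_ge0.
move: (\sum_(s < t) _) (pack (2 * t)) S0 pt IH => S p S0 p0 IH.
have h1 : A * (1 + 2 * pack 2) <= (1 + 2 * pack 2) ^+ t * (2 * S) * Adj * (1 + 2 * pack 2).
  by rewrite ler_wpM2r// addr_ge0 ?mulr_ge0.
have h2 : 2 * p * Adj <= (1 + 2 * pack 2) ^+ t.+1 * (2 * p * Adj).
  by rewrite ler_peMl// !mulr_ge0.
rewrite exprS in h2 *; clear IH A0 Q1; clearbody A Adj.
move: (pack 2) ((1 + 2 * pack 2) ^+ t) h1 h2 {p2} => P Q h1 h2.
lra.
Qed.

(** The left side runs over ordered pairs, while [ifaces] lists a face once, with the smaller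
    element number first; hence the factor 2. *)
Lemma adj_spread_le : \sum_K \sum_(L | adjb K L) D K L <=
  2 * \sum_(F | ifaces T F) D F.1.1 F.2.1.
Proof.
pose G (F : lface d N * lface d N) : R :=
  if (F.1.1 != F.2.1) && `[< face T F.1 = face T F.2 >] then D F.1.1 F.2.1 else 0.
have G0 F : 0 <= G F by rewrite /G; case: ifP.
apply: le_trans (_ : \sum_F G F <= _).
  rewrite -(pair_bigA _ (fun F1 F2 => G (F1, F2))) /=.
  rewrite -(pair_bigA _ (fun K i => \sum_F2 G ((K, i), F2))) /=.
  apply: ler_sum => K _.
  under [leRHS]eq_bigr do rewrite -(pair_bigA _ (fun L j => G (_, (L, j)))) /=.
  rewrite exchange_big big_mkcond /=; apply: ler_sum => L _.
  case: ifP => [/asboolP[KL [i [j ij]]]|_]; last by do 2 apply: sumr_ge0 => ? _.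
  rewrite (bigD1 i)//= (bigD1 j)//= -addrA /G /= KL /=.
  rewrite (_ : `[< _ >] = true) ?lerDl; last exact/asboolP.
  by rewrite addr_ge0//; do ?apply: sumr_ge0 => ? _; do ?case: ifP; rewrite // sumr_ge0// => ? _; case: ifP.
rewrite mulr_natl mulr2n.
have GE F : G F = (if ifaces T F then D F.1.1 F.2.1 else 0) +
    (if ifaces T (F.2, F.1) then D F.2.1 F.1.1 else 0).
  rewrite /G /ifaces /= neq_ltn (asbool_equiv_eq (_ : face T F.2 = face T F.1 <-> face T F.1 = face T F.2)); last by split.
  rewrite {3}/D -[v F.2.1 - _]opprB sqN -/(D _ _).
  case: asboolP => _; rewrite ?andbF ?addr0// !andbT.
  by case: ltngtP; rewrite /= ?addr0 ?add0r.
under eq_bigr do rewrite GE.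
rewrite big_split /= -[leRHS]/(_ + _) ![in leRHS]big_mkcond /= lerD2l.
rewrite (reindex_inj (h := fun F : lface d N * lface d N => (F.2, F.1))) //=.
by move=> [? ?] [? ?] /= [-> ->].
Qed.

End Spread.

Definition spread (thr : nat) : R :=
  (1 + 2 * pack 2) ^+ thr * (2 * \sum_(s < thr) pack (2 * s)) * 2.

Lemma spread_ge0 thr : 0 <= spread thr.
Proof.
rewrite /spread !mulr_ge0 ?exprn_ge0 ?addr_ge0 ?mulr_ge0 ?pack_ge0//.
by apply: sumr_ge0 => s _; exact: pack_ge0.
Qed.

Lemma patch_spread_le thr (v : 'I_N -> R[i]) :
  \sum_K \sum_(L in Defs.patch T thr K) sq (v K - v L) <=
  spread thr * \sum_(F | ifaces T F) sq (v F.1.1 - v F.2.1).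
Proof.
apply: le_trans (_ : \sum_K \sum_(L in layer T thr K) sq (v K - v L) <= _).
  apply: ler_sum => K _; rewrite [leLHS]big_mkcond [leRHS]big_mkcond /=.
  apply: ler_sum => L _; case: ifPn => [/(fintype.subsetP (patch_sub_layer thr K)) -> //|_].
  by case: ifP => // _; exact: sq_ge0.
apply: le_trans (layer_spread_le v thr) _; rewrite -[leRHS]mulrA ler_wpM2l ?adj_spread_le//.
rewrite !mulr_ge0 ?exprn_ge0 ?addr_ge0 ?mulr_ge0 ?pack_ge0//.
by apply: sumr_ge0 => s _; exact: pack_ge0.
Qed.

(** A crude count: two elements have [d.+2 ^ 2] pairs of local faces, and an element sharing a face
    with [K] is among the at most [pack 2] elements near [K]. *)
Lemma sum_ifaces_le (X : 'I_N -> R) : (forall K, 0 <= X K) ->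
  \sum_(F | ifaces T F) (X F.1.1 + X F.2.1) <= 2 * d.+2%:R ^+ 2 * pack 2 * \sum_K X K.
Proof.
move=> X0.
pose G (F : lface d N * lface d N) : R :=
  if near 2 F.1.1 F.2.1 then X F.1.1 + X F.2.1 else 0.
apply: le_trans (_ : \sum_F G F <= _).
  rewrite big_mkcond /=; apply: ler_sum => F _; rewrite /G.
  case: ifP => [/andP[_ /asboolP FF]|_]; last by case: ifP => // _; exact: addr_ge0.
  by rewrite ifT//; apply: (@face_near _ _ F.1.2 F.2.2); rewrite -!surjective_pairing.
rewrite -(pair_bigA _ (fun F1 F2 => G (F1, F2))) /=.
rewrite -(pair_bigA _ (fun K i => \sum_F2 G ((K, i), F2))) /=.
under eq_bigr do under eq_bigr do rewrite -(pair_bigA _ (fun L j => G (_, (L, j)))) /=.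
rewrite /G /=.
under eq_bigr do under eq_bigr do under eq_bigr do rewrite sumr_const card_ord.
under eq_bigr do rewrite sumr_const card_ord.
under eq_bigr do rewrite sumrMnl -mulrnA -mulr_natr.
rewrite -mulr_suml natrM -expr2 mulrC.
rewrite [leRHS](_ : _ = d.+2%:R ^+ 2 * (pack 2 * \sum_K X K + pack 2 * \sum_K X K)); last first.
  by move: (d.+2%:R) (pack 2) (\sum_K _) => a p S; ring.
rewrite ler_wpM2l ?sqr_ge0//.
rewrite (_ : \sum_K _ = \sum_K (\sum_(L | near 2 K L) X K + \sum_(L | near 2 K L) X L)); last first.
  by apply: eq_bigr => K _; rewrite -big_split [RHS]big_mkcond.
rewrite big_split /=; apply: lerD.
  exact: (sum_near_le X0).
rewrite (exchange_big_dep xpredT)//=.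
by apply: (sum_near_le X0) => K L; rewrite nearC.
Qed.

Lemma sum_bfaces_le Omega (X : 'I_N -> R) : (forall K, 0 <= X K) ->
  \sum_(F | bfaces Omega T F) X F.1 <= d.+2%:R * \sum_K X K.
Proof.
move=> X0; apply: le_trans (_ : \sum_(F : lface d N) X F.1 <= _).
  by rewrite big_mkcond /=; apply: ler_sum => F _; case: ifP.
rewrite -(pair_bigA _ (fun K i => X K)) /= mulr_sumr; apply: ler_sum => K _.
by rewrite sumr_const card_ord mulr_natl.
Qed.

End Packing.

(** * Least squares reconstruction *)

Section LeastSquares.
Variable R : realType.
Local Notation C := R[i].

Lemma peval_sumZ n k (c : 'I_k -> C) (q : 'I_k -> cpoly R n) x :
  peval (\sum_i c i *: q i) x = \sum_i c i * peval (q i) x.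
Proof.
by rewrite /peval rmorph_sum /=; apply: eq_bigr => i _; rewrite mpoly.mevalZ.
Qed.

Lemma deg_le_sumZ n m k (c : 'I_k -> C) (q : 'I_k -> cpoly R n) :
  (forall i, deg_le m (q i)) -> deg_le m (\sum_i c i *: q i).
Proof.
move=> dq; apply: (leq_trans (@mpoly.mmeasure_sum _ _ _ _ _ _ _)).
apply/bigmax_leqP => i _.
exact: leq_trans (@mpoly.mmeasureZ_le _ _ _ _ _) (dq i).
Qed.

Lemma deg_leD n m (p q : cpoly R n) : deg_le m p -> deg_le m q -> deg_le m (p + q).
Proof.
move=> dp dq; apply: (leq_trans (@mpoly.mmeasureD_le _ _ _ _ _)).
by rewrite geq_max; apply/andP.
Qed.

Lemma deg_leZ n m (c : C) (p : cpoly R n) : deg_le m p -> deg_le m (c *: p).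
Proof. exact: leq_trans (@mpoly.mmeasureZ_le _ _ _ _ _). Qed.

Lemma deg_leB n m (p q : cpoly R n) : deg_le m p -> deg_le m q -> deg_le m (p - q).
Proof.
by move=> dp dq; apply: deg_leD => //; rewrite /deg_le mpoly.mmeasureN.
Qed.

Lemma deg_leC n m (c : C) : deg_le m (mpoly.mpolyC n c).
Proof. by rewrite /deg_le mpoly.mmeasureC; case: (c == 0). Qed.

Lemma pevalC n (c : C) (x : 'rV[R]_n) : peval (mpoly.mpolyC n c) x = c.
Proof. exact: mpoly.mevalC. Qed.

Lemma pevalD n (p q : cpoly R n) x : peval (p + q) x = peval p x + peval q x.
Proof. exact: mpoly.mevalD. Qed.

Lemma pevalB n (p q : cpoly R n) x : peval (p - q) x = peval p x - peval q x.
Proof. exact: mpoly.mevalB. Qed.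

Lemma pevalZ n c (p : cpoly R n) x : peval (c *: p) x = c * peval p x.
Proof. exact: mpoly.mevalZ. Qed.

Lemma monomial_basis n m : exists k (mon : 'I_k -> cpoly R n),
  (forall i, deg_le m (mon i)) /\
  forall p, deg_le m p -> exists c : 'I_k -> C,
    forall x, peval p x = \sum_i c i * peval (mon i) x.
Proof.
pose I : finType := mpoly.bmultinom n m.+1.
exists #|I|, (fun i => mpoly.mpolyX _ (mpoly.bmnm (enum_val i : I))).
split=> [i|p dp].
  by rewrite /deg_le mpoly.mmeasureX; exact: (valP (enum_val i : I)).
exists (fun i => mpoly.mcoeff (mpoly.bmnm (enum_val i : I)) p) => x.
rewrite {1}(mpoly.mpolywE dp) /peval rmorph_sum /=.
rewrite (reindex (fun i : 'I_#|I| => enum_val i)) /=; last first.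
  by apply: onW_bij; exact: enum_val_bij.
by apply: eq_bigr => i _; rewrite mpoly.mevalZ.
Qed.

(** A diagonal entry of the product is the sum of the squared moduli of a column of [Y]. *)
Lemma mulmx_conj_eq0 p q (Y : 'M[C]_(p, q)) :
  (map_mx (@conjc R) Y)^T *m Y = 0 -> Y = 0.
Proof.
move=> YY; apply/matrixP => i j; rewrite mxE; apply: sq_eq0.
have : ((map_mx (@conjc R) Y)^T *m Y) j j = 0 by rewrite YY mxE.
rewrite mxE => h.
have {}h : \sum_k sq (Y k j) = 0.
  have : (\sum_k (sq (Y k j))%:C%C : C) = 0.
    by rewrite -[RHS]h; apply: eq_bigr => k _; rewrite !mxE mulrC mulC_conj.
  by rewrite -rmorph_sum => /eqP; rewrite fmorph_eq0 => /eqP.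
apply/eqP; move: h => /eqP; rewrite psumr_eq0 => [/allP /(_ i (mem_index_enum _))|k _] //.
exact: sq_ge0.
Qed.

(* The normal equations are solvable because F F* and F* have the same kernel. *)
Lemma orthogonal_projection k N (f : 'I_k -> 'I_N -> C) (h : 'I_N -> C) :
  exists c : 'I_k -> C, forall b,
    \sum_L (h L - \sum_a c a * f a L) * conjc (f b L) = 0.
Proof.
pose F : 'M[C]_(k, N) := \matrix_(a, L) f a L.
pose Fs : 'M[C]_(N, k) := (map_mx (@conjc R) F)^T.
have sub : ((\row_L h L) *m Fs <= F *m Fs)%MS.
  rewrite submxE -mulmxA; set Y := Fs *m _.
  suff -> : Y = 0 by rewrite mulmx0.
  apply: mulmx_conj_eq0.
  have FsF : (map_mx (@conjc R) Fs)^T = F.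
    by apply/matrixP => i j; rewrite !mxE; case: (f i j) => ? ? /=; rewrite opprK.
  rewrite {1}/Y map_mxM trmx_mul -mulmxA FsF.
  by rewrite /Y (mulmxA F) mulmx_coker mulmx0.
have /submxP[D hD] := sub.
exists (D 0) => b.
have : ((\row_L h L) *m Fs) 0 b = (D *m (F *m Fs)) 0 b by rewrite -hD.
rewrite mulmxA !mxE => h1.
apply/eqP; under eq_bigr do rewrite mulrBl; rewrite sumrB subr_eq0; apply/eqP.
transitivity (\sum_j (\row_L h L) 0 j * Fs j b).
  by apply: eq_bigr => j _; rewrite !mxE.
rewrite h1; apply: eq_bigr => j _; rewrite !mxE; congr (_ * _).
by apply: eq_bigr => a _; rewrite !mxE.
Qed.

Lemma sq_sub_scale (r z q : C) (s : R) :
  sq (r - s%:C * z * q) =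
  sq r - 2 * s * complex.Re (conjc z * (r * conjc q)) + s ^+ 2 * (sq z * sq q).
Proof.
case: r z q => [r1 r2] [z1 z2] [q1 q2]; rewrite /sq.
rewrite !(ReD, ImD, ReN, ImN, ReM, ImM, Re_conj, Im_conj) /=; ring.
Qed.

Variables (d N : nat) (T : mesh R d N) (xc : 'I_N -> 'rV[R]_d.+1) (m thr : nat).
Implicit Types (K L : 'I_N) (p q : cpoly R d.+1) (g v : 'I_N -> C).
Local Notation S := (Defs.patch T thr).

(** The variational form of the constrained fit: the residual is orthogonal to all variations that
    preserve the value at the collocation point of [K]. Being linear in [g] and [p], it passes to
    linear combinations, which minimality does not do directly. *)
Definition normal_eq K g p := forall q, deg_le m q -> peval q (xc K) = 0 ->
  \sum_(L in S K) (peval p (xc L) - g L) * conjc (peval q (xc L)) = 0.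

Lemma lsqE K g p : lsq T xc thr K g p = \sum_(L in S K) sq (peval p (xc L) - g L).
Proof. by apply: eq_bigr => L _; rewrite normc_sq. Qed.

Lemma is_fit_normal_eq K g p : is_fit T xc m thr K g p -> normal_eq K g p.
Proof.
move=> [dp pK pmin] q dq qK; set z := \sum_(L in _) _.
apply: sq_eq0; apply/eqP; rewrite eq_le sq_ge0 andbT leNgt; apply/negP => z0.
pose Q := \sum_(L in S K) sq (peval q (xc L)).
have Q0 : 0 <= Q by apply: sumr_ge0 => L _; exact: sq_ge0.
(* Replacing [p] by [p - s z q] changes the sum of squares by [- 2 s |z|^2 + s^2 |z|^2 Q]; as
   [s Q <= 1], this is negative unless [z = 0]. *)
pose s := (1 + Q)^-1; have s0 : 0 < s by rewrite invr_gt0 ltr_wpDr.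
have := pmin (p - (s%:C * z)%C *: q) (deg_leB dp (deg_leZ _ dq)) _.
rewrite pevalB pevalZ qK mulr0 subr0 => /(_ pK); rewrite !lsqE.
under [X in _ <= X]eq_bigr => L _.
  rewrite pevalB pevalZ addrAC sq_sub_scale; over.
rewrite !big_split /= -!mulr_sumr -/Q sumrN -mulr_sumr.
have -> : \sum_(L in S K) complex.Re (conjc z *
    ((peval p (xc L) - g L) * conjc (peval q (xc L)))) = sq z.
  rewrite -[RHS]/(complex.Re ((sq z)%:C)%C) -mulC_conj mulrC {3}/z mulr_sumr.
  by rewrite (big_morph _ (@ReD R) (erefl : complex.Re (0 : C) = 0)).
have -> : s ^+ 2 * (sq z * Q) = s * sq z * (s * Q) by ring.
have : s * Q <= 1.
  by rewrite /s mulrC ler_pdivrMr ?ltr_wpDr// mul1r lerDr.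
move: (\sum_(L in _) _) (sq z) (s * Q) z0 s0 => A Z B Z0 s0 B1.
have := mulr_gt0 s0 Z0; have := ler_wpM2l (ltW (mulr_gt0 s0 Z0)) B1; lra.
Qed.

Lemma normal_eq_is_fit K g p : deg_le m p -> peval p (xc K) = g K ->
  normal_eq K g p -> is_fit T xc m thr K g p.
Proof.
move=> dp pK ne; split=> // q dq qK; rewrite !lsqE.
have := ne (q - p) (deg_leB dq dp) _; rewrite pevalB qK pK subrr => /(_ erefl) h.
have E L : sq (peval q (xc L) - g L) = sq (peval p (xc L) - g L)
    + 2 * complex.Re ((peval p (xc L) - g L) * conjc (peval (q - p) (xc L)))
    + sq (peval (q - p) (xc L)).
  rewrite pevalB; move: (peval q _) (peval p _) (g L) => [a1 a2] [b1 b2] [g1 g2].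
  rewrite /sq !(ReD, ImD, ReN, ImN, ReM, ImM, Re_conj, Im_conj) /=; ring.
under [leRHS]eq_bigr do rewrite E.
rewrite !big_split /= -mulr_sumr -(big_morph _ (@ReD R) (erefl : complex.Re (0 : C) = 0)) h.
by rewrite mulr0 addr0 lerDl addr_ge0// sumr_ge0// => L _; exact: sqr_ge0.
Qed.

(** The constraint is eliminated by searching for [g K] plus a combination of monomials shifted so
    as to vanish at the collocation point of [K]; what remains is an unconstrained orthogonal
    projection. *)
Lemma fit_exists K g : exists p, is_fit T xc m thr K g p.
Proof.
have [k [mon [dm basis]]] := monomial_basis d.+1 m.
pose f a L := if L \in S K then peval (mon a) (xc L) - peval (mon a) (xc K) else 0.
have [c hc] := orthogonal_projection f (fun L => if L \in S K then g L - g K else 0).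
pose p := mpoly.mpolyC d.+1 (g K) + \sum_a c a *: (mon a - mpoly.mpolyC d.+1 (peval (mon a) (xc K))).
have pE x : peval p x = g K + \sum_a c a * (peval (mon a) x - peval (mon a) (xc K)).
  by rewrite pevalD pevalC peval_sumZ; under eq_bigr do rewrite pevalB pevalC.
exists p; apply: normal_eq_is_fit.
- by apply: deg_leD; [exact: deg_leC|apply: deg_le_sumZ => i; exact: deg_le_subC].
- by rewrite pE big1 ?addr0// => a _; rewrite subrr mulr0.
move=> q /basis[e qE] qK.
have qf L : L \in S K -> peval q (xc L) = \sum_a e a * f a L.
  move=> LK; rewrite -[LHS]subr0 -[X in _ - X = _]qK !qE -sumrB; apply: eq_bigr => a _.
  by rewrite /f LK mulrBr.
transitivity (- \sum_b conjc (e b) * \sum_L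
    ((if L \in S K then g L - g K else 0) - \sum_a c a * f a L) * conjc (f b L)).
  under [X in - X]eq_bigr do rewrite mulr_sumr.
  rewrite exchange_big /= -sumrN big_mkcond /=; apply: eq_bigr => L _.
  case: ifP => LK; last first.
    by rewrite big1 ?oppr0// => a _; rewrite /f LK rmorph0 !mulr0.
  rewrite qf// pE rmorph_sum mulr_sumr -sumrN; apply: eq_bigr => b _.
  rewrite rmorphM mulrCA -mulrN; congr (_ * _); rewrite -mulNr; congr (_ * _).
  have -> : \sum_a c a * f a L = \sum_a c a * (peval (mon a) (xc L) - peval (mon a) (xc K)).
    by apply: eq_bigr => a _; rewrite /f LK.
  by move: (\sum_a _) (g L) (g K) => A B D; ring.
by rewrite big1 ?oppr0// => b _; rewrite hc mulr0.
Qed.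

Lemma recon_is_fit g K : is_fit T xc m thr K g (recon T xc m thr g K).
Proof.
by rewrite /recon; case: xgetP => [p _ //|h]; have [p /h] := fit_exists K g.
Qed.

(** The combination of basis functions that the matrix [A_eps] sees. It is shown to be a minimizer
    for [v] itself, so it does not have to be identified with the minimizer chosen by [recon]. *)
Definition lin_recon v : bpoly R d N :=
  fun K => \sum_L v L *: recon T xc m thr (charf R L) K.

Lemma lin_recon_is_fit v K : is_fit T xc m thr K v (lin_recon v K).
Proof.
have vE M : v M = \sum_L v L * charf R L M.
  rewrite (bigD1 M)//= /charf eqxx mulr1 big1 ?addr0// => L LM.
  by rewrite eq_sym (negPf LM) mulr0.
apply: normal_eq_is_fit.
- by apply: deg_le_sumZ => L; case: (recon_is_fit (charf R L) K).
- rewrite peval_sumZ vE; apply: eq_bigr => L _.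
  by case: (recon_is_fit (charf R L) K) => _ ->.
move=> q dq qK.
transitivity (\sum_L v L * \sum_(M in S K)
   (peval (recon T xc m thr (charf R L) K) (xc M) - charf R L M) * conjc (peval q (xc M))).
  under eq_bigr => M _ do rewrite peval_sumZ vE -sumrB mulr_suml.
  rewrite exchange_big /=; apply: eq_bigr => L _; rewrite mulr_sumr; apply: eq_bigr => M _.
  by rewrite -mulrBr mulrA.
rewrite big1// => L _.
by rewrite (is_fit_normal_eq (recon_is_fit (charf R L) K) dq qK) mulr0.
Qed.

(** * Stability of the reconstruction *)

Section Stability.
Hypotheses (uT : unisolvent T xc m thr) (bT : forall K, bset (elt T K)).

Lemma patch_dom_bounded K : exists M, forall x, patch_dom T thr K x ->
  forall i, `|x 0 i| <= M.
Proof.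
have /choice[B hB] L := (bT L).2; exists (\sum_L `|B L|) => x [L _ xL] i.
apply: le_trans (hB L x xL i) _; apply: le_trans (ler_norm _) _.
by rewrite (bigD1 L)//= lerDl sumr_ge0.
Qed.

Definition maxc K p : R := \big[Num.max/0]_(L in S K) normc (peval p (xc L)).

Lemma maxc_ge0 K p : 0 <= maxc K p.
Proof. by apply: bigmax_ge_id. Qed.

Lemma le_maxc K p L : L \in S K -> normc (peval p (xc L)) <= maxc K p.
Proof. exact: (le_bigmax_cond 0 (fun L => normc (peval p (xc L)))). Qed.

(* On the patch, the value of a polynomial at a point is a combination of its values at
   the collocation points, with coefficients that are polynomial in the point. *)
Lemma patch_sup_bounded K : exists2 c : R, 0 <= c & forall p, deg_le m p ->
  forall x, patch_dom T thr K x -> normc (peval p x) <= c * maxc K p.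
Proof.
have [k [mon [dm basis]]] := monomial_basis d.+1 m.
pose M : 'M[C]_(N, k) := \matrix_(L, a) (if L \in S K then peval (mon a) (xc L) else 0).
pose u x L := \sum_a peval (mon a) x * pinvmx M a L.
have uE p x : deg_le m p -> patch_dom T thr K x ->
    peval p x = \sum_(L in S K) u x L * peval p (xc L).
  move=> dp Kx; pose b : 'rV[C]_k := \row_a peval (mon a) x.
  (* A linear relation between the columns of [M] is a polynomial that vanishes at the collocation
     points of the patch. By unisolvence it vanishes at [x], so the row of monomials at [x] lies in
     the row space of [M]. *)
  have bM : (b <= M)%MS.
    rewrite submxE; apply/eqP/matrixP => i j; rewrite [RHS]mxE.
    pose c a := cokermx M a j.
    transitivity (peval (\sum_a c a *: mon a) x).
      rewrite peval_sumZ mxE; apply: eq_bigr => a _.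
      by rewrite [b _ _]mxE mulrC.
    apply: (uT (K := K)) => //; first exact: deg_le_sumZ.
    move=> L LK; rewrite peval_sumZ.
    have : (M *m cokermx M) L j = 0 by rewrite mulmx_coker mxE.
    by rewrite mxE => h0; rewrite -[RHS]h0; apply: eq_bigr => a _; rewrite [M _ _]mxE LK mulrC.
  have := mulmxKpV bM => bE; have [c pE] := basis p dp.
  rewrite pE.
  transitivity (\sum_a c a * (b *m pinvmx M *m M) 0 a).
    by rewrite bE; apply: eq_bigr => a _; rewrite [b _ _]mxE.
  under eq_bigr do rewrite mxE mulr_sumr.
  rewrite exchange_big /= [RHS]big_mkcond /=; apply: eq_bigr => L _.
  have -> : (b *m pinvmx M) 0 L = u x L.
    by rewrite mxE; apply: eq_bigr => a _; rewrite [b _ _]mxE.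
  case: ifP => LK; last by rewrite big1// => a _; rewrite [M _ _]mxE LK !mulr0.
  by rewrite pE mulr_sumr; apply: eq_bigr => a _; rewrite [M _ _]mxE LK mulrCA.
have [B hB] := patch_dom_bounded K.
have nu_ L : nice (u ^~ L).
  by apply: nice_sum => a _; apply: niceM; [exact: nice_peval|exact: nice_cst].
have /choice[c hc] L := (lbm_sq (nu_ L)).2 B.
have bd L x : patch_dom T thr K x -> normc (u x L) <= 1 + `|c L|.
  move=> Kx; have := hc L x (hB x Kx); rewrite ger0_norm ?sq_ge0// -normc_sq => h.
  have n0 : 0 <= normc (u x L) by rewrite normcE sqrtr_ge0.
  have := le_trans h (ler_norm _); move: (normc _) (`|c L|) n0 => a e a0 h2.
  by nra.
exists (\sum_L (1 + `|c L|)); first by apply: sumr_ge0 => L _; rewrite addr_ge0.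
move=> p dp x Kx; rewrite (uE p x dp Kx).
apply: le_trans (_ : \sum_(L in S K) normc (u x L * peval p (xc L)) <= _).
  elim/big_ind2 : _ => [|a a' e e' h h'|//]; first by rewrite normc0.
  by apply: le_trans (le_normcD _ _) _; exact: lerD.
rewrite mulr_suml [leLHS]big_mkcond /=; apply: ler_sum => L _; case: ifP => LK.
  rewrite normcM ler_pM ?bd ?le_maxc//; by rewrite normcE sqrtr_ge0.
by rewrite mulr_ge0 ?maxc_ge0// addr_ge0.
Qed.

(** [Lambda] dominates its quotients only if the suprema are finite, which [patch_sup_bounded]
    provides. A vanishing denominator would make the quotient 0; then the same lemma shows that [p]
    vanishes on the patch. *)
Lemma normc_le_Lambda K p x : deg_le m p -> patch_dom T thr K x ->
  normc (peval p x) <= Lambda T xc m thr K * maxc K p.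
Proof.
move=> dp Kx; have [p0|p0] := eqVneq p 0.
  rewrite p0 (_ : maxc K 0 = 0) ?mulr0.
    by rewrite /peval rmorph0 normc0.
  by apply/bigmax_eq_id => L _; rewrite /peval rmorph0 normc0.
have [c c0 hc] := patch_sup_bounded K.
have [m0|mn0] := eqVneq (maxc K p) 0.
  by have := hc p dp x Kx; rewrite m0 !mulr0.
have m1 : 0 < maxc K p by rewrite lt_neqAle eq_sym mn0 maxc_ge0.
have sup_le q : deg_le m q -> sup [set normc (peval q y) | y in patch_dom T thr K] <= c * maxc K q.
  move=> dq; apply: ge_sup; first by exists (normc (peval q x)), x.
  by move=> _ [y Ky <-]; exact: hc.
rewrite -ler_pdivrMr//.
apply: le_trans (_ : sup [set normc (peval p y) | y in patch_dom T thr K] / maxc K p <= _).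
  rewrite ler_pM2r ?invr_gt0//; apply: ub_le_sup; last by exists x.
  by exists (c * maxc K p) => _ [y Ky <-]; exact: hc.
apply: ub_le_sup; last by exists p.
exists c => _ [q [dq _ ->]]; rewrite -/(maxc K q).
have [q0|qn0] := eqVneq (maxc K q) 0; first by rewrite q0 invr0 mulr0.
by rewrite ler_pdivrMr ?sup_le// lt_neqAle eq_sym qn0 maxc_ge0.
Qed.

Lemma sup_ge0 (E : set R) : (forall x, E x -> 0 <= x) -> 0 <= sup E.
Proof.
move=> E0; have [[[x Ex] ubE]|h] := pselect (has_sup E); last by rewrite sup_out.
exact: le_trans (E0 x Ex) (ub_le_sup ubE Ex).
Qed.

Lemma Lambda_ge0 K : 0 <= Lambda T xc m thr K.
Proof.
apply: sup_ge0 => _ [p [_ _ ->]]; rewrite divr_ge0 ?maxc_ge0//.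
by apply: sup_ge0 => _ [x _ <-]; rewrite normcE sqrtr_ge0.
Qed.

Lemma Lambda_m_ge K :
  1 <= Lambda_m T xc m thr /\ Lambda T xc m thr K <= Lambda_m T xc m thr.
Proof.
have h := le_bigmax 0 (fun K => 1 + Lambda T xc m thr K * Num.sqrt (#|S K|%:R)) K.
have L0 := Lambda_ge0 K; rewrite -/(Lambda_m T xc m thr) in h.
have s1 : 1 <= Num.sqrt (#|S K|%:R : R).
  rewrite -[leLHS]sqrtr1 ler_wsqrtr// ler1n; apply/card_gt0P; exists K.
  exact: patch_refl.
move: h L0 s1; move: (Lambda _ _ _ _ K) (Num.sqrt _) (Lambda_m _ _ _ _) => l s M h l0 s1.
by split; nra.
Qed.

(** The constant [v K] is an admissible competitor, so the residual of the fit is at most the spread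
    of [v] over the patch. This bounds [p - v K] at the collocation points, and [Lambda] extends the
    bound to the patch. *)
Lemma fit_error K v p x : is_fit T xc m thr K v p -> patch_dom T thr K x ->
  sq (peval p x - v K) <=
  4 * Lambda_m T xc m thr ^+ 2 * \sum_(L in S K) sq (v K - v L).
Proof.
move=> [dp pK pmin] Kx; set D := \sum_(L in _) _.
have D0 : 0 <= D by apply: sumr_ge0 => L _; exact: sq_ge0.
have pD : lsq T xc thr K v p <= D.
  apply: le_trans (pmin (mpoly.mpolyC d.+1 (v K)) (deg_leC _ _ _) (pevalC _ _)) _.
  by rewrite lsqE; under eq_bigr do rewrite pevalC.
pose q := p - mpoly.mpolyC d.+1 (v K).
have qE y : peval q y = peval p y - v K by rewrite pevalB pevalC.
have mq : maxc K q <= Num.sqrt (4 * D).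
  apply/bigmax_leP; split=> [|L LK]; first exact: sqrtr_ge0.
  rewrite normcE ler_wsqrtr// qE.
  rewrite (_ : _ - v K = (peval p (xc L) - v L) + (v L - v K)); last by rewrite addrA subrK.
  apply: le_trans (sqD_le _ _) _.
  have h1 : sq (peval p (xc L) - v L) <= D.
    apply: le_trans pD; rewrite lsqE (bigD1 L)//= lerDl sumr_ge0// => M _; exact: sq_ge0.
  have h2 : sq (v L - v K) <= D.
    rewrite -opprB sqN /D (bigD1 L)//= lerDl sumr_ge0// => M _; exact: sq_ge0.
  by move: (sq _) (sq _) h1 h2 => a a' h1 h2; lra.
have [M1 LM] := Lambda_m_ge K; have L0 := Lambda_ge0 K.
have := normc_le_Lambda (deg_le_subC (v K) dp) Kx; rewrite -/q => h.
have h2 : normc (peval q x) <= Lambda_m T xc m thr * Num.sqrt (4 * D).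
  by apply: le_trans h _; apply: ler_pM => //; exact: maxc_ge0.
rewrite -qE -normc_sq; apply: le_trans (_ : (Lambda_m T xc m thr * Num.sqrt (4 * D)) ^+ 2 <= _).
  rewrite lerXn2r// nnegrE; first by rewrite normcE sqrtr_ge0.
  by rewrite mulr_ge0 ?sqrtr_ge0// (le_trans L0).
by rewrite exprMn sqr_sqrtr ?mulr_ge0// mulrCA mulrA.
Qed.

End Stability.
End LeastSquares.

(** * Energy estimates *)

Section MeshFunctionals.
Variable R : realType.
Local Notation C := R[i].

Lemma bset_ref_simplex q : bset (@ref_simplex R q).
Proof.
split; last first.
  exists 1 => t [t0 t1] i; rewrite ger0_norm//; apply: le_trans t1.
  by rewrite (bigD1 i)//= lerDl sumr_ge0.
have -> : (\1_(@ref_simplex R q) : 'rV[R]_q -> R) = fun t =>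
    \prod_i \1_(`[0, +oo[%classic : set R) (t 0 i)
    * \1_(`]-oo, 1]%classic : set R) (\sum_i t 0 i).
  apply/funext => t; rewrite indicE.
  have [/set_mem[t0 t1]|/negP tn] := boolP (t \in @ref_simplex R q).
    rewrite big1 => [|i _]; last by rewrite indicE mem_set//= in_itv/= t0.
    by rewrite indicE mem_set ?mulr1//= in_itv.
  have [t1|t1] := boolP (\sum_i t 0 i <= 1); last first.
    by rewrite [X in _ * X]indicE memNset ?mulr0//= in_itv/=; exact/negP.
  have [i hi] : exists i, ~ 0 <= t 0 i.
    by apply/existsNP => h; apply: tn; rewrite in_setE.
  rewrite (bigD1 i)//= indicE memNset ?mul0r//=.
  by rewrite in_itv/= andbT.
apply: mbleM; last first.
  apply: mble_comp1; first exact: measurable_indic.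
  have [] : lbm (fun t : 'rV[R]_q => \sum_i t 0 i) by apply: lbm_sum => i _; exact: lbm_coord.
  by [].
elim: (index_enum _) => [|j r IH].
  rewrite (_ : (fun x => _) = fun=> 1); first exact: mble_cst.
  by apply/funext => x; rewrite big_nil.
rewrite (_ : (fun x => _) = fun t : 'rV[R]_q => \1_(`[0, +oo[%classic : set R) (t 0 j) *
   \prod_(i <- r) \1_(`[0, +oo[%classic : set R) (t 0 i)); last first.
  by apply/funext => x; rewrite big_cons.
apply: mbleM => //; apply: mble_comp1; last exact: mble_coord.
exact: measurable_indic.
Qed.

Definition ref_vol q : R := rint (@ref_simplex R q) (fun=> 1).

Lemma ref_vol_le1 q : ref_vol q <= 1.
Proof.
have <- : rint (box (0 : 'rV[R]_q) 1) (fun=> 1) = 1 by rewrite rint_box// expr1n.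
apply: rint_le => //; [exact: bset_ref_simplex|exact: bset_box|exact: lbm_cst|exact: lbm_cst|].
move=> t [t0 t1] i; rewrite mxE t0 add0r /=; apply: le_trans t1.
by rewrite (bigD1 i)//= lerDl sumr_ge0.
Qed.

Lemma ref_vol_gt0 q : (0 < q)%N -> 0 < ref_vol q.
Proof.
move=> q0; have q1 : 0 < q%:R :> R by rewrite ltr0n.
apply: lt_le_trans (_ : q%:R^-1 ^+ q <= _); first by rewrite exprn_gt0 ?invr_gt0.
have s0 : 0 <= q%:R^-1 :> R by rewrite invr_ge0.
rewrite -(rint_box (0 : 'rV[R]_q) s0).
apply: rint_le => //; [exact: bset_box|exact: bset_ref_simplex|exact: lbm_cst|exact: lbm_cst|].
move=> t tb; split=> [i|]; first by have := tb i; rewrite mxE => /andP[].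
apply: le_trans (_ : \sum_(i < q) q%:R^-1 <= _).
  by apply: ler_sum => i _; have := tb i; rewrite mxE add0r => /andP[].
by rewrite sumr_const card_ord -[_ *+ _]mulr_natr mulVf// gt_eqF.
Qed.

Variables (d N : nat) (T : mesh R d N).

Definition rsurf (F : lface d N) (g : 'rV[R]_d.+1 -> R) : R :=
  farea T F * rint (@ref_simplex R d)
    (fun t => g (fvert T F ord0 + t *m edges (fvert T F))).

Lemma surf_intE F f : surf_int (fvert T F) f = cext (rsurf F) f.
Proof. by apply: eqC; rewrite ?ReM ?ImM /= mul0r ?subr0 ?addr0. Qed.

Lemma lbm_param (F : lface d N) i :
  lbm (fun t : 'rV[R]_d => (fvert T F ord0 + t *m edges (fvert T F)) 0 i).
Proof.
apply: (@eq_lbm _ _ (fun t => fvert T F ord0 0 i + \sum_j t 0 j * edges (fvert T F) j i)).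
  by move=> t; rewrite !mxE.
apply: lbmD; first exact: lbm_cst.
by apply: lbm_sum => j _; apply: lbmM; [exact: lbm_coord|exact: lbm_cst].
Qed.

Lemma param_face (F : lface d N) t : @ref_simplex R d t ->
  face T F (fvert T F ord0 + t *m edges (fvert T F)).
Proof.
move=> [t0 t1]; exists (fun j => if unlift ord0 j is Some i then t 0 i else 1 - \sum_i t 0 i).
split=> [j|j||].
- by case: unliftP => // _; rewrite subr_ge0.
- by rewrite finset.inE.
- rewrite big_ord_recl unlift_none [X in _ + X](eq_bigr (fun i => t 0 i)) ?subrK// => i _.
  by rewrite liftK.
- rewrite big_ord_recl unlift_none.
  rewrite [X in _ = _ + X](eq_bigr (fun i => t 0 i *: fvert T F (lift ord0 i))); last by move=> i _; rewrite liftK.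
  rewrite mulmx_sum_row scalerBl scale1r -addrA; congr (_ + _).
  rewrite scaler_suml -sumrN -big_split; apply: eq_bigr => i _.
  by apply/rowP => l; rewrite !mxE; ring.
Qed.

Lemma farea_ge0 F : 0 <= farea T F. Proof. exact: sqrtr_ge0. Qed.

Lemma posfun_rsurf F : posfun (face T F) (rsurf F).
Proof.
have bR := bset_ref_simplex d.
have lp f : lbm f -> lbm (fun t => f (fvert T F ord0 + t *m edges (fvert T F))).
  by move=> lf; apply: lbm_comp => // i; exact: lbm_param.
split=> [a f g lf lg|f g lf lg fg]; rewrite /rsurf.
  by rewrite rint_lin ?mulrDr; [rewrite mulrCA|exact: bR|exact: lp|exact: lp].
rewrite ler_wpM2l ?farea_ge0//; apply: rint_mono => //; [exact: lp|exact: lp|].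
by move=> t tr; apply: fg; exact: param_face.
Qed.

Lemma rsurf1 F : rsurf F (fun=> 1) = farea T F * ref_vol d.
Proof. by []. Qed.

Definition gK (u : bpoly R d N) K : R :=
  rint (elt T K) (fun x => \sum_l sq (peval (pdiff l (u K)) x)).
Definition mK (u : bpoly R d N) K : R := rint (elt T K) (fun x => sq (peval (u K) x)).
Definition jF (u : bpoly R d N) (F : lface d N * lface d N) : R :=
  rsurf F.1 (fun x => sq (jump u F x)).
Definition bF (u : bpoly R d N) F : R := rsurf F (fun x => sq (peval (u F.1) x)).
Definition vF (u : bpoly R d N) (F : lface d N * lface d N) : R :=
  rsurf F.1 (fun x => sq (avg_dn T u F x)).

Lemma nice_jump u F : nice (@jump R d N u F).
Proof. by apply: niceB; exact: nice_peval. Qed.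

Lemma nice_avg u F : nice (avg_dn T u F).
Proof.
apply: nice_sum => l _; apply: niceM; first exact: nice_cst.
apply: niceM; last exact: nice_cst.
by apply: niceD; exact: nice_peval.
Qed.

Lemma lbm_grad (p : cpoly R d.+1) : lbm (fun x => \sum_l sq (peval (pdiff l p) x)).
Proof. by apply: lbm_sum => l _; exact: lbm_sq (nice_peval _). Qed.

Lemma sum_sq_ge0 (p : cpoly R d.+1) x : 0 <= \sum_l sq (peval (pdiff l p) x).
Proof. by apply: sumr_ge0 => l _; exact: sq_ge0. Qed.

Lemma gK_ge0 u K : 0 <= gK u K.
Proof. by apply: rint_ge0 => x _; exact: sum_sq_ge0. Qed.
Lemma mK_ge0 u K : 0 <= mK u K.
Proof. by apply: rint_ge0 => x _; exact: sq_ge0. Qed.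
Lemma rsurf_sq_ge0 F (f : 'rV[R]_d.+1 -> C) : 0 <= rsurf F (fun x => sq (f x)).
Proof. by rewrite mulr_ge0 ?farea_ge0//; apply: rint_ge0 => x _; exact: sq_ge0. Qed.

(** The default 0 of [xget] satisfies it too; the estimates use the normal only through this
    bound. *)
Lemma normal_le1 F l : `|normal T F 0 l| <= 1.
Proof.
rewrite /normal; case: xgetP => [n _ [n1 _ _]|_]; last by rewrite mxE normr0.
by rewrite -n1; exact: coord_le_enorm.
Qed.

Lemma sq_mean_le (e : R) (a b : C) : `|e| <= 1 -> sq (e%:C%C * ((a + b) / 2)) <= sq a + sq b.
Proof.
move=> e1; rewrite !sqM sq_real.
have {}e1 : e ^+ 2 <= 1 by rewrite -(real_normK (num_real _)) expr_le1.
have -> : sq (2^-1 : C) = 4^-1.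
  by rewrite (_ : 2^-1 = (2^-1 : R)%:C%C) ?sq_real ?fmorphV ?rmorph_nat//; field.
have := sqD_le a b; have := sq_ge0 (a + b); have := sq_ge0 a; have := sq_ge0 b.
move: (sq (a + b)) (sq a) (sq b) => D A B B0 A0 D0 h.
apply: le_trans (_ : 1 * (D * 4^-1) <= _); last lra.
by rewrite ler_wpM2r// divr_ge0.
Qed.

Lemma sq_avg_le u F x : sq (avg_dn T u F x) <= 2 ^+ d.+1 *
  \sum_l (sq (peval (pdiff l (u F.1.1)) x) + sq (peval (pdiff l (u F.2.1)) x)).
Proof.
apply: le_trans (sq_sum_le _) _; rewrite card_ord ler_wpM2l ?exprn_ge0//.
by apply: ler_sum => l _; exact/sq_mean_le/normal_le1.
Qed.

End MeshFunctionals.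

(** * Trace, Poincare and inverse inequalities on elements *)

Section LocalEstimates.
Variables (R : realType) (d m : nat) (kappa : R).
Hypotheses (d0 : (0 < d)%N) (k0 : 0 < kappa) (k1 : kappa <= 1).
Local Notation C := R[i].

Lemma kinv_ge1 : 1 <= kappa^-1.
Proof. by rewrite -[leLHS]invr1 lef_pV2 ?posrE. Qed.

(** The box of radius [h] around the corner contains the closed element, so the bound holds on its
    faces. The power of [h] is split because [hmax T ^+ d] cancels against the area of a face. *)
Lemma elt_trace : exists2 c : R, 0 < c &
  forall N (T : mesh R d N) b K p x, regular T kappa b -> deg_le m p ->
  bigbox (b K) (hmax T) x ->
  sq (peval p x) <= c / (hmax T * hmax T ^+ d) * rint (elt T K) (fun x => sq (peval p x)).
Proof.
have [c c0 H] := @chunky_sup R m kappa^-1 d.+1 kinv_ge1.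
exists (c / kappa ^+ d.+1); first by rewrite divr_gt0 ?exprn_gt0.
move=> N T b K p x rT dp bx; have h0 := reg_h rT.
have := H (elt T K) (b K) (kappa * hmax T) p (mulr_gt0 k0 h0) (reg_bset rT K) (@reg_box _ _ _ _ _ _ rT K) dp x.
rewrite mulrA mulVf ?gt_eqF// mul1r => /(_ bx) /le_trans; apply.
by rewrite -exprS exprMn invfM mulrA.
Qed.

Lemma elt_poincare : exists2 c : R, 0 < c &
  forall N (T : mesh R d N) b K p x y, regular T kappa b -> deg_le m p ->
  bigbox (b K) (hmax T) x -> bigbox (b K) (hmax T) y ->
  sq (peval p x - peval p y) <= c * (hmax T / hmax T ^+ d *
    rint (elt T K) (fun x => \sum_l sq (peval (pdiff l p) x))).
Proof.
have [c c0 H] := @chunky_poincare R m kappa^-1 d.+1 kinv_ge1.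
exists (c * (kappa ^+ 2 / kappa ^+ d.+1)); first by rewrite mulr_gt0// divr_gt0 ?exprn_gt0.
move=> N T b K p x y rT dp bx by_; have h0 := reg_h rT.
have := H (elt T K) (b K) (kappa * hmax T) p (mulr_gt0 k0 h0) (reg_bset rT K) (@reg_box _ _ _ _ _ _ rT K) dp x y.
rewrite mulrA mulVf ?gt_eqF// mul1r => /(_ bx by_) /le_trans; apply.
rewrite -!mulrA ler_wpM2l ?(ltW c0)// !mulrA.
rewrite le_eqVlt; apply/orP; left; apply/eqP; congr (_ * _).
have := expf_neq0 d (lt0r_neq0 h0); have := lt0r_neq0 h0.
have := expf_neq0 d (lt0r_neq0 k0); have := lt0r_neq0 k0.
rewrite !exprMn !exprS; move: (hmax T) (kappa ^+ d) (hmax T ^+ d) => h kd hd kn kdn hn hdn.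
by field; rewrite kn kdn hn hdn.
Qed.

(** Subtracting a constant does not change the gradient, so the distance to [v] on the element also
    controls the gradient. *)
Lemma elt_inverse : exists2 c : R, 0 < c &
  forall N (T : mesh R d N) b K p v B x, regular T kappa b -> deg_le m p ->
  (forall y, elt T K y -> sq (peval p y - v) <= B) ->
  bigbox (b K) (hmax T) x ->
  sq (peval p x - v) <= c * B /\ forall l, sq (peval (pdiff l p) x) <= c * B / hmax T ^+ 2.
Proof.
have [c c0 H] := @box_ext R m kappa^-1 d.+1 kinv_ge1.
have k2 : 0 < kappa ^+ 2 by rewrite exprn_gt0.
have k21 : 1 <= (kappa ^+ 2)^-1 by rewrite -[leLHS]invr1 lef_pV2 ?posrE// expr_le1// ltW.
exists (c / kappa ^+ 2); first by rewrite divr_gt0.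
move=> N T b K p v B x rT dp pB bx; have h0 := reg_h rT.
have B0 : 0 <= B.
  apply: le_trans (pB (b K) _); first exact: sq_ge0.
  apply: (reg_box rT) => i; rewrite lexx lerDl.
  by rewrite mulr_ge0// ltW.
have := H (b K) (kappa * hmax T) (p - mpoly.mpolyC d.+1 v) B (mulr_gt0 k0 h0) (deg_le_subC v dp) _ x.
rewrite mulrA mulVf ?gt_eqF// mul1r peval_subC => /(_ _ bx)[|h1 h2].
  by move=> y yb; rewrite peval_subC; apply: pB; exact: (reg_box rT).
split=> [|l].
  apply: le_trans h1 _; rewrite -mulrA ler_wpM2l ?(ltW c0)//.
  by rewrite ler_peMl.
have := h2 l; rewrite pdiff_subC => /le_trans; apply.
by rewrite exprMn invfM [c / _ * B]mulrAC !mulrA.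
Qed.

Lemma elt_vol_le N (T : mesh R d N) b K : regular T kappa b ->
  rint (elt T K) (fun=> 1) <= 2 ^+ d.+1 * (hmax T * hmax T ^+ d).
Proof.
move=> rT; have h0 := reg_h rT.
have h2 : 0 <= 2 * hmax T by rewrite mulr_ge0// ltW.
rewrite -exprS -exprMn -(rint_box (b K - hmax T *: const_mx 1) h2).
apply: rint_le => //; [exact: reg_bset rT K|exact: bset_box|exact: lbm_cst|exact: lbm_cst|].
move=> x Kx i; have := reg_hull rT (open_simplex_sub_hull Kx) i.
rewrite !mxE mulr1 ler_norml; move: (hmax T) (x 0 i) (b K 0 i) => h y z.
by move=> /andP[h1 h3]; apply/andP; split; lra.
Qed.

Lemma face_vol_le N (T : mesh R d N) b F : regular T kappa b ->
  rsurf T F (fun=> 1) <= kappa^-1 * hmax T ^+ d.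
Proof.
move=> rT; rewrite rsurf1; apply: le_trans (reg_area_le rT F).
by rewrite ler_piMr ?farea_ge0// ref_vol_le1.
Qed.

Lemma face_vol_ge N (T : mesh R d N) b F : regular T kappa b ->
  kappa * ref_vol R d * hmax T ^+ d <= rsurf T F (fun=> 1).
Proof.
move=> rT; rewrite rsurf1 mulrAC ler_wpM2r ?(reg_area_ge rT)//.
by rewrite ltW// ref_vol_gt0.
Qed.

Lemma iface_bigbox N (T : mesh R d N) b F x : regular T kappa b -> ifaces T F ->
  face T F.1 x -> bigbox (b F.1.1) (hmax T) x /\ bigbox (b F.2.1) (hmax T) x.
Proof.
move=> rT /andP[_ /asboolP FF] Fx; split; apply: (reg_hull rT).
  exact: (face_sub_hull Fx).
by apply: (@face_sub_hull _ _ _ T F.2); rewrite -FF.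
Qed.

Lemma bface_bigbox N (T : mesh R d N) b (F : lface d N) x : regular T kappa b ->
  face T F x -> bigbox (b F.1) (hmax T) x.
Proof. by move=> rT Fx; apply: (reg_hull rT); exact: (face_sub_hull Fx). Qed.

Lemma rsurf_sup N (T : mesh R d N) b F f c : regular T kappa b -> lbm f -> 0 <= c ->
  (forall x, face T F x -> f x <= c) -> rsurf T F f <= c * (kappa^-1 * hmax T ^+ d).
Proof.
move=> rT lf c0 fc; apply: le_trans (posfun_sup (posfun_rsurf T F) lf fc) _.
by rewrite ler_wpM2l// (face_vol_le F rT).
Qed.

End LocalEstimates.

(** * Young inequalities for sesquilinear integrals *)

Section ComplexBounds.
Variable R : realType.
Local Notation C := R[i].

(** Bounds both components in place of the modulus: stable under sums and multiplication by i, and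
    each component is available separately in the coercivity argument. *)
Definition le2 (z : C) (x : R) : Prop := `|complex.Re z| <= x /\ `|complex.Im z| <= x.

Lemma le2W z x y : x <= y -> le2 z x -> le2 z y.
Proof. by move=> xy [h1 h2]; split; exact: le_trans xy. Qed.

Lemma le2D z w x y : le2 z x -> le2 w y -> le2 (z + w) (x + y).
Proof.
move=> [h1 h2] [h3 h4]; split; rewrite ?ReD ?ImD; apply: le_trans (ler_normD _ _) _;
  exact: lerD.
Qed.

Lemma le2N z x : le2 z x -> le2 (- z) x.
Proof. by case=> h1 h2; split; rewrite ?ReN ?ImN normrN. Qed.

Lemma le2_sum (I : Type) (r : seq I) (P : pred I) (z : I -> C) (x : I -> R) :
  (forall i, P i -> le2 (z i) (x i)) ->
  le2 (\sum_(i <- r | P i) z i) (\sum_(i <- r | P i) x i).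
Proof.
move=> h; elim/big_ind2 : _ => //; first by split; rewrite normr0.
by move=> *; exact: le2D.
Qed.

Lemma le2_i z x : le2 z x -> le2 ('i%C * z) x.
Proof.
by move=> [h1 h2]; split; rewrite ?ReM ?ImM /= ?mul0r ?mul1r ?sub0r ?add0r ?addr0 ?normrN.
Qed.

Lemma le2Z (c : R) z x : 0 <= c -> le2 z x -> le2 (c%:C%C * z) (c * x).
Proof.
move=> c0 [h1 h2]; split; rewrite ?ReM ?ImM /= mul0r ?subr0 ?addr0 normrM (ger0_norm c0);
  exact: ler_wpM2l.
Qed.

(** The pointwise inequality [|f| |g| <= t |f|^2 + |g|^2 / t] is integrated by monotonicity, for the
    real and the imaginary part separately. *)
Lemma cext_young n (D : set 'rV[R]_n) I (f g : 'rV[R]_n -> C) (t : R) :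
  posfun D I -> nice f -> nice g -> 0 < t ->
  le2 (cext I (fun x => f x * conjc (g x)))
    (t * I (fun x => sq (f x)) + t^-1 * I (fun x => sq (g x))).
Proof.
move=> pI nf ng t0; have nfg := niceM nf (nice_conj ng).
have lf := lbm_sq nf; have lg := lbm_sq ng.
rewrite -(posfunZ pI t^-1 lg) -(posfun_lin pI t lf (lbmZ t^-1 lg)).
set G := (fun x => t * _ + _).
have lG : lbm G by apply: lbmD; exact: lbmZ.
have fG x : sq (f x * conjc (g x)) <= G x ^+ 2.
  rewrite sqM sq_conj /G; have := sq_ge0 (f x); have := sq_ge0 (g x).
  move: (sq (f x)) (sq (g x)) => A B B0 A0.
  have : A * B = (t * A) * (t^-1 * B) by rewrite mulrACA divff ?mul1r// gt_eqF.
  have : 0 <= t * A by rewrite mulr_ge0// ltW.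
  have : 0 <= t^-1 * B by rewrite mulr_ge0// invr_ge0 ltW.
  by move: (t * A) (t^-1 * B) => A' B' B'0 A'0 ->; nra.
have G0 x : 0 <= G x by rewrite addr_ge0// mulr_ge0 ?sq_ge0 ?invr_ge0// ltW.
have key (u : 'rV[R]_n -> R) : lbm u -> (forall x, u x ^+ 2 <= G x ^+ 2) -> `|I u| <= I G.
  move=> lu hu.
  have h x : `|u x| <= G x.
    by rewrite -(@ler_pXn2r _ 2) ?nnegrE// real_normK ?num_real.
  have hp : I u <= I G.
    by apply: (posfun_mono pI) => // x _; apply: le_trans (h x); exact: ler_norm.
  have hm : - I u <= I G.
    rewrite -mulN1r -(posfunZ pI)//.
    apply: (posfun_mono pI) => //; first exact: lbmZ.
    by move=> x _; apply: le_trans (h x); rewrite mulN1r -normrN; exact: ler_norm.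
  by rewrite ler_norml; apply/andP; split; lra.
split; apply: key; [exact: nfg.1| |exact: nfg.2|] => x; apply: le_trans (fG x).
  by rewrite [leRHS]/sq lerDl sqr_ge0.
by rewrite [leRHS]/sq lerDr sqr_ge0.
Qed.

Lemma cext_young1 n (D : set 'rV[R]_n) I (f g : 'rV[R]_n -> C) :
  posfun D I -> nice f -> nice g ->
  le2 (cext I (fun x => f x * conjc (g x)))
    (I (fun x => sq (f x)) + I (fun x => sq (g x))).
Proof. by move=> pI nf ng; have := cext_young pI nf ng ltr01; rewrite invr1 !mul1r. Qed.

Lemma nice_sesq n (f g : 'rV[R]_n -> C) : nice f -> nice g ->
  nice (fun x => f x * conjc (g x)).
Proof. by move=> nf ng; apply: niceM => //; exact: nice_conj. Qed.

Lemma int_onE n (A : set 'rV[R]_n) f : int_on A f = cext (rint A) f.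
Proof. by []. Qed.

Section Additivity.
Variables (n : nat) (D : set 'rV[R]_n) (I : ('rV[R]_n -> R) -> R).
Hypothesis pI : posfun D I.

Lemma cext0 : cext I (fun=> 0) = 0.
Proof. by rewrite /cext /= (posfun0 pI). Qed.

Lemma cextD f g : nice f -> nice g ->
  cext I (fun x => f x + g x) = cext I f + cext I g.
Proof.
move=> nf ng; rewrite -[X in X + _]mul1r -(cext_lin pI)//.
by congr cext; apply/funext => x; rewrite mul1r.
Qed.

Lemma cextZ c f : nice f -> cext I (fun x => c * f x) = c * cext I f.
Proof.
move=> nf; rewrite -[RHS]addr0 -[X in _ + X]cext0 -(cext_lin pI)//; last exact: nice_cst.
by congr cext; apply/funext => x; rewrite addr0.
Qed.

Lemma cext_sum (J : Type) (r : seq J) (F : J -> 'rV[R]_n -> C) :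
  (forall j, nice (F j)) ->
  cext I (fun x => \sum_(j <- r) F j x) = \sum_(j <- r) cext I (F j).
Proof.
move=> nF; elim: r => [|j r IH].
  rewrite big_nil -[RHS]cext0; congr (cext I _); apply/funext => x.
  by rewrite big_nil.
rewrite big_cons -IH -cextD//; last exact: nice_sum.
by congr (cext I _); apply/funext => x; rewrite big_cons.
Qed.

Lemma cext_sq f :
  cext I (fun x => f x * conjc (f x)) = (I (fun x => sq (f x)))%:C%C.
Proof.
rewrite -(cext_real pI); congr (cext _ _); apply/funext => x; exact: mulC_conj.
Qed.

Lemma cext_sum_sq (J : Type) (r : seq J) (F : J -> 'rV[R]_n -> C) :
  cext I (fun x => \sum_(j <- r) F j x * conjc (F j x))
  = (I (fun x => \sum_(j <- r) sq (F j x)))%:C%C.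
Proof.
rewrite -(cext_real pI); congr (cext _ _); apply/funext => x.
by rewrite rmorph_sum; apply: eq_bigr => j _; exact: mulC_conj.
Qed.

End Additivity.
End ComplexBounds.

Lemma gK_sum (R : realType) d N (T : mesh R d N) u K : bset (elt T K) ->
  gK T u K = \sum_l rint (elt T K) (fun x => sq (peval (pdiff l (u K)) x)).
Proof.
move=> bK; apply: (posfun_sum (posfun_rint bK)) => l _.
exact: lbm_sq (nice_peval _).
Qed.

(** * The broken energy and the arithmetic of its bounds *)

Section Energy.
Variables (R : realType) (d N : nat) (Omega : set 'rV[R]_d.+1) (T : mesh R d N).
Local Notation C := R[i].

Definition Gr (u : bpoly R d N) : R := \sum_K gK T u K.
Definition Ms (u : bpoly R d N) : R := \sum_K mK T u K.
Definition Jp (u : bpoly R d N) : R := \sum_(F | ifaces T F) jF T u F.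
Definition Bm (u : bpoly R d N) : R := \sum_(F | bfaces Omega T F) bF T u F.
Definition energy (k : R) (u : bpoly R d N) : R :=
  Gr u + Jp u / hmax T + k ^+ 2 * Ms u + k * Bm u.

Lemma Gr_ge0 u : 0 <= Gr u. Proof. by apply: sumr_ge0 => K _; exact: gK_ge0. Qed.
Lemma Ms_ge0 u : 0 <= Ms u. Proof. by apply: sumr_ge0 => K _; exact: mK_ge0. Qed.
Lemma Jp_ge0 u : 0 <= Jp u. Proof. by apply: sumr_ge0 => F _; exact: rsurf_sq_ge0. Qed.
Lemma Bm_ge0 u : 0 <= Bm u. Proof. by apply: sumr_ge0 => F _; exact: rsurf_sq_ge0. Qed.

Lemma energy_parts k u : 0 < k -> 0 < hmax T ->
  [/\ Gr u <= energy k u, Jp u / hmax T <= energy k u,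
      k ^+ 2 * Ms u <= energy k u, k * Bm u <= energy k u & 0 <= energy k u].
Proof.
move=> k0 h0; rewrite /energy.
have := Gr_ge0 u; have : 0 <= Jp u / hmax T by rewrite divr_ge0 ?Jp_ge0// ltW.
have : 0 <= k ^+ 2 * Ms u by rewrite mulr_ge0 ?sqr_ge0// Ms_ge0.
have : 0 <= k * Bm u by rewrite mulr_ge0 ?Bm_ge0// ltW.
move: (Gr u) (Jp u / hmax T) (k ^+ 2 * Ms u) (k * Bm u) => a b c e e0 c0 b0 a0.
by split; lra.
Qed.

End Energy.

Lemma young_regroup (R : realType) (t s a b c d : R) :
  t * a + s * d + (s * c + t * b) <= t * (a + b) + s * (c + d).
Proof. lra. Qed.

Lemma form_arith (R : realType) (ceps ca e V V' G G' J J' M M' B B' k2 k E E' : R) :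
  0 <= ceps -> 0 <= ca -> 0 <= e -> V <= ca * G -> V' <= ca * G' ->
  G <= E -> J <= E -> k2 * M <= E -> k * B <= E ->
  G' <= E' -> J' <= E' -> k2 * M' <= E' -> k * B' <= E' ->
  G + G' + (J + J' + (V + V')) + e * (J + J') + (1 + ceps) * (k2 * (M + M'))
    + k * (B + B') <= (4 + ca + e + ceps) * (E + E').
Proof.
move=> c0 ca0 e0 V1 V2 a1 a2 a3 a4 b1 b2 b3 b4.
rewrite !mulrDr; move: (k2 * M) (k2 * M') (k * B) (k * B') a3 a4 b3 b4 => m m' q q' a3 a4 b3 b4.
have h1 := ler_wpM2l ca0 a1; have h2 := ler_wpM2l ca0 b1.
have h3 := ler_wpM2l e0 a2; have h4 := ler_wpM2l e0 b2.
have h5 := ler_wpM2l c0 a3; have h6 := ler_wpM2l c0 b3.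
rewrite !mulrDl !mul1r.
move: (ca * G) (ca * G') (ca * E) (ca * E') (e * J) (e * J') (e * E) (e * E') (ceps * m)
  (ceps * m') (ceps * E) (ceps * E') V1 V2 h1 h2 h3 h4 h5 h6 => *; lra.
Qed.

(** [JH + e * M + B] is the imaginary part and [G - s - k2 * M] the real part. The former bounds
    [J], [e * M] and [B] by [X], hence [k2 * M] by [k2 / e * X]. The latter, half of [G] being
    absorbed, gives [G <= 2 X + 16 a X + 2 (k2 / e) X]. Finally [X <= c (k2 / e) X]. *)
Lemma coercive_arith (R : realType) (k2 e c a G J M B s JH X : R) :
  0 < e -> e <= c * k2 -> 0 < c -> 0 < a -> `|s| <= 8 * a * J + G / 2 -> J <= JH ->
  0 <= M -> 0 <= B -> 0 <= J -> `|G - s - k2 * M| <= X -> `|JH + e * M + B| <= X ->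
  G + J + k2 * M + B <= ((4 + 16 * a) * c + 3) * (k2 / e * X).
Proof.
move=> e0 kc c0 a0 hs JJ M0 B0 J0 hR hI.
have eM0 : 0 <= e * M by rewrite mulr_ge0// ltW.
have JX : J <= X by apply: le_trans hI; apply: le_trans (ler_norm _); lra.
have BX : B <= X by apply: le_trans hI; apply: le_trans (ler_norm _); lra.
have MX : e * M <= X by apply: le_trans hI; apply: le_trans (ler_norm _); lra.
have X0 : 0 <= X by apply: le_trans JX.
pose q := k2 / e.
have k20 : 0 <= k2 by rewrite -(pmulr_rge0 _ c0) (le_trans _ kc)// ltW.
have q0 : 0 <= q by rewrite divr_ge0// ltW.
have kM : k2 * M = q * (e * M) by rewrite /q mulrA divfK// gt_eqF.
have cq : 1 <= c * q by rewrite /q mulrA ler_pdivlMr// mul1r.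
have qX : k2 * M <= q * X by rewrite kM ler_wpM2l.
have cX : X <= c * (q * X) by rewrite mulrA ler_peMl.
have aJ : a * J <= a * X by rewrite ler_wpM2l// ltW.
have aX : a * X <= a * (c * (q * X)) by rewrite ler_wpM2l// ltW.
rewrite -/q; move: (k2 * M) hR qX => KM hR qX.
have {}hR := le_trans (ler_norm _) hR; have {}hs := le_trans (ler_norm _) hs.
have -> : ((4 + 16 * a) * c + 3) * (q * X) =
  4 * (c * (q * X)) + 16 * (a * (c * (q * X))) + 3 * (q * X) by ring.
rewrite -mulrA in hs.
by move: (q * X) (c * (q * X)) (a * J) (a * X) (a * (c * (q * X))) hs qX cX aJ aX => *; lra.
Qed.

Lemma inv_regroup (R : realType) (c h V : R) : 0 < c -> 0 < h ->
  (4 * c / h)^-1 * (V + V) = h * V / c / 2.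
Proof. by move=> c0 h0; field; rewrite !gt_eqF. Qed.

(** * Continuity and coercivity of the form *)

Section FormBounds.
Variables (R : realType) (d m : nat) (kappa eta ceps : R).
Hypotheses (d0 : (0 < d)%N) (k0 : 0 < kappa) (k1 : kappa <= 1).
Hypotheses (eta1 : 1 <= eta) (ceps0 : 0 < ceps).
Local Notation C := R[i].

(** The trace bound is applied to the components of the gradient on both sides of each face; the
    factor [hmax T] makes up for the difference between face and volume integrals. *)
Lemma avg_energy_le : exists2 c : R, 0 < c &
  forall N (T : mesh R d N) b u, regular T kappa b ->
  (forall K L, K != L -> elt T K `&` elt T L = set0) ->
  (forall K, deg_le m (u K)) ->
  hmax T * \sum_(F | ifaces T F) vF T u F <= c * Gr T u.
Proof.
have [c c0 H] := elt_trace d m k0 k1.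
pose A : R := 2 ^+ d.+1 * c * kappa^-1.
have A0 : 0 < A by rewrite !mulr_gt0 ?exprn_gt0 ?invr_gt0.
pose P : R := 2 * d.+2%:R ^+ 2 * pack d kappa 2.
have P0 : 0 < P by rewrite !mulr_gt0 ?exprn_gt0 ?divr_gt0 ?mulr_gt0.
exists (A * P); first exact: mulr_gt0.
move=> N T b u rT dis du; have h0 := reg_h rT.
have hd0 : 0 < hmax T ^+ d by rewrite exprn_gt0.
have key F : ifaces T F -> hmax T * vF T u F <= A * (gK T u F.1.1 + gK T u F.2.1).
  move=> iF; have := rsurf_sup (F := F.1) rT (lbm_sq (nice_avg T u F)).
  have Kb K x : bigbox (b K) (hmax T) x -> \sum_l sq (peval (pdiff l (u K)) x) <=
      c / (hmax T * hmax T ^+ d) * gK T u K.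
    move=> bx; rewrite (gK_sum u (reg_bset rT K)) mulr_sumr; apply: ler_sum => l _.
    exact: H rT (deg_le_pdiff l (du K)) bx.
  have S0 : 0 <= gK T u F.1.1 + gK T u F.2.1 by rewrite addr_ge0 ?gK_ge0.
  move=> /(_ (2 ^+ d.+1 * (c / (hmax T * hmax T ^+ d) * (gK T u F.1.1 + gK T u F.2.1)))) h.
  apply: le_trans (ler_wpM2l (ltW h0) (h _ _)) _ => [|x Fx|].
  - have cc : 0 <= c / (hmax T * hmax T ^+ d) by apply/ltW/divr_gt0 => //; exact: mulr_gt0.
    by apply: mulr_ge0; [exact: exprn_ge0|exact: mulr_ge0].
  - apply: le_trans (sq_avg_le T u F x) _; rewrite ler_wpM2l ?exprn_ge0// big_split /= mulrDr.
    have [b1 b2] := iface_bigbox rT iF Fx.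
    by apply: lerD; exact: Kb.
  - have := lt0r_neq0 h0; have := lt0r_neq0 hd0; have := lt0r_neq0 k0; rewrite /A.
    move: (hmax T) (hmax T ^+ d) (_ + _) (2 ^+ d.+1) => h' hd S e n1 n2 n3.
    by rewrite le_eqVlt; apply/orP; left; apply/eqP; field; rewrite n1 n2 n3.
rewrite mulr_sumr; apply: le_trans (ler_sum _ key) _.
rewrite -mulr_sumr -mulrA ler_wpM2l ?(ltW A0)//.
by apply: (sum_ifaces_le k0 k1 rT dis) => K; exact: gK_ge0.
Qed.

Variables (N : nat) (T : mesh R d N) (b : 'I_N -> 'rV[R]_d.+1).
Hypotheses (rT : regular T kappa b).
Variables (k eps : R).
Hypotheses (kgt0 : 0 < k) (eps0 : 0 < eps) (epsk : eps <= ceps * k ^+ 2).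

Let h0 : 0 < hmax T := reg_h rT.

Lemma grad_form_le2 u v :
  le2 (\sum_K int_on (elt T K) (fun x =>
     \sum_l peval (pdiff l (u K)) x * conjc (peval (pdiff l (v K)) x)))
    (Gr T u + Gr T v).
Proof.
rewrite -big_split; apply: le2_sum => K _.
have pI := posfun_rint (reg_bset rT K).
rewrite int_onE (cext_sum pI); last first.
  by move=> l; apply: nice_sesq; exact: nice_peval.
rewrite (gK_sum u (reg_bset rT K)) (gK_sum v (reg_bset rT K)) -big_split /=.
apply: le2_sum => l _.
exact: (cext_young1 pI (nice_peval (pdiff l (u K))) (nice_peval (pdiff l (v K)))).
Qed.

Lemma mass_le2 u v : le2 (mass T u v) (Ms T u + Ms T v).
Proof.
rewrite -big_split; apply: le2_sum => K _.
exact: (cext_young1 (posfun_rint (reg_bset rT K)) (nice_peval (u K)) (nice_peval (v K))).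
Qed.

Lemma bmass_le2 Omega u v : le2 (bmass Omega T u v) (Bm Omega T u + Bm Omega T v).
Proof.
rewrite -big_split; apply: le2_sum => F _; rewrite surf_intE.
exact: (cext_young1 (posfun_rsurf T F) (nice_peval (u F.1)) (nice_peval (v F.1))).
Qed.

Lemma consistency_le2 (t : R) u v F : 0 < t ->
  le2 (surf_int (fvert T F.1) (fun x =>
       jump u F x * conjc (avg_dn T v F x) + conjc (jump v F x) * avg_dn T u F x))
    (t * (jF T u F + jF T v F) + t^-1 * (vF T u F + vF T v F)).
Proof.
move=> t0; rewrite surf_intE.
have pI := posfun_rsurf T F.1.
rewrite (cextD pI); last first.
- by apply: niceM; [apply: nice_conj; exact: nice_jump|exact: nice_avg].
- by apply: nice_sesq; [exact: nice_jump|exact: nice_avg].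
under [X in _ + cext _ X]eq_fun do rewrite mulrC.
have ti0 : 0 < t^-1 by rewrite invr_gt0.
have h1 : le2 _ (t * jF T u F + t^-1 * vF T v F) :=
  cext_young pI (nice_jump u F) (nice_avg T v F) t0.
have h2 : le2 _ (t^-1 * vF T u F + t^-1^-1 * jF T v F) :=
  cext_young pI (nice_avg T u F) (nice_jump v F) ti0.
apply: le2W (le2D h1 h2); rewrite invrK.
exact: young_regroup.
Qed.

Lemma penalty_coef_le F : eta / hF T F <= eta / kappa / hmax T.
Proof.
have e0 : 0 < eta by apply: lt_le_trans eta1.
rewrite -mulrA ler_wpM2l ?(ltW e0)// -invfM lef_pV2 ?posrE; last 2 first.
- by apply: lt_le_trans (reg_hF_ge rT F); exact: mulr_gt0.
- exact: mulr_gt0.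
exact: (reg_hF_ge rT F).
Qed.

Lemma penalty_coef_ge F : 1 / hmax T <= eta / hF T F.
Proof.
have hF0 : 0 < hF T F by apply: lt_le_trans (reg_hF_ge rT F); exact: mulr_gt0.
apply: ler_pM => //; first by rewrite invr_ge0 ltW.
by rewrite lef_pV2 ?posrE// (reg_hF_le rT).
Qed.

Lemma penalty_formE u v F : surf_int (fvert T F.1) (fun x =>
   (eta / hF T F.1)%:C%C * jump u F x * conjc (jump v F x)) =
  (eta / hF T F.1)%:C%C * cext (rsurf T F.1) (fun x => jump u F x * conjc (jump v F x)).
Proof.
rewrite surf_intE -(cextZ (posfun_rsurf T F.1)); last by apply: nice_sesq; exact: nice_jump.
by congr cext; apply/funext => x; rewrite mulrA.
Qed.

Lemma penalty_le2 u v : le2 (\sum_(F | ifaces T F) 'i%C * surf_int (fvert T F.1) (fun x =>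
       (eta / hF T F.1)%:C%C * jump u F x * conjc (jump v F x)))
  (eta / kappa * (Jp T u / hmax T + Jp T v / hmax T)).
Proof.
rewrite -mulrDl mulrA mulrAC -big_split mulr_sumr; apply: le2_sum => F _.
apply: le2_i; rewrite penalty_formE.
have hh : 0 <= eta / hF T F.1.
  by apply: le_trans (penalty_coef_ge F.1); rewrite divr_ge0// ltW.
have h : le2 _ (jF T u F + jF T v F) :=
  cext_young1 (posfun_rsurf T F.1) (nice_jump u F) (nice_jump v F).
apply: le2W (le2Z hh h); apply: ler_wpM2r; last exact: penalty_coef_le.
by rewrite addr_ge0 ?rsurf_sq_ge0.
Qed.

Lemma shifted_mass_le2 (z : C) x : le2 z x ->
  le2 (((k ^+ 2)%:C - 'i * eps%:C)%C * z) ((1 + ceps) * (k ^+ 2 * x)).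
Proof.
move=> h; have [h1 h2] := h; have x0 : 0 <= x by apply: le_trans h1.
rewrite mulrBl -mulrA; apply: (@le2W _ _ (k ^+ 2 * x + eps * x)).
  by rewrite mulrDl mul1r lerD2l mulrA ler_wpM2r.
apply: le2D; first by apply: le2Z => //; exact: sqr_ge0.
by apply/le2N/le2_i/le2Z => //; exact: ltW.
Qed.

Lemma a_h_le2 Omega ca u v : 0 <= ca ->
  hmax T * \sum_(F | ifaces T F) vF T u F <= ca * Gr T u ->
  hmax T * \sum_(F | ifaces T F) vF T v F <= ca * Gr T v ->
  le2 (a_h Omega T eta k eps u v)
    ((4 + ca + eta / kappa + ceps) * (energy Omega T k u + energy Omega T k v)).
Proof.
move=> ca0 vu vv; have e0 : 0 <= eta / kappa by rewrite divr_ge0 ?(ltW k0)// (le_trans ler01).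
have cons : le2 (\sum_(F | ifaces T F) surf_int (fvert T F.1) (fun x =>
       jump u F x * conjc (avg_dn T v F x) + conjc (jump v F x) * avg_dn T u F x))
    ((Jp T u + Jp T v) / hmax T + hmax T * (\sum_(F | ifaces T F) vF T u F
      + \sum_(F | ifaces T F) vF T v F)).
  rewrite [_ / hmax T]mulrC -!big_split !mulr_sumr -big_split; apply: le2_sum => F _.
  (* The weight [1 / h] produces the jumps as they stand in the energy and leaves the averages with
     the factor [h] of [vu] and [vv]. *)
  have hi : 0 < (hmax T)^-1 by rewrite invr_gt0.
  by have := consistency_le2 u v F hi; rewrite invrK.
have bm : le2 ('i%C * k%:C%C * bmass Omega T u v) (k * (Bm Omega T u + Bm Omega T v)).
  by rewrite -mulrA; apply/le2_i/le2Z; [exact: ltW|exact: bmass_le2].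
have form := le2D (le2D (le2D (le2D (grad_form_le2 u v) (le2N cons)) (penalty_le2 u v))
  (le2N (shifted_mass_le2 (mass_le2 u v)))) bm.
apply: le2W form.
have [a1 a2 a3 a4 a0] := energy_parts Omega u kgt0 h0.
have [b1 b2 b3 b4 b0] := energy_parts Omega v kgt0 h0.
rewrite [_ / hmax T]mulrDl [hmax T * (_ + _)]mulrDr.
apply: (form_arith (ltW ceps0) ca0 e0 vu vv a1 a2 a3 a4 b1 b2 b3 b4).
Qed.

Lemma a_h_diagE Omega u : a_h Omega T eta k eps u u =
  (Gr T u)%:C%C - \sum_(F | ifaces T F) surf_int (fvert T F.1) (fun x =>
       jump u F x * conjc (avg_dn T u F x) + conjc (jump u F x) * avg_dn T u F x)
  + 'i%C * (\sum_(F | ifaces T F) eta / hF T F.1 * jF T u F)%:C%C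
  - ((k ^+ 2)%:C - 'i * eps%:C)%C * (Ms T u)%:C%C + 'i%C * k%:C%C * (Bm Omega T u)%:C%C.
Proof.
rewrite /a_h /A_h; congr (_ - _ + _ - _ * _ + _ * _).
- rewrite rmorph_sum; apply: eq_bigr => K _.
  exact: (cext_sum_sq (posfun_rint (reg_bset rT K))).
- rewrite rmorph_sum mulr_sumr; apply: eq_bigr => F _.
  rewrite penalty_formE [in RHS]rmorphM; congr (_ * (_ * _)).
  exact: (cext_sq (posfun_rsurf T F.1)).
- rewrite rmorph_sum; apply: eq_bigr => K _.
  exact: (cext_sq (posfun_rint (reg_bset rT K))).
- rewrite rmorph_sum; apply: eq_bigr => F _; rewrite surf_intE.
  exact: (cext_sq (posfun_rsurf T F)).
Qed.

(** On the diagonal the two consistency terms are complex conjugates of each other. *)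
Lemma consistency_diag_Im u : complex.Im (\sum_(F | ifaces T F) surf_int (fvert T F.1) (fun x =>
   jump u F x * conjc (avg_dn T u F x) + conjc (jump u F x) * avg_dn T u F x)) = 0.
Proof.
rewrite (big_morph _ (@ImD R) (erefl : complex.Im (0 : C) = 0)) big1// => F _.
rewrite surf_intE /= -[RHS](posfun0 (posfun_rsurf T F.1)); congr (rsurf _ _ _).
apply/funext => x; rewrite ImD !ImM !Re_conj !Im_conj; ring.
Qed.

(* The imaginary part controls the jumps, the mass and the boundary term, and then the real
   part controls the gradient. *)
Lemma energy_le_a_h Omega ca u X : 0 < ca ->
  hmax T * \sum_(F | ifaces T F) vF T u F <= ca * Gr T u ->
  le2 (a_h Omega T eta k eps u u) X ->
  energy Omega T k u <= ((4 + 16 * ca) * ceps + 3) * (k ^+ 2 / eps * X).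
Proof.
move=> ca0 vu; rewrite a_h_diagE; set S := \sum_(F | ifaces T F) surf_int _ _.
set JH := \sum_(F | ifaces T F) eta / _ * _; set V := \sum_(F | _) _ in vu.
have SI : complex.Im S = 0 by exact: consistency_diag_Im.
(* This weight makes the averages cost at most half of the gradient: [t^-1 * (V + V)] equals
   [h V / (2 ca)], at most [Gr T u / 2]. *)
pose t := 4 * ca / hmax T; have t0 : 0 < t by rewrite !mulr_gt0 ?invr_gt0.
have [SR _] : le2 S (t * (Jp T u + Jp T u) + t^-1 * (V + V)).
  rewrite -!big_split !mulr_sumr -big_split; apply: le2_sum => F _.
  exact: consistency_le2.
have {}SR : `|complex.Re S| <= 8 * ca * (Jp T u / hmax T) + Gr T u / 2.
  apply: le_trans SR _; have E1 : t * (Jp T u + Jp T u) = 8 * ca * (Jp T u / hmax T).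
    by rewrite /t; move: (Jp T u) ((hmax T)^-1) => J hi; ring.
  have E2 : t^-1 * (V + V) = hmax T * V / ca / 2.
    exact: inv_regroup.
  rewrite E1 E2 lerD2l ler_pM2r ?invr_gt0// ler_pdivrMr// [_ * ca]mulrC.
  exact: vu.
(* Here [1 <= eta] enters, together with face diameters being at most [h]. *)
have JJ : Jp T u / hmax T <= JH.
  rewrite mulr_suml; apply: ler_sum => F _; rewrite mulrC ler_wpM2r ?rsurf_sq_ge0//.
  by have := penalty_coef_ge F.1; rewrite mul1r.
case; rewrite !(ReD, ImD, ReN, ImN, ReM, ImM) SI /=.
rewrite !(mul0r, mulr0, mul1r, mulr1, oppr0, addr0, add0r, subr0, sub0r, opprK, mulNr).
have M0 := Ms_ge0 T u; have B0 : 0 <= k * Bm Omega T u by rewrite mulr_ge0 ?Bm_ge0// ltW.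
have G0 := Gr_ge0 T u; have J0 : 0 <= Jp T u / hmax T by rewrite divr_ge0 ?Jp_ge0// ltW.
rewrite /energy.
move: (Gr T u) (Jp T u / hmax T) (Ms T u) (k * Bm Omega T u) (complex.Re S) JH SR JJ M0 B0 G0 J0.
move: eps0 epsk ceps0 ca0; clear.
move: (k ^+ 2) eps ceps ca => k2 e c a e0 kc c0 a0 G J M B s JH SR JJ M0 B0 G0 J0 hR hI.
exact: (coercive_arith e0 kc c0 a0 SR JJ M0 B0 J0 hR hI).
Qed.

End FormBounds.

(** * Reconstruction energy versus the piecewise constant norm *)

Section DiscreteNorm.
Variables (R : realType) (d m : nat) (kappa eta chk : R).
Hypotheses (d0 : (0 < d)%N) (k0 : 0 < kappa) (k1 : kappa <= 1).
Hypotheses (eta1 : 1 <= eta) (chk0 : 0 < chk).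
Local Notation C := R[i].

Lemma sq_add3_le (a b c : C) : sq (a + b + c) <= 4 * sq b + 4 * (sq a + sq c).
Proof.
have h1 := sqD_le (a + b) c; have h2 := sqD_le a b; have := sq_ge0 c.
by move: (sq (a + b + c)) (sq (a + b)) (sq a) (sq b) (sq c) h1 h2 => *; lra.
Qed.

Section Pw0.
Variables (N : nat) (T : mesh R d N) (v : 'I_N -> C).

Lemma jF_pw0 F : jF T (pw0 d v) F = sq (v F.1.1 - v F.2.1) * rsurf T F.1 (fun=> 1).
Proof.
rewrite -(posfunZ (posfun_rsurf T F.1)); last exact: lbm_cst.
by congr (rsurf _ _ _); apply/funext => x; rewrite /jump /pw0 !pevalC mulr1.
Qed.

Lemma mK_pw0 K : bset (elt T K) ->
  mK T (pw0 d v) K = sq (v K) * rint (elt T K) (fun=> 1).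
Proof.
move=> bK; rewrite -(posfunZ (posfun_rint bK)); last exact: lbm_cst.
by congr (rint _ _); apply/funext => x; rewrite /pw0 pevalC mulr1.
Qed.

Definition p0norm (Omega : set 'rV[R]_d.+1) (k : R) : R :=
  eta * (Jp T (pw0 d v) / hmax T) + k ^+ 2 * Ms T (pw0 d v) + k * Bm Omega T (pw0 d v).

End Pw0.

(** The jump of [u] is that of [w] plus the errors on the two sides. It is used in both directions,
    with a piecewise constant function in the place of [u] or of [w]. *)
Lemma jF_compare N (T : mesh R d N) b (u w : bpoly R d N) F B1 B2 :
  regular T kappa b -> 0 <= B1 -> 0 <= B2 ->
  (forall x, face T F.1 x -> sq (peval (u F.1.1) x - peval (w F.1.1) x) <= B1) ->
  (forall x, face T F.1 x -> sq (peval (u F.2.1) x - peval (w F.2.1) x) <= B2) ->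
  jF T u F <= 4 * jF T w F + 4 * (B1 + B2) * (kappa^-1 * hmax T ^+ d).
Proof.
move=> rT B10 B20 h1 h2; have pI := posfun_rsurf T F.1.
have B0 : 0 <= 4 * (B1 + B2) by rewrite mulr_ge0// addr_ge0.
have lj := lbm_sq (nice_jump w F).
apply: le_trans (_ : rsurf T F.1 (fun x => 4 * sq (jump w F x) + 4 * (B1 + B2)) <= _).
  apply: (posfun_mono pI) => [||x Fx].
  - exact: lbm_sq (nice_jump u F).
  - by apply: lbmD; [exact: lbmZ|exact: lbm_cst].
  - rewrite (_ : jump u F x = (peval (u F.1.1) x - peval (w F.1.1) x) + jump w F x
      + (- (peval (u F.2.1) x - peval (w F.2.1) x))).
      apply: le_trans (sq_add3_le _ _ _) _; rewrite sqN.
      by rewrite lerD2l ler_wpM2l// lerD ?h1 ?h2.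
    rewrite /jump; move: (peval _ _) (peval _ _) (peval _ _) (peval _ _) => a e f g; ring.
rewrite (posfun_lin pI 4 lj (lbm_cst _ _)) lerD2l.
have l1 := lbm_cst d.+1 (1 : R).
rewrite (_ : (fun=> _) = fun x => 4 * (B1 + B2) * 1); last by apply/funext => x; rewrite mulr1.
rewrite (posfunZ pI _ l1) ler_wpM2l//.
exact: (face_vol_le F.1 rT).
Qed.

Lemma bF_compare N (T : mesh R d N) b (u w : bpoly R d N) F B :
  regular T kappa b -> 0 <= B ->
  (forall x, face T F x -> sq (peval (u F.1) x - peval (w F.1) x) <= B) ->
  bF T u F <= 2 * bF T w F + 2 * B * (kappa^-1 * hmax T ^+ d).
Proof.
move=> rT B0 h; have pI := posfun_rsurf T F.
have lw := lbm_sq (nice_peval (w F.1)).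
apply: le_trans (_ : rsurf T F (fun x => 2 * sq (peval (w F.1) x) + 2 * B) <= _).
  apply: (posfun_mono pI) => [||x Fx].
  - exact: lbm_sq (nice_peval (u F.1)).
  - by apply: lbmD; [exact: lbmZ|exact: lbm_cst].
  - rewrite -[peval (u F.1) x](subrK (peval (w F.1) x)) addrC.
    apply: le_trans (sqD_le _ _) _; rewrite lerD2l ler_wpM2l//.
    exact: h.
rewrite (posfun_lin pI 2 lw (lbm_cst _ _)) lerD2l.
have l1 := lbm_cst d.+1 (1 : R).
rewrite (_ : (fun=> _) = fun x => 2 * B * 1); last by apply/funext => x; rewrite mulr1.
rewrite (posfunZ pI _ l1) ler_wpM2l ?mulr_ge0//.
exact: (face_vol_le F rT).
Qed.

Lemma mK_compare N (T : mesh R d N) b (u w : bpoly R d N) K B :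
  regular T kappa b -> 0 <= B ->
  (forall x, elt T K x -> sq (peval (u K) x - peval (w K) x) <= B) ->
  mK T u K <= 2 * mK T w K + 2 * B * (2 ^+ d.+1 * (hmax T * hmax T ^+ d)).
Proof.
move=> rT B0 h; have pI := posfun_rint (reg_bset rT K).
have lw := lbm_sq (nice_peval (w K)).
apply: le_trans (_ : rint (elt T K) (fun x => 2 * sq (peval (w K) x) + 2 * B) <= _).
  apply: (posfun_mono pI) => [||x Fx].
  - exact: lbm_sq (nice_peval (u K)).
  - by apply: lbmD; [exact: lbmZ|exact: lbm_cst].
  - rewrite -[peval (u K) x](subrK (peval (w K) x)) addrC.
    apply: le_trans (sqD_le _ _) _; rewrite lerD2l ler_wpM2l//.
    exact: h.
rewrite (posfun_lin pI 2 lw (lbm_cst _ _)) lerD2l.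
have l1 := lbm_cst d.+1 (1 : R).
rewrite (_ : (fun=> _) = fun x => 2 * B * 1); last by apply/funext => x; rewrite mulr1.
rewrite (posfunZ pI _ l1) ler_wpM2l ?mulr_ge0//.
exact: (elt_vol_le K rT).
Qed.

Lemma elt_bigbox N (T : mesh R d N) b K x : regular T kappa b -> elt T K x ->
  bigbox (b K) (hmax T) x.
Proof. by move=> rT Kx; apply: (reg_hull rT); exact: open_simplex_sub_hull. Qed.

Let P : R := 2 * d.+2%:R ^+ 2 * pack d kappa 2.

Let P0 : 0 < P.
Proof. by rewrite /P !mulr_gt0 ?exprn_gt0 ?divr_gt0 ?mulr_gt0. Qed.

Lemma jump_arith (c k h hd g g' : R) : 0 < h -> 0 < hd -> 0 < k ->
  4 * (c * (h / hd * g) + c * (h / hd * g')) * (k^-1 * hd) = 4 * c / k * h * (g + g').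
Proof. by move=> h0 hd0 k_0; field; rewrite !gt_eqF. Qed.

Lemma bdry_arith (c k h hd g : R) : 0 < h -> 0 < hd -> 0 < k ->
  2 * (c * (h / hd * g)) * (k^-1 * hd) = 2 * c / k * h * g.
Proof. by move=> h0 hd0 k_0; field; rewrite !gt_eqF. Qed.

Lemma grad_arith (n c e h hd E : R) : 0 < h ->
  n * (c * E / h ^+ 2) * (e * (h * hd)) = n * c * e * (hd / h) * E.
Proof. by move=> h0; field; rewrite gt_eqF. Qed.

Lemma p0_arith (c1 c2 c3 k h k2 G J J0 M M0 B B0 : R) : 0 < h -> 0 <= c1 ->
  0 <= c2 -> 0 <= c3 -> 0 < k -> 0 <= G -> 0 <= J -> 0 <= M -> 0 <= B -> 0 <= k2 -> h * k <= chk ->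
  J0 <= 4 * J + c1 * h * G -> M0 <= c2 * M -> B0 <= 2 * B + c3 * h * G ->
  eta * (J0 / h) + k2 * M0 + k * B0 <=
  (eta * (4 + c1) + c2 + 2 + c3 * chk) * (G + J / h + k2 * M + k * B).
Proof.
move=> h0 c10 c20 c30 k_0 G0 J0_ M0_ B0_ k20 hk hJ hM hB.
have eta0 : 0 <= eta by apply: le_trans eta1.
have j0 : 0 <= J / h by rewrite divr_ge0// ltW.
have m0 : 0 <= k2 * M by rewrite mulr_ge0.
have b0 : 0 <= k * B by rewrite mulr_ge0// ltW.
set E := G + J / h + k2 * M + k * B.
have GE : G <= E by rewrite /E; lra.
have JE : J / h <= E by rewrite /E; lra.
have ME : k2 * M <= E by rewrite /E; lra.
have BE : k * B <= E by rewrite /E; lra.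
have E0 : 0 <= E by apply: le_trans GE.
clearbody E.
have t1 : eta * (J0 / h) <= eta * (4 + c1) * E.
  rewrite -mulrA ler_wpM2l//; apply: le_trans (_ : 4 * (J / h) + c1 * G <= _).
    by rewrite ler_pdivrMr// [leRHS]mulrDl -!mulrA mulVf ?gt_eqF// mulr1 [G * h]mulrC mulrA.
  by rewrite [leRHS]mulrDl lerD// ler_wpM2l.
have t2 : k2 * M0 <= c2 * E.
  apply: le_trans (ler_wpM2l k20 hM) _; rewrite mulrCA.
  by rewrite ler_wpM2l.
have t3 : k * B0 <= (2 + c3 * chk) * E.
  apply: le_trans (ler_wpM2l (ltW k_0) hB) _; rewrite [leLHS]mulrDr [leRHS]mulrDl lerD//.
    by rewrite mulrCA ler_wpM2l.
  rewrite (_ : k * (c3 * h * G) = c3 * ((h * k) * G)); last by ring.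
  rewrite -[leRHS]mulrA ler_wpM2l//; apply: ler_pM => //.
  by rewrite mulr_ge0// ltW.
by move: (eta * (J0 / h)) (k2 * M0) (k * B0) (eta * (4 + c1)) (c3 * chk) t1 t2 t3 => *; lra.
Qed.

(** Freezing [u] at one value per element changes the squared face terms by order [h] times the
    squared gradient. This cancels the division by [h] in the jump term; in the boundary term the
    factor [k] is absorbed by [h k <= chk]. *)
Lemma p0norm_le_energy : exists2 c : R, 0 < c &
  forall N (Omega : set 'rV[R]_d.+1) (T : mesh R d N) b u v k, regular T kappa b ->
  (forall K L, K != L -> elt T K `&` elt T L = set0) ->
  0 < k -> hmax T * k <= chk -> (forall K, deg_le m (u K)) ->
  (forall K, exists2 x, elt T K x & peval (u K) x = v K) ->
  p0norm T v Omega k <= c * energy Omega T k u.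
Proof.
have [c c0 H] := elt_poincare d m k0 k1.
have [c' c'0 H'] := elt_trace d m k0 k1.
pose c1 := 4 * c / kappa * P; pose c2 := c' * 2 ^+ d.+1; pose c3 := 2 * c / kappa * d.+2%:R.
have c10 : 0 < c1 := mulr_gt0 (divr_gt0 (mulr_gt0 (ltr0Sn _ 3) c0) k0) P0.
have c20 : 0 < c2 := mulr_gt0 c'0 (exprn_gt0 _ (ltr0Sn _ 1)).
have c30 : 0 < c3 := mulr_gt0 (divr_gt0 (mulr_gt0 (ltr0Sn _ 1) c0) k0) (ltr0Sn _ _).
exists (eta * (4 + c1) + c2 + 2 + c3 * chk).
  have : 0 < eta * (4 + c1) by rewrite mulr_gt0 ?addr_gt0// (lt_le_trans ltr01).
  have : 0 < c3 * chk by rewrite mulr_gt0.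
  by move: (eta * _) (c3 * chk) => A B; lra.
move=> N Omega T b u v k rT dis kgt0 hk du uv; have h0 := reg_h rT.
have hd0 : 0 < hmax T ^+ d by rewrite exprn_gt0.
have hh0 : 0 <= hmax T / hmax T ^+ d by rewrite divr_ge0 ?ltW.
pose w := pw0 d v.
have near_v K x : bigbox (b K) (hmax T) x ->
    sq (peval (w K) x - peval (u K) x) <= c * (hmax T / hmax T ^+ d * gK T u K).
  move=> bx; have [y Ky uy] := uv K; rewrite /w /pw0 pevalC -uy.
  exact: H rT (du K) (elt_bigbox rT Ky) bx.
have cg0 K : 0 <= c * (hmax T / hmax T ^+ d * gK T u K).
  by rewrite mulr_ge0 ?(ltW c0)// mulr_ge0// gK_ge0.
apply: p0_arith => //; try exact: ltW; try exact: sqr_ge0.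
- exact: Gr_ge0.
- exact: Jp_ge0.
- exact: Ms_ge0.
- exact: Bm_ge0.
- apply: le_trans (_ : \sum_(F | ifaces T F) (4 * jF T u F
      + 4 * c / kappa * hmax T * (gK T u F.1.1 + gK T u F.2.1)) <= _).
    apply: ler_sum => F iF; rewrite -(jump_arith _ _ _ h0 hd0 k0).
    by apply: (jF_compare rT) => // x Fx; have [b1 b2] := iface_bigbox rT iF Fx; exact: near_v.
  rewrite big_split /= -!mulr_sumr -/(Jp T u) lerD2l /c1.
  have s := sum_ifaces_le k0 k1 rT dis (fun K => gK_ge0 T u K).
  have cc : 0 <= 4 * c / kappa * hmax T by rewrite ltW// mulr_gt0 ?divr_gt0 ?mulr_gt0.
  apply: le_trans (ler_wpM2l cc s) _; rewrite -/P -/(Gr T u).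
  by rewrite le_eqVlt; apply/orP; left; apply/eqP; rewrite mulrA; congr (_ * _); exact: mulrAC.
(* As [v K] is a value of [u], the pointwise bound compares the two masses directly, without the
   gradient. *)
- rewrite /Ms mulr_sumr; apply: ler_sum => K _; rewrite (mK_pw0 _ (reg_bset rT K)).
  have [y Ky <-] := uv K.
  apply: le_trans (ler_pM (sq_ge0 _) _ (H' N T b K _ y rT (du K) (elt_bigbox rT Ky)) (elt_vol_le K rT)) _.
    by apply: rint_ge0.
  rewrite -/(mK T u K) /c2.
  move: (mK T u K) (2 ^+ d.+1) (hmax T * hmax T ^+ d) (mulr_gt0 h0 hd0) => M e hhd hhd0.
  by rewrite le_eqVlt; apply/orP; left; apply/eqP; field; rewrite gt_eqF.
- apply: le_trans (_ : \sum_(F | bfaces Omega T F) (2 * bF T u F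
      + 2 * c / kappa * hmax T * gK T u F.1) <= _).
    apply: ler_sum => F iF; rewrite -(bdry_arith _ _ h0 hd0 k0).
    by apply: (bF_compare rT) => // x Fx; apply: near_v; exact: (bface_bigbox rT Fx).
  rewrite big_split /= -!mulr_sumr -/(Bm Omega T u) lerD2l /c3.
  have s := sum_bfaces_le T Omega (fun K => gK_ge0 T u K).
  have cc : 0 <= 2 * c / kappa * hmax T by rewrite ltW// mulr_gt0 ?divr_gt0 ?mulr_gt0.
  apply: le_trans (ler_wpM2l cc s) _; rewrite -/(Gr T u).
  by rewrite le_eqVlt; apply/orP; left; apply/eqP; rewrite mulrA; congr (_ * _); exact: mulrAC.
Qed.

Lemma spread_arith (sp kr hd X L2 D J : R) : 0 < kr -> 0 < hd -> 0 <= sp -> 0 <= L2 ->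
  D <= sp * X -> kr * hd * X <= J -> hd * (4 * L2 * D) <= 4 * sp / kr * L2 * J.
Proof.
move=> kr0 hd0 sp0 L0 DX XJ.
have e1 : 0 <= 4 * L2 * hd by rewrite !mulr_ge0// ltW.
apply: le_trans (_ : 4 * L2 * hd * (sp * X) <= _).
  by rewrite [leLHS](_ : _ = 4 * L2 * hd * D) ?ler_wpM2l//; ring.
have e2 : 0 <= 4 * sp / kr * L2 by rewrite !mulr_ge0// invr_ge0 ltW.
apply: le_trans (ler_wpM2l e2 XJ); rewrite le_eqVlt; apply/orP; left; apply/eqP.
by field; rewrite gt_eqF.
Qed.

Lemma recon_arith (a1 a2 a3 a4 a5 h hd k L2 S G J Jw M Mw B Bw : R) :
  0 < h -> 0 < hd -> 0 < k -> h * k <= chk -> 1 <= L2 -> 0 <= S ->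
  0 <= a1 -> 0 <= a2 -> 0 <= a3 -> 0 <= a4 -> 0 <= a5 ->
  0 <= Jw -> 0 <= Mw -> 0 <= Bw ->
  G <= a1 * (hd / h) * S -> J <= 4 * Jw + a2 * hd * S ->
  M <= 2 * Mw + a3 * (h * hd) * S -> B <= 2 * Bw + a4 * hd * S ->
  hd * S <= a5 * L2 * Jw ->
  G + J / h + k ^+ 2 * M + k * B <=
  ((a1 + a2 + a3 * chk ^+ 2 + a4 * chk) * a5 + 4) * L2 *
    (eta * (Jw / h) + k ^+ 2 * Mw + k * Bw).
Proof.
move=> h0 hd0 kk0 hk L1 S0 a10 a20 a30 a40 a50 Jw0 Mw0 Bw0 hG hJ hM hB hS.
have hi0 : 0 <= h^-1 by rewrite invr_ge0 ltW.
(* All errors are measured by [Y]: those of the gradient and of the jumps by [Y] itself, those of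
   the mass and of the boundary by [(h k)^2 Y] and [h k Y]. *)
pose Y := hd / h * S; pose y := Jw / h.
have Y0 : 0 <= Y := mulr_ge0 (divr_ge0 (ltW hd0) (ltW h0)) S0.
have y0 : 0 <= y by rewrite mulr_ge0.
have hY : Y <= a5 * L2 * y.
  by rewrite /Y /y mulrA mulrAC ler_wpM2r.
have kh0 : 0 <= h * k := mulr_ge0 (ltW h0) (ltW kk0).
have G1 : G <= a1 * Y by rewrite /Y mulrA.
have J1 : J / h <= 4 * y + a2 * Y.
  apply: le_trans (ler_wpM2r hi0 hJ) _; rewrite le_eqVlt; apply/orP; left; apply/eqP.
  by rewrite /y /Y; ring.
have M1 : k ^+ 2 * M <= 2 * (k ^+ 2 * Mw) + a3 * chk ^+ 2 * Y.
  apply: le_trans (ler_wpM2l (sqr_ge0 k) hM) _.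
  rewrite [leLHS](_ : _ = 2 * (k ^+ 2 * Mw) + a3 * (h * k) ^+ 2 * Y).
    by rewrite lerD2l ler_wpM2r// ler_wpM2l// lerXn2r// nnegrE ?kh0 ?(ltW chk0).
  by rewrite /Y; field; rewrite gt_eqF.
have B1 : k * B <= 2 * (k * Bw) + a4 * chk * Y.
  apply: le_trans (ler_wpM2l (ltW kk0) hB) _.
  rewrite [leLHS](_ : _ = 2 * (k * Bw) + a4 * (h * k) * Y).
    by rewrite lerD2l ler_wpM2r// ler_wpM2l.
  by rewrite /Y; field; rewrite gt_eqF.
have m0 : 0 <= k ^+ 2 * Mw by rewrite mulr_ge0 ?sqr_ge0.
have b0 : 0 <= k * Bw := mulr_ge0 (ltW kk0) Bw0.
pose A := a1 + a2 + a3 * chk ^+ 2 + a4 * chk.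
have A0 : 0 <= A.
  have : 0 <= a3 * chk ^+ 2 by rewrite mulr_ge0 ?sqr_ge0.
  have : 0 <= a4 * chk := mulr_ge0 a40 (ltW chk0).
  by rewrite /A; move: (a3 * _) (a4 * _) => t t'; lra.
have AY : A * Y <= A * a5 * L2 * y by rewrite -!mulrA ler_wpM2l// mulrA.
have sum1 : G + J / h + k ^+ 2 * M + k * B <=
    A * Y + (4 * y + 2 * (k ^+ 2 * Mw) + 2 * (k * Bw)).
  rewrite /A !mulrDl.
  move: (J / h) (k ^+ 2 * M) (k * B) (k ^+ 2 * Mw) (k * Bw) (a1 * Y) (a2 * Y)
    (a3 * chk ^+ 2 * Y) (a4 * chk * Y) G1 J1 M1 B1 => *; lra.
apply: le_trans sum1 _; rewrite -/A -/y.
move: A A0 AY (k ^+ 2 * Mw) (k * Bw) m0 b0 => A A0 AY m' b' m0 b0.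
have Ey : y <= eta * y by rewrite ler_peMl.
pose Q := y + m' + b'.
have Q0 : 0 <= Q by rewrite /Q; lra.
apply: le_trans (_ : (A * a5 + 4) * L2 * Q <= _).
  have yQ : y <= Q by rewrite /Q; lra.
  have c0 : 0 <= A * a5 * L2 by rewrite !mulr_ge0// (le_trans ler01).
  have h1 := ler_wpM2l c0 yQ.
  have h2 : Q <= L2 * Q by rewrite ler_peMl.
  rewrite (_ : (A * a5 + 4) * L2 * Q = A * a5 * L2 * Q + 4 * (L2 * Q)); last first.
    by rewrite -mulrA [LHS]mulrDl !mulrA.
  move: (A * Y) (A * a5 * L2 * y) (A * a5 * L2 * Q) (L2 * Q) AY h1 h2 => q1 q2 q3 q4 AY h1 h2.
  by move: h2; rewrite /Q; lra.
rewrite ler_wpM2l//; last by rewrite /Q; lra.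
by rewrite mulr_ge0 ?addr_ge0 ?mulr_ge0// (le_trans ler01).
Qed.

(** Each part of the energy is compared with that of the piecewise constant function, up to the
    errors [e K] of the fit, whose sum is at most [Lambda_m^2] times the jumps. The terms of the
    piecewise constant function itself also fit under this factor, because [1 <= Lambda_m]. *)
Lemma recon_energy_le thr : exists2 c : R, 0 < c &
  forall N (Omega : set 'rV[R]_d.+1) (T : mesh R d N) b xc v k, regular T kappa b ->
  (forall K L, K != L -> elt T K `&` elt T L = set0) -> (0 < N)%N ->
  unisolvent T xc m thr -> 0 < k -> hmax T * k <= chk ->
  energy Omega T k (lin_recon T xc m thr v) <=
    c * Lambda_m T xc m thr ^+ 2 * p0norm T v Omega k.
Proof.
have [c c0 H] := elt_inverse d m k0 k1.
pose e2 : R := 2 ^+ d.+1; have e20 : 0 < e2 := exprn_gt0 _ (ltr0Sn _ 1).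
pose a1 := d.+1%:R * c * e2; pose a2 := 4 * c / kappa * P.
pose a3 := 2 * c * e2; pose a4 := 2 * c / kappa * d.+2%:R.
have rv0 := ref_vol_gt0 R d0.
pose a5 := 4 * spread d kappa thr / (kappa * ref_vol R d).
have a10 : 0 <= a1 := ltW (mulr_gt0 (mulr_gt0 (ltr0Sn _ _) c0) e20).
have a20 : 0 <= a2 := ltW (mulr_gt0 (divr_gt0 (mulr_gt0 (ltr0Sn _ 3) c0) k0) P0).
have a30 : 0 <= a3 := ltW (mulr_gt0 (mulr_gt0 (ltr0Sn _ _) c0) e20).
have a40 : 0 <= a4 := ltW (mulr_gt0 (divr_gt0 (mulr_gt0 (ltr0Sn _ 1) c0) k0) (ltr0Sn _ _)).
have sp0 := spread_ge0 d k0 thr.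
have a50 : 0 <= a5 := divr_ge0 (mulr_ge0 (ler0n _ 4) sp0) (ltW (mulr_gt0 k0 rv0)).
exists ((a1 + a2 + a3 * chk ^+ 2 + a4 * chk) * a5 + 4).
  have : 0 <= a3 * chk ^+ 2 := mulr_ge0 a30 (sqr_ge0 _).
  have : 0 <= a4 * chk := mulr_ge0 a40 (ltW chk0).
  move: (a3 * _) (a4 * _) => t t' t0 t0'.
  by apply: ltr_wpDl => //; apply: mulr_ge0 => //; rewrite !addr_ge0.
move=> N Omega T b xc v k rT dis N0 uT kgt0 hk; have h0 := reg_h rT.
have hd0 : 0 < hmax T ^+ d by rewrite exprn_gt0.
pose u := lin_recon T xc m thr v; pose w := pw0 d v.
pose Lam := Lambda_m T xc m thr.
pose D K := \sum_(L in Defs.patch T thr K) sq (v K - v L).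
have D0 K : 0 <= D K by apply: sumr_ge0 => L _; exact: sq_ge0.
pose e K := 4 * Lam ^+ 2 * D K.
have e0 K : 0 <= e K by rewrite mulr_ge0// mulr_ge0 ?sqr_ge0.
have du K : deg_le m (u K) by case: (lin_recon_is_fit T xc m thr v K).
have err K x : elt T K x -> sq (peval (u K) x - v K) <= e K.
  move=> Kx; apply: (fit_error uT (reg_bset rT) (lin_recon_is_fit T xc m thr v K)).
  by exists K => //; exact: patch_refl.
have errb K x : bigbox (b K) (hmax T) x -> sq (peval (u K) x - peval (w K) x) <= c * e K.
  move=> bx; have [h _] := H N T b K (u K) (v K) (e K) x rT (du K) (err K) bx.
  by rewrite /w /pw0 pevalC.
have grb K x : elt T K x -> \sum_l sq (peval (pdiff l (u K)) x) <= d.+1%:R * (c * e K / hmax T ^+ 2).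
  move=> Kx; have [_ h] := H N T b K (u K) (v K) (e K) x rT (du K) (err K) (elt_bigbox rT Kx).
  by apply: le_trans (ler_sum _ (fun l _ => h l)) _; rewrite sumr_const card_ord mulr_natl.
have ce0 K : 0 <= c * e K by rewrite mulr_ge0// ltW.
have L1 : 1 <= Lam ^+ 2.
  by rewrite exprn_ege1//; case: (Lambda_m_ge T xc m thr (Ordinal N0)).
pose S := \sum_K e K; have S0 : 0 <= S by apply: sumr_ge0.
apply: (recon_arith h0 hd0 kgt0 hk L1 S0 a10 a20 a30 a40 a50).
- exact: Jp_ge0.
- exact: Ms_ge0.
- exact: Bm_ge0.
- rewrite /Gr /S mulr_sumr; apply: ler_sum => K _.
  apply: le_trans (posfun_sup (posfun_rint (reg_bset rT K)) (lbm_grad (u K)) (grb K)) _.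
  have q0 : 0 <= d.+1%:R * (c * e K / hmax T ^+ 2) by rewrite mulr_ge0// divr_ge0// sqr_ge0.
  apply: le_trans (ler_wpM2l q0 (elt_vol_le K rT)) _.
  by rewrite le_eqVlt; apply/orP; left; apply/eqP; exact: grad_arith.
- apply: le_trans (_ : \sum_(F | ifaces T F) (4 * jF T w F
      + 4 * c / kappa * hmax T ^+ d * (e F.1.1 + e F.2.1)) <= _).
    apply: ler_sum => F iF.
    apply: le_trans (@jF_compare N T b u w F (c * e F.1.1) (c * e F.2.1) rT _ _ _ _) _ => //.
    + by move=> x Fx; have [b1 _] := iface_bigbox rT iF Fx; exact: errb.
    + by move=> x Fx; have [_ b2] := iface_bigbox rT iF Fx; exact: errb.
    + rewrite lerD2l; move: (_ ^+ d) (e _) (e _) => hd E E'.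
      by rewrite le_eqVlt; apply/orP; left; apply/eqP; field; rewrite gt_eqF.
  rewrite big_split /= -!mulr_sumr -/(Jp T w) lerD2l /a2.
  have s := sum_ifaces_le k0 k1 rT dis e0.
  have cc : 0 <= 4 * c / kappa * hmax T ^+ d.
    exact: ltW (mulr_gt0 (divr_gt0 (mulr_gt0 (ltr0Sn _ 3) c0) k0) hd0).
  apply: le_trans (ler_wpM2l cc s) _; rewrite -/P -/S.
  by rewrite le_eqVlt; apply/orP; left; apply/eqP; rewrite mulrA; congr (_ * _); exact: mulrAC.
- rewrite /Ms /S !mulr_sumr -big_split /=; apply: ler_sum => K _.
  apply: le_trans (@mK_compare N T b u w K (c * e K) rT (ce0 K) _) _.
    by move=> x Kx; apply: errb; exact: (elt_bigbox rT Kx).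
  rewrite -/e2 /a3 lerD2l; move: (_ * _ ^+ d) (e K) => hhd E.
  by rewrite le_eqVlt; apply/orP; left; apply/eqP; ring.
- apply: le_trans (_ : \sum_(F | bfaces Omega T F) (2 * bF T w F
      + 2 * c / kappa * hmax T ^+ d * e F.1) <= _).
    apply: ler_sum => F iF.
    apply: le_trans (@bF_compare N T b u w F (c * e F.1) rT _ _) _ => //.
    + by move=> x Fx; apply: errb; exact: (bface_bigbox rT Fx).
    + rewrite lerD2l; move: (_ ^+ d) (e _) => hd E.
      by rewrite le_eqVlt; apply/orP; left; apply/eqP; field; rewrite gt_eqF.
  rewrite big_split /= -[X in X + _ <= _]mulr_sumr -[X in _ + X <= _]mulr_sumr -/(Bm Omega T w) lerD2l /a4.
  have s := sum_bfaces_le T Omega e0.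
  have cc : 0 <= 2 * c / kappa * hmax T ^+ d.
    exact: ltW (mulr_gt0 (divr_gt0 (mulr_gt0 (ltr0Sn _ 1) c0) k0) hd0).
  apply: le_trans (ler_wpM2l cc s) _; rewrite -/S.
  by rewrite le_eqVlt; apply/orP; left; apply/eqP; rewrite mulrA; congr (_ * _); exact: mulrAC.
(* The jump of a piecewise constant function is constant on a face, whose area is at least of order
   [h ^+ d]; this turns differences of values into the jump term. *)
- pose X := \sum_(F | ifaces T F) sq (v F.1.1 - v F.2.1).
  have DX : \sum_K D K <= spread d kappa thr * X := patch_spread_le k0 k1 rT dis thr v.
  have XJ : kappa * ref_vol R d * hmax T ^+ d * X <= Jp T w.
    rewrite mulr_sumr; apply: ler_sum => F _; rewrite jF_pw0 mulrC ler_wpM2l ?sq_ge0//.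
    exact: (face_vol_ge d0 F.1 rT).
  have -> : S = 4 * Lam ^+ 2 * \sum_K D K by rewrite mulr_sumr.
  by apply: (spread_arith _ hd0 sp0 _ DX XJ); [exact: mulr_gt0|exact: sqr_ge0].
Qed.

End DiscreteNorm.

(** * Matrices *)

Section Sesquilinear.
Variable R : realType.
Local Notation C := R[i].

Definition comb d N (b : 'I_N -> bpoly R d N) (v : 'I_N -> C) : bpoly R d N :=
  fun K => \sum_L v L *: b L K.

(** Sesquilinearity on finite combinations of a family, in the summation order of a matrix
    product. *)
Definition sesq d N (B : bpoly R d N -> bpoly R d N -> C) : Prop :=
  forall b v z, B (comb b v) (comb b z) =
    \sum_L (\sum_K conjc (z K) * B (b L) (b K)) * v L.

Definition linfun_at d N (f : bpoly R d N -> 'rV[R]_d.+1 -> C) : Prop :=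
  (forall u, nice (f u)) /\
  forall b v x, f (comb b v) x = \sum_L v L * f (b L) x.

Section Rules.
Variables (d N : nat).
Implicit Types B : bpoly R d N -> bpoly R d N -> C.

Lemma sesq_ext B B' : (forall u w, B u w = B' u w) -> sesq B' -> sesq B.
Proof.
by move=> BB sB b v z; rewrite BB sB; apply: eq_bigr => L _; congr (_ * _);
  apply: eq_bigr => K _; rewrite BB.
Qed.

Lemma sesqD B B' : sesq B -> sesq B' -> sesq (fun u w => B u w + B' u w).
Proof.
move=> sB sB' b v z; rewrite sB sB' -big_split; apply: eq_bigr => L _ /=.
rewrite -mulrDl -big_split; congr (_ * _); apply: eq_bigr => K _ /=.
by rewrite mulrDr.
Qed.

Lemma sesqZ c B : sesq B -> sesq (fun u w => c * B u w).
Proof.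
move=> sB b v z; rewrite sB mulr_sumr; apply: eq_bigr => L _.
rewrite mulrA mulr_sumr; congr (_ * _); apply: eq_bigr => K _.
by rewrite mulrCA.
Qed.

Lemma sesq_sum (I : Type) (r : seq I) (P : pred I)
    (B : I -> bpoly R d N -> bpoly R d N -> C) :
  (forall i, sesq (B i)) -> sesq (fun u w => \sum_(i <- r | P i) B i u w).
Proof.
move=> sB b v z; elim: r => [|i r IH].
  rewrite big_nil big1// => L _; rewrite big1 ?mul0r// => K _.
  by rewrite big_nil mulr0.
rewrite big_cons IH; case: ifPn => Pi; last first.
  apply: eq_bigr => L _; congr (_ * _); apply: eq_bigr => K _.
  by rewrite big_cons (negPf Pi).
rewrite sB -big_split; apply: eq_bigr => L _ /=.
rewrite -mulrDl -big_split; congr (_ * _); apply: eq_bigr => K _ /=.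
by rewrite big_cons Pi mulrDr.
Qed.

Lemma sesq_cext (D : set 'rV[R]_d.+1) I (f g : bpoly R d N -> 'rV[R]_d.+1 -> C) :
  posfun D I -> linfun_at f -> linfun_at g ->
  sesq (fun u w => cext I (fun x => f u x * conjc (g w x))).
Proof.
move=> pI [nf lf] [ng lg] b v z.
transitivity (cext I (fun x => \sum_L \sum_K v L * (conjc (z K) * (f (b L) x * conjc (g (b K) x))))).
  congr (cext _ _); apply/funext => x; rewrite lf lg rmorph_sum mulr_suml.
  apply: eq_bigr => L _; rewrite mulr_sumr; apply: eq_bigr => K _.
  by rewrite rmorphM -mulrA; congr (_ * _); rewrite mulrCA.
have nn L K : nice (fun x => f (b L) x * conjc (g (b K) x)) by exact: nice_sesq.
have nz L K : nice (fun x => conjc (z K) * (f (b L) x * conjc (g (b K) x))).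
  by apply: niceM => //; exact: nice_cst.
have nv L K : nice (fun x => v L * (conjc (z K) * (f (b L) x * conjc (g (b K) x)))).
  by apply: niceM => //; exact: nice_cst.
rewrite (cext_sum pI) => [|L]; last exact: nice_sum.
apply: eq_bigr => L _; rewrite (cext_sum pI)// mulr_suml; apply: eq_bigr => K _.
by rewrite (cextZ pI)// (cextZ pI)// mulrC.
Qed.

Lemma linfun_peval K : linfun_at (fun (u : bpoly R d N) x => peval (u K) x).
Proof. by split=> [u|b v x]; [exact: nice_peval|rewrite peval_sumZ]. Qed.

Lemma pdiff_sumZ k l (c : 'I_k -> C) (q : 'I_k -> cpoly R d.+1) :
  pdiff l (\sum_i c i *: q i) = \sum_i c i *: pdiff l (q i).
Proof.
by rewrite /pdiff linear_sum /=; apply: eq_bigr => i _; rewrite linearZ.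
Qed.

Lemma peval_pdiff_comb (b : 'I_N -> bpoly R d N) v K l x :
  peval (pdiff l (comb b v K)) x = \sum_L v L * peval (pdiff l (b L K)) x.
Proof. by rewrite pdiff_sumZ peval_sumZ. Qed.

Lemma linfun_pdiff K l : linfun_at (fun (u : bpoly R d N) x => peval (pdiff l (u K)) x).
Proof.
by split=> [u|b v x]; [exact: nice_peval|exact: peval_pdiff_comb].
Qed.

Lemma linfun_jump F : linfun_at (fun (u : bpoly R d N) => jump u F).
Proof.
split=> [u|b v x]; first exact: nice_jump.
by rewrite /jump !peval_sumZ -sumrB; apply: eq_bigr => L _; rewrite mulrBr.
Qed.

Lemma linfun_avg T F : linfun_at (fun (u : bpoly R d N) => avg_dn T u F).
Proof.
split=> [u|b v x]; first exact: nice_avg.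
transitivity (\sum_(l < d.+1) \sum_L v L * ((normal T F 0 l)%:C%C *
    ((peval (pdiff l (b L F.1.1)) x + peval (pdiff l (b L F.2.1)) x) / 2))).
  apply: eq_bigr => l _; rewrite !peval_pdiff_comb -big_split mulr_suml mulr_sumr.
  by apply: eq_bigr => L _; rewrite /= -mulrDr -mulrA mulrCA.
by rewrite exchange_big; apply: eq_bigr => L _; rewrite mulr_sumr.
Qed.

Variables (Omega : set 'rV[R]_d.+1) (T : mesh R d N).
Hypothesis bT : forall K, bset (elt T K).

Lemma sesq_mass : sesq (mass T).
Proof.
apply: sesq_sum => K.
exact: (sesq_cext (posfun_rint (bT K)) (linfun_peval K) (linfun_peval K)).
Qed.

Lemma sesq_bmass : sesq (bmass Omega T).
Proof.
apply: sesq_sum => F; apply: (@sesq_ext _ (fun u w => cext (rsurf T F)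
    (fun x => peval (u F.1) x * conjc (peval (w F.1) x)))) => [u w|]; first exact: surf_intE.
exact: (sesq_cext (posfun_rsurf T F) (linfun_peval F.1) (linfun_peval F.1)).
Qed.

Lemma sesq_penalty (c : R) F : sesq (fun u w : bpoly R d N => surf_int (fvert T F.1) (fun x =>
  c%:C%C * jump u F x * conjc (jump w F x))).
Proof.
apply: (@sesq_ext _ (fun u w => c%:C%C * cext (rsurf T F.1) (fun x => jump u F x * conjc (jump w F x)))).
  move=> u w; rewrite surf_intE -(cextZ (posfun_rsurf T F.1)); last by apply: nice_sesq; exact: nice_jump.
  by congr (cext _ _); apply/funext => x; rewrite mulrA.
apply: sesqZ.
exact: (sesq_cext (posfun_rsurf T F.1) (linfun_jump F) (linfun_jump F)).
Qed.

Lemma sesq_a_h eta k eps : sesq (a_h Omega T eta k eps).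
Proof.
apply: sesqD; last by apply: sesqZ; exact: sesq_bmass.
apply: sesqD; last first.
  apply: (@sesq_ext _ (fun u w => - ((k ^+ 2)%:C - 'i * eps%:C)%C * mass T u w)).
    by move=> u w; rewrite mulNr.
  by apply: sesqZ; exact: sesq_mass.
apply: sesqD; last by apply: sesq_sum => F; apply: sesqZ; exact: sesq_penalty.
apply: sesqD.
  apply: sesq_sum => K.
  apply: (@sesq_ext _ (fun u w => \sum_l cext (rint (elt T K))
      (fun x => peval (pdiff l (u K)) x * conjc (peval (pdiff l (w K)) x)))).
    move=> u w; rewrite int_onE (cext_sum (posfun_rint (bT K)))// => l.
    by apply: nice_sesq; exact: nice_peval.
  apply: sesq_sum => l.
  exact: (sesq_cext (posfun_rint (bT K)) (linfun_pdiff K l) (linfun_pdiff K l)).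
pose B (F : lface d N * lface d N) (u w : bpoly R d N) :=
  cext (rsurf T F.1) (fun x => jump u F x * conjc (avg_dn T w F x))
  + cext (rsurf T F.1) (fun x => avg_dn T u F x * conjc (jump w F x)).
apply: (@sesq_ext _ (fun u w => -1 * \sum_(F | ifaces T F) B F u w)).
  move=> u w; rewrite mulN1r; congr (- _); apply: eq_bigr => F _; rewrite surf_intE /B.
  rewrite -(cextD (posfun_rsurf T F.1)).
  - by congr (cext _ _); apply/funext => x; congr (_ + _); rewrite mulrC.
  - by apply: nice_sesq; [exact: nice_jump|exact: nice_avg].
  - by apply: nice_sesq; [exact: nice_avg|exact: nice_jump].
apply: sesqZ; apply: sesq_sum => F; apply: sesqD.
  exact: (sesq_cext (posfun_rsurf T F.1) (linfun_jump F) (linfun_avg T F)).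
exact: (sesq_cext (posfun_rsurf T F.1) (linfun_avg T F) (linfun_jump F)).
Qed.

Lemma sesq_a_h0 eta k : sesq (a_h0 Omega T eta k).
Proof.
apply: sesqD; last by apply: sesqZ; exact: sesq_bmass.
apply: sesqD; last by apply: sesqZ; exact: sesq_mass.
by apply: sesq_sum => F; exact: sesq_penalty.
Qed.

Lemma ipP_sesq B (b : 'I_N -> bpoly R d N) (v z : 'cV[C]_N) : sesq B ->
  ipP (\matrix_(K, L) B (b L) (b K)) v z
  = B (comb b (fun K => v K 0)) (comb b (fun K => z K 0)).
Proof.
move=> sB; rewrite sB /ipP mxE; apply: eq_bigr => L _; rewrite mxE; congr (_ * _).
by apply: eq_bigr => K _; rewrite !mxE.
Qed.

Lemma pw0_comb (v : 'I_N -> C) : pw0 d v = comb (fun L => pw0 d (charf R L)) v.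
Proof.
apply/funext => K; rewrite /comb (bigD1 K)//= big1 ?addr0 => [|L LK]; last first.
  by rewrite /pw0 /charf eq_sym (negPf LK) rmorph0 scaler0.
by rewrite /pw0 /charf eqxx rmorph1 mpoly.alg_mpolyC.
Qed.

Lemma ipP_P_mx eta k (v : 'cV[C]_N) :
  ipP (P_mx Omega T eta k) v v = (p0norm eta T (fun K => v K 0) Omega k)%:C%C.
Proof.
rewrite (ipP_sesq (fun L => pw0 d (charf R L)) v v (sesq_a_h0 eta k)) -pw0_comb.
set w := pw0 d _; rewrite /p0norm /a_h0 !rmorphD; congr (_ + _ + _).
- rewrite mulrA mulrAC mulr_sumr rmorph_sum; apply: eq_bigr => F _.
  transitivity ((eta / hmax T)%:C%C * cext (rsurf T F.1) (fun x => jump w F x * conjc (jump w F x))).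
    rewrite surf_intE -(cextZ (posfun_rsurf T F.1)); last by apply: nice_sesq; exact: nice_jump.
    by congr (cext _ _); apply/funext => x; rewrite mulrA.
  rewrite [RHS]rmorphM; congr (_ * _); exact: (cext_sq (posfun_rsurf T F.1)).
- rewrite [RHS]rmorphM; congr (_ * _); rewrite rmorph_sum; apply: eq_bigr => K _.
  exact: (cext_sq (posfun_rint (bT K))).
- rewrite [RHS]rmorphM; congr (_ * _); rewrite rmorph_sum; apply: eq_bigr => F _; rewrite surf_intE.
  exact: (cext_sq (posfun_rsurf T F)).
Qed.

End Rules.

Lemma ipPZ N (P : 'M[C]_N) (a c : R) u v :
  ipP P (a%:C%C *: u) (c%:C%C *: v) = (a * c)%:C%C * ipP P u v.
Proof.
rewrite /ipP (_ : map_mx _ _ = c%:C%C *: map_mx (@conjc R) v^T); last first.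
  by apply/matrixP => i j; rewrite !mxE rmorphM; congr (_ * _); rewrite /= oppr0.
by rewrite -scalemxAr -!scalemxAl scalerA mxE rmorphM.
Qed.

Lemma le2_normc (z : C) : le2 z (normc z).
Proof.
have h a e : `|a| <= Num.sqrt (a ^+ 2 + e ^+ 2) :> R.
  by rewrite -sqrtr_sqr ler_wsqrtr// lerDl sqr_ge0.
by split; rewrite normcE /sq; [|rewrite addrC]; exact: h.
Qed.

End Sesquilinear.

(** * Definiteness of the preconditioner *)

Section Preconditioner.
Variables (R : realType) (d N : nat) (kappa eta k : R).
Variables (Omega : set 'rV[R]_d.+1) (T : mesh R d N) (b : 'I_N -> 'rV[R]_d.+1).
Hypotheses (k0 : 0 < kappa) (eta1 : 1 <= eta) (kgt0 : 0 < k) (rT : regular T kappa b).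
Local Notation C := R[i].

Lemma p0norm_ge_mass (v : 'I_N -> C) : k ^+ 2 * Ms T (pw0 d v) <= p0norm eta T v Omega k.
Proof.
have h1 : 0 <= eta * (Jp T (pw0 d v) / hmax T).
  by rewrite mulr_ge0 ?divr_ge0 ?Jp_ge0 ?(ltW (reg_h rT))// (le_trans ler01).
have h2 : 0 <= k * Bm Omega T (pw0 d v) by rewrite mulr_ge0 ?Bm_ge0// ltW.
rewrite /p0norm; move: (eta * _) (_ * Ms _ _) (_ * Bm _ _ _) h1 h2 => *; lra.
Qed.

Lemma p0norm_ge0 (v : 'I_N -> C) : 0 <= p0norm eta T v Omega k.
Proof.
by apply: le_trans (p0norm_ge_mass v); rewrite mulr_ge0 ?sqr_ge0// Ms_ge0.
Qed.

(** The mass term alone gives definiteness: an element contains a cube, so its volume is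
    positive. *)
Lemma p0norm_eq0 (v : 'I_N -> C) : p0norm eta T v Omega k = 0 -> forall K, v K = 0.
Proof.
move=> v0 K; apply: sq_eq0.
have M0 : Ms T (pw0 d v) <= 0.
  by have := p0norm_ge_mass v; rewrite v0 pmulr_rle0// exprn_gt0.
have : mK T (pw0 d v) K <= 0.
  apply: le_trans M0; rewrite /Ms (bigD1 K)//= lerDl; apply: sumr_ge0 => L _.
  exact: mK_ge0.
rewrite (mK_pw0 v (reg_bset rT K)).
have s0 : 0 < kappa * hmax T by rewrite mulr_gt0 ?(reg_h rT).
have vol0 : 0 < rint (elt T K) (fun=> 1).
  apply: lt_le_trans (_ : (kappa * hmax T) ^+ d.+1 <= _); first exact: exprn_gt0.
  rewrite -(rint_box (b K) (ltW s0)).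
  by apply: rint_le (bset_box _ _) (reg_bset rT K) (lbm_cst _ _) (lbm_cst _ _) (reg_box rT (K := K)) _ _.
by rewrite pmulr_lle0// => h; apply/eqP; rewrite eq_le h sq_ge0.
Qed.

Lemma P_mx_unit : P_mx Omega T eta k \in unitmx.
Proof.
set P := P_mx _ _ _ _.
rewrite -unitmx_tr -row_free_unit -kermx_eq0; apply/eqP/row_matrixP => i; rewrite row0.
set r := row i _; have rP : r *m P^T = 0 by rewrite /r -row_mul mulmx_ker row0.
have Pr : P *m r^T = 0 by apply: trmx_inj; rewrite trmx_mul trmxK rP trmx0.
have : ipP P r^T r^T = 0 by rewrite /ipP -mulmxA Pr mulmx0 mxE.
rewrite (ipP_P_mx Omega (reg_bset rT)) => /eqP; rewrite fmorph_eq0 => /eqP /p0norm_eq0 h.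
by apply/rowP => L; have := h L; rewrite !mxE.
Qed.

Lemma normP_P_mx (v : 'cV[C]_N) :
  normP (P_mx Omega T eta k) v = Num.sqrt (p0norm eta T (fun K => v K 0) Omega k).
Proof. by rewrite /normP (ipP_P_mx Omega (reg_bset rT)). Qed.

End Preconditioner.

Section Scaling.
Variables (R : realType) (N : nat).
Local Notation C := R[i].
Implicit Types (A P : 'M[C]_N) (v : 'cV[C]_N) (p : 'cV[C]_N -> R).

Lemma ipP_invmx A P u w : P \in unitmx -> ipP P (invmx P *m (A *m u)) w = ipP A u w.
Proof. by move=> PU; rewrite /ipP -[_ *m P *m _]mulmxA (mulKVmx PU) mulmxA. Qed.

(* The additive bound is applied to (s v, y / s); optimizing in s makes it multiplicative. *)
Lemma norm_le_of_additive_bound A P p M v y :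
  (forall u, ipP P u u = (p u)%:C%C) -> (forall u, 0 <= p u) -> 0 < M ->
  (forall u w, `|complex.Re (ipP A u w)| <= M * (p u + p w)) ->
  ipP P y y = ipP A v y -> p y <= (2 * M) ^+ 2 * p v.
Proof.
move=> pE p0 M0 hA yE.
have pZ c u : p (c%:C%C *: u) = c ^+ 2 * p u.
  have := ipPZ P c c u u; rewrite !pE -rmorphM /= -expr2 => /(congr1 (@complex.Re R)).
  by [].
(* With [s ^+ 2 = 2 * M] the term in [y] is half of the left side and is absorbed. *)
pose s := Num.sqrt (2 * M); have s20 : 0 < 2 * M by rewrite mulr_gt0.
have s0 : 0 < s by rewrite sqrtr_gt0.
have s2 : s ^+ 2 = 2 * M by rewrite sqr_sqrtr// ltW.
have := hA (s%:C%C *: v) ((s^-1)%:C%C *: y).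
rewrite ipPZ divff ?gt_eqF// mul1r -yE pE !pZ exprVn s2 /= ger0_norm// => h.
have : M * ((2 * M)^-1 * p y) = p y / 2 by field; rewrite gt_eqF.
rewrite mulrDr in h; move=> e; rewrite e in h.
have -> : (2 * M) ^+ 2 * p v = 2 * (M * (2 * M * p v)) by ring.
by move: (p y) (M * (2 * M * p v)) h => a c; lra.
Qed.

End Scaling.

Unset Implicit Arguments.

Theorem theorem6 (R : realType) (d : nat) (hd : d.+1 = 2%N \/ d.+1 = 3%N)
    (Omega : set 'rV[R]_d.+1) (hOmega : polyhedral_lipschitz_domain Omega)
    (nu : R) (hnu : 0 < nu) (m : nat) (hm : (1 <= m)%N) (thr : nat)
    (ceps chk : R) (hceps : 0 < ceps) (hchk : 0 < chk) :
  exists2 eta0 : R, 0 < eta0 &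
  forall eta : R, eta0 <= eta ->
  exists C1 C2 : R, [/\ 0 < C1, 0 < C2 &
  forall (N : nat) (T : mesh R d N) (xc : 'I_N -> 'rV[R]_d.+1) (k eps : R),
    admissible Omega nu m thr T xc ->
    0 < k -> 0 < eps -> eps <= ceps * k ^+ 2 -> hmax T * k <= chk ->
    let A := A_eps Omega T xc m thr eta k eps in
    let P := P_mx Omega T eta k in
    (forall v : 'cV[R[i]]_N,
       normP P (invmx P *m (A *m v)) <= C1 * Lambda_m T xc m thr ^+ 2 * normP P v)
    /\
    (forall v : 'cV[R[i]]_N,
       (C2 * (eps / k ^+ 2))%:C * ipP P v v
         <= `| ipP P (invmx P *m (A *m v)) v |)].
Proof.
have dd : (0 < d <= 2)%N by case: hd => [[->]|[->]].
have d0 : (0 < d)%N by case/andP: dd.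
(* From 1 on, [eta / h_F] is at least [1 / h], so the penalty in the imaginary part dominates the
   jump term of the energy with constant 1. *)
exists 1 => // eta eta1.
have [kappa [k0 k1 regT]] := mesh_regular dd hnu.
have [ca ca0 havg] := avg_energy_le d m k0 k1.
have [c4 c40 h4] := p0norm_le_energy d m k0 k1 eta1 hchk.
have [c5 c50 h5] := recon_energy_le m d0 k0 k1 eta1 hchk thr.
have e0 : 0 < eta by apply: lt_le_trans eta1.
pose Ct := 4 + ca + eta / kappa + ceps.
have Ct0 : 0 < Ct.
  have : 0 < eta / kappa by rewrite divr_gt0.
  by rewrite /Ct; move: (eta / kappa) ca0 hceps => q *; lra.
pose Cc := (4 + 16 * ca) * ceps + 3.
have Cc0 : 0 < Cc.
  have : 0 < (4 + 16 * ca) * ceps by rewrite mulr_gt0// addr_gt0// mulr_gt0.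
  by rewrite /Cc; move: (_ * ceps) => q *; lra.
(* [Ct] bounds the form by energies and [c5] the energy of a reconstruction; the 2 comes from
   [norm_le_of_additive_bound]. Conversely, [Cc] bounds the energy by the form and [c4] the
   preconditioner norm by the energy. All are fixed before the mesh, [k] and [eps]. *)
exists (2 * (Ct * c5)), (c4 * Cc)^-1; split.
- by rewrite mulr_gt0// mulr_gt0.
- by rewrite invr_gt0 mulr_gt0.
move=> N T xc k eps [meshT quT xcT _ uniT] kgt0 eps0 epsk hk /=.
(* Without elements both matrices are empty. This case is set apart because [hmax] and [Lambda_m]
   are then the default 0 of an empty maximum. *)
have [N0|Npos] := posnP N.
  move: T xc meshT quT xcT uniT hk; rewrite N0 => T xc _ _ _ _ _.
  have ip0 (P : 'M[R[i]]_0) u v : ipP P u v = 0 by rewrite /ipP mxE big_ord0.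
  by split=> v; rewrite /normP ?ip0 ?mulr0 ?normr0//= sqrtr0 mulr0.
have [TU dis _ _] := meshT.
have [b rT] := regT N T Npos TU quT.
pose R_ (v : 'cV[R[i]]_N) := lin_recon T xc m thr (fun K => v K 0).
set A := A_eps _ _ _ _ _ _ _ _; set P := P_mx _ _ _ _.
set Lam := Lambda_m T xc m thr.
have PU : P \in unitmx by exact: (P_mx_unit Omega k0 eta1 kgt0 rT).
pose p (v : 'cV[R[i]]_N) := p0norm eta T (fun K => v K 0) Omega k.
have pE v : ipP P v v = (p v)%:C by exact: (ipP_P_mx Omega (reg_bset rT)).
have p0 v : 0 <= p v by exact: (p0norm_ge0 Omega eta1 kgt0 rT).
have AE v w : ipP A v w = a_h Omega T eta k eps (R_ v) (R_ w).
  exact: (ipP_sesq (fun L => recon T xc m thr (charf R L)) v w (sesq_a_h Omega (reg_bset rT) eta k eps)).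
have PA v w : ipP P (invmx P *m (A *m v)) w = ipP A v w by exact: ipP_invmx.
have du v K : deg_le m (R_ v K) by case: (lin_recon_is_fit T xc m thr (fun K => v K 0) K).
have av v := havg N T b (R_ v) rT dis (du v).
have Lam1 : 1 <= Lam by case: (Lambda_m_ge T xc m thr (Ordinal Npos)).
have ER v : energy Omega T k (R_ v) <= c5 * Lam ^+ 2 * p v by exact: (h5 N Omega T b).
split=> v.
- set y := invmx P *m (A *m v).
  have L20 : 0 < Lam ^+ 2 by rewrite exprn_gt0// (lt_le_trans ltr01).
  pose M := Ct * (c5 * Lam ^+ 2).
  have M0 : 0 < M by rewrite mulr_gt0// mulr_gt0.
  have := @norm_le_of_additive_bound R N A P p M v y pE p0 M0.
  have hA u w : `|complex.Re (ipP A u w)| <= M * (p u + p w).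
    rewrite AE; have [h _] := a_h_le2 k0 eta1 hceps rT kgt0 eps0 epsk Omega (ltW ca0) (av u) (av w).
    apply: le_trans h _; rewrite /M -mulrA ler_wpM2l ?(ltW Ct0)// mulrDr.
    by apply: lerD; exact: ER.
  move=> /(_ hA); rewrite PA => /(_ erefl) h.
  rewrite /P !(normP_P_mx eta k Omega rT) -/(p v) -/(p y).
  apply: le_trans (ler_wsqrtr h) _.
  rewrite sqrtrM ?sqr_ge0// sqrtr_sqr (ger0_norm (mulr_ge0 (ler0n _ 2) (ltW M0))).
  by rewrite /M !mulrA.
- rewrite PA pE AE; set a := a_h _ _ _ _ _ _ _.
  have hE := energy_le_a_h k0 eta1 hceps rT kgt0 eps0 epsk ca0 (av v) (le2_normc a).
  have hP : p v <= c4 * energy Omega T k (R_ v).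
    (* The constraint of the fit makes the reconstruction take the value [v K] at the collocation
       point of [K]. *)
    apply: (h4 N Omega T b (R_ v)) => // K; exists (xc K) => //.
    by case: (lin_recon_is_fit T xc m thr (fun K => v K 0) K).
  rewrite normc_def -rmorphM lecR.
  suff : (c4 * Cc)^-1 * (eps / k ^+ 2) * p v <= normc a by rewrite normcE.
  have k20 : 0 < k ^+ 2 by rewrite exprn_gt0.
  have {}hP : p v <= c4 * (Cc * (k ^+ 2 / eps * normc a)).
    by apply: le_trans hP _; rewrite ler_wpM2l ?(ltW c40).
  have q0 : 0 <= (c4 * Cc)^-1 * (eps / k ^+ 2) by rewrite mulr_ge0 ?invr_ge0 ?divr_ge0 ?mulr_ge0 ?ltW.
  apply: le_trans (ler_wpM2l q0 hP) _; move: (normc a) => X.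
  rewrite le_eqVlt; apply/orP; left; apply/eqP; field.
  by rewrite !gt_eqF.
Qed.
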